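(* Let $k\ge1$ be an integer, $\lambda,\mu>0$, $\theta>0$, $\alpha\in(0,1)$. The sojourn times $S^{\theta,\alpha}$ of the queue length process $\{L^{\theta,\alpha}(t)\}_{t\ge0}$ of the tempered Erlang queue in a non-zero state are independent and identically distributed with \begin{equation*} \Pr(S^{\theta,\alpha}>t)=e^{-\theta t}\sum_{q=0}^{\infty}(\theta t)^q\sum_{r=0}^{\infty}(-(\lambda+k\mu) t^\alpha)^rE_{\alpha, r\alpha+q+1}^r(\theta^\alpha t^\alpha),\qquad t\ge0. \end{equation*}
   Context: Erlang queue: $\{Q(t)\}_{t\ge0}$, $Q(t)=(N(t),S(t))$, is the continuous-time Markov chain on $\{(0,0)\}\cup S$, $S=\{(n,s)\in\mathbb{N}\times\mathbb{N}: n\ge1,\ 1\le s\le k\}$, started at $(0,0)$, with Poisson arrivals of rate $\lambda$ and Erlang service with $k$ phases each exponential of rate $k\mu$; transition rates: $(0,0)\to(1,k)$ and $(n,s)\to(n+1,s)$ at rate $\lambda$; $(n,s)\to(n,s-1)$ at rate $k\mu$ for $s\ge2$; $(n,1)\to(n-1,k)$ at rate $k\mu$ for $n\ge2$; $(1,1)\to(0,0)$ at rate $k\mu$. Let $D_{\theta,\alpha}$ be the subordinator with $\mathbb{E}e^{-sD_{\theta,\alpha}(t)}=e^{-t((s+\theta)^\alpha-\theta^\alpha)}$, $Y_{\theta,\alpha}(t)=\inf\{x>0:D_{\theta,\alpha}(x)>t\}$ independent of $Q$, and $Q^{\theta,\alpha}(t)=Q(Y_{\theta,\alpha}(t))$.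 Queue length process: $L^{\theta,\alpha}(t)=g_k(Q^{\theta,\alpha}(t))$ with $g_k(n,s)=k(n-1)+s$, $g_k(0,0)=0$. A sojourn time is the time $L^{\theta,\alpha}$ spends in a state before transitioning to another state. Three-parameter Mittag-Leffler function: $E_{\alpha,b}^{\gamma}(x)=\sum_{j\ge0}\frac{(\gamma)_j x^j}{j!\Gamma(\alpha j+b)}$ with Pochhammer symbol $(\gamma)_j$, $(\gamma)_0=1$ (so $E^0_{\alpha,b}(x)=1/\Gamma(b)$). *)

(* Defs.v *)
From HB Require Import structures.
From mathcomp Require Import all_boot all_order all_algebra.
From mathcomp Require Import all_classical all_reals all_analysis.
Set Implicit Arguments. Unset Strict Implicit. Unset Printing Implicit Defensive.
Import Order.TTheory GRing.Theory Num.Theory.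
Import numFieldNormedType.Exports.
Local Open Scope classical_set_scope.
Local Open Scope ring_scope.

Section Defs.
Variable R : realType.

Definition Gamma (x : R) : R :=
  Rintegral (@lebesgue_measure R) `]0, +oo[%classic
    (fun u => powR u (x - 1) * expR (- u)).

Definition poch (g : R) (j : nat) : R := \prod_(i < j) (g + i%:R).

Definition ML3 (a b g x : R) : R :=
  limn (series (fun j : nat => poch g j * x ^+ j / (j`!%:R * Gamma (a * j%:R + b)))).

Definition sojourn_survival (k : nat) (la mu th al t : R) : R :=
  expR (- (th * t)) *
  limn (series (fun q : nat =>
     (th * t) ^+ q *
     limn (series (fun r : nat =>
        (- ((la + k%:R * mu) * powR t al)) ^+ r *
        ML3 al (r%:R * al + q%:R + 1) r%:R (powR th al * powR t al))))).

(* the state reached by a phase completion (rate k mu) from (n,s), n >= 1 *)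
Definition phase_down (k : nat) (x : nat * nat) : nat * nat :=
  if (2 <= x.2)%N then (x.1, x.2.-1)
  else if (2 <= x.1)%N then (x.1.-1, k) else (0, 0)%N.

Definition exit_rate (k : nat) (la mu : R) (x : nat * nat) : R :=
  if x == (0, 0)%N then la else la + k%:R * mu.

Definition jump_prob (k : nat) (la mu : R) (x y : nat * nat) : R :=
  if x == (0, 0)%N then (y == (1, k)%N)%:R
  else ((y == (x.1.+1, x.2))%:R * la + (y == phase_down k x)%:R * (k%:R * mu))
       / (la + k%:R * mu).

Context {d : measure_display} {T : measurableType d}.

Definition jtime (H : nat -> T -> R) (n : nat) (w : T) : R := \sum_(i < n) H i w.

Definition ctmc_path (X : nat -> T -> nat * nat) (H : nat -> T -> R) (t : R) (w : T)
  : nat * nat :=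
  X (xget 0%N [set m | jtime H m w <= t < jtime H m.+1 w]) w.

(** (X,H) is the jump chain / holding-time description (Norris, Def. of CTMC)
    of the CTMC with the Erlang-queue rates, started at (0,0); paths are
    regular (positive holding times, no explosion). *)
Definition erlang_jump_hold (P : probability T R) (k : nat) (la mu : R)
  (X : nat -> T -> nat * nat) (H : nat -> T -> R) : Prop :=
  [/\ (forall n x, measurable (X n @^-1` [set x])),
      (forall n, measurable_fun setT (H n)),
      (forall n w, 0 < H n w),
      (forall w t, exists n, t < jtime H n w) &
      (forall (n : nat) (x : nat -> nat * nat) (s : nat -> R),
          (forall i, 0 <= s i) ->
          P [set w | (forall i, (i <= n)%N -> X i w = x i) /\
                     (forall i, (i < n)%N -> s i < H i w)]
          = (((x 0%N == (0, 0)%N)%:R *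
              \prod_(i < n) (jump_prob k la mu (x i) (x i.+1) *
                             expR (- (exit_rate k la mu (x i) * s i)))) : R)%:E)].

Definition mutual_indep (P : probability T R) (n : nat) (Z : 'I_n -> T -> R) : Prop :=
  forall B : 'I_n -> set R, (forall i, measurable (B i)) ->
    P [set w | forall i, B i (Z i w)] = (\prod_(i < n) P (Z i @^-1` B i))%E.

Definition tempered_subordinator (P : probability T R) (th al : R)
  (D : R -> T -> R) : Prop :=
     (forall t, measurable_fun setT (D t)) /\
      (forall w, D 0 w = 0) /\
      (forall w s t, 0 <= s -> s <= t -> D s w <= D t w) /\
      (forall w t, 0 <= t -> ((fun u => D u w) @ at_right t --> D t w)) /\
      (forall (n : nat) (t : nat -> R), 0 <= t 0%N ->
          (forall i, t i <= t i.+1) ->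
          mutual_indep P (fun i : 'I_n => fun w => D (t i.+1) w - D (t i) w)) /\
      (forall t h B, 0 <= t -> 0 <= h -> measurable B ->
          P ((fun w => D (t + h) w - D t w) @^-1` B) = P (D h @^-1` B)) /\
      (forall t s, 0 <= t -> 0 <= s ->
          (\int[P]_w (expR (- (s * D t w)))%:E)%E
          = (expR (- (t * (powR (s + th) al - powR th al))))%:E).

Definition indep_processes (P : probability T R)
  (Q : R -> T -> nat * nat) (D : R -> T -> R) : Prop :=
  forall A B,
    <<s [set A' | exists t x, 0 <= t /\ A' = Q t @^-1` [set x]] >> A ->
    <<s [set B' | exists t (C : set R), [/\ 0 <= t, measurable C & B' = D t @^-1` C]] >> B ->
    P (A `&` B) = (P A * P B)%E.

Definition inv_sub (D : R -> T -> R) (t : R) (w : T) : R :=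
  inf [set x | 0 < x /\ t < D x w].

Definition gk (k : nat) (x : nat * nat) : nat :=
  if x == (0, 0)%N then 0%N else (k * x.1.-1 + x.2)%N.

Definition qlen (k : nat) (Q : R -> T -> nat * nat) (D : R -> T -> R) (t : R) (w : T)
  : nat := gk k (Q (inv_sub D t w) w).

Fixpoint trans_time (L : R -> T -> nat) (n : nat) (w : T) : R :=
  match n with
  | 0%N => 0
  | m.+1 => inf [set u | trans_time L m w < u /\ L u w != L (trans_time L m w) w]
  end.

Definition nz_visit (L : R -> T -> nat) (n : nat) (w : T) : nat :=
  xget 0%N [set m | L (trans_time L m w) w != 0%N /\
                    (\sum_(i < m) (L (trans_time L i w) w != 0%N))%N = n].

Definition nz_sojourn (L : R -> T -> nat) (n : nat) (w : T) : R :=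
  trans_time L (nz_visit L n w).+1 w - trans_time L (nz_visit L n w) w.

End Defs.

(* Main.v *)
Require Import Defs.
From HB Require Import structures.
From mathcomp Require Import all_boot all_order all_algebra.
From mathcomp Require Import all_classical all_reals all_analysis.
From mathcomp Require Import measurable_realfun exponential_distribution ring lra zify.
Set Implicit Arguments. Unset Strict Implicit. Unset Printing Implicit Defensive.
Import Order.TTheory GRing.Theory Num.Theory.
Import numFieldNormedType.Exports.
Local Open Scope classical_set_scope.
Local Open Scope ring_scope.

(* Let [J_m] be the jump times of the queue and [psi] the Laplace exponent of the
   subordinator [D].  Since [D] almost surely increases strictly to infinity, the
   time-changed queue length visits the same states in the same order, its [m]-th
   transition taking place at [tau_m = D (J_m -)].  Rounding the holding times down
   to a grid and using that [D] has independent stationary increments and is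
   independent of the queue gives, in the limit,
     E[1_{X = x} prod exp(-s_i (tau_{i+1} - tau_i))] = P(X = x) prod q_i / (q_i + psi s_i)
   with [q_i] the exit rate of [x_i].  The exit rate of every non-zero state is
   [c = la + k mu]; summing over the paths [x], the sojourns in non-zero states have
   joint Laplace transform [prod c / (c + psi s_j)], whence independence.
   The function [t^x / Gamma(x+1)] has Laplace transform [s^(-x-1)] and is at most
   [z^(-x) e^(z t)] for every [z > 0]; for large [z] this bound makes the triple series
   of the statement converge geometrically, and its transform sums to
   [psi s / (s (c + psi s))], the transform of [P(S > t)].  Both functions of [t] are
   right-continuous, so they coincide. *)

(** * Uniqueness of the Laplace transform *)

(** Increments of [D] are independent at deterministic times only. The rounded holding times take
    countably many values, so on each fibre the jump times are constants, and the fibre meets the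
    path event in an event of the sigma-algebra of the queue. Uniqueness is stated for integrals of
    [W f(Z)] with an integrable weight [W], not for laws: the weight absorbs the other coordinates,
    so a joint formula is extended from special test functions to general ones one coordinate at a
    time, and a signed weight also covers functions on the half-line. The state 0 has a different
    exit rate. Its visits receive the parameter [s = 0], where [psi] vanishes, so they contribute a
    factor 1; and since 0 is never followed by 0, the first [2 N] transitions contain [N] visits to
    non-zero states. Sojourns are known to be positive only almost surely, whereas the uniqueness
    lemmas want variables that are nonnegative everywhere: the argument runs on absolute values,
    removed at the end. *)

Section BoundedIntegration.
Context {d} {T : measurableType d} {R : realType} (mu : {measure set T -> \bar R}).

Lemma integrable_mul_bounded (W f : T -> R) (M : R) :
  mu.-integrable setT (EFin \o W) -> measurable_fun setT f ->
  (forall x, `|f x| <= M) ->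
  mu.-integrable setT (EFin \o (fun x => W x * f x)).
Proof.
move=> iW mf fM.
have mW : measurable_fun setT W by exact/measurable_EFinP/(measurable_int mu).
have iM : mu.-integrable setT (EFin \o (fun x => M * W x)).
  by have := integrableZl measurableT M iW; apply: eq_integrable.
apply: le_integrable iM => //.
  by apply/measurable_EFinP; exact: measurable_funM.
move=> x _ /=; rewrite lee_fin !normrM mulrC ler_wpM2r//.
by rewrite (le_trans (fM x))// ler_norm.
Qed.

Lemma bounded_cvg_Rintegral (W f : T -> R) (g : nat -> T -> R) (M : R) :
  mu.-integrable setT (EFin \o W) -> (forall n, measurable_fun setT (g n)) ->
  (forall n x, `|g n x| <= M) -> (forall x, g ^~ x @ \oo --> f x) ->
  (\int[mu]_x (W x * g n x)) @[n --> \oo] --> \int[mu]_x (W x * f x).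
Proof.
move=> iW mg gM gf.
have mW : measurable_fun setT W by exact/measurable_EFinP/(measurable_int mu).
have iM : mu.-integrable setT (EFin \o (fun x => M * `|W x|)).
  have := integrableZl measurableT M (integrable_abse iW).
  by apply: eq_integrable.
have mf : measurable_fun setT f.
  by apply: (measurable_fun_cvg mg) => x _; exact: gf.
have fM x : `|f x| <= M.
  have h : `|g n x| @[n --> \oo] --> `|f x| by apply: cvg_norm; exact: gf.
  by apply: (cvgr_to_le h); apply: nearW => n; exact: gM.
have iWg n := integrable_mul_bounded iW (mg n) (gM n).
have iWf := integrable_mul_bounded iW mf fM.
apply: fine_cvg.
rewrite fineK; last exact: integrable_fin_num.
apply: (@dominated_cvg _ _ _ mu setT measurableT
  (fun n x => (W x * g n x)%:E) (fun x => (W x * f x)%:E) (fun x => (M * `|W x|)%:E)) => //.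
- by move=> n; apply/measurable_EFinP; exact: measurable_funM.
- move=> x _; apply: cvg_EFin; first exact: nearW.
  by apply: cvgM => //; exact: cvg_cst.
- move=> n x _ /=; rewrite lee_fin normrM mulrC ler_wpM2r//.
Qed.

End BoundedIntegration.

Section PairingTransfer.
Context {d d'} {T : measurableType d} {T' : measurableType d'} {R : realType}.
Variables (mu : {measure set T -> \bar R}) (mu' : {measure set T' -> \bar R}).
Variables (W Z : T -> R) (W' Z' : T' -> R).
Hypotheses (iW : mu.-integrable setT (EFin \o W))
  (iW' : mu'.-integrable setT (EFin \o W')).
Hypotheses (mZ : measurable_fun setT Z) (mZ' : measurable_fun setT Z').
Hypotheses (Z0 : forall x, 0 <= Z x) (Z'0 : forall x, 0 <= Z' x).

Implicit Types f g : R -> R.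

(** The image under [Z] of the signed measure of density [W] and the image under [Z'] of that of
    density [W'] agree on [f]. *)
Definition same_pairing (f : R -> R) : Prop :=
  \int[mu]_x (W x * f (Z x)) = \int[mu']_x (W' x * f (Z' x)).

Lemma same_pairing_eq f g :
  (forall z, 0 <= z -> f z = g z) -> same_pairing f -> same_pairing g.
Proof.
move=> fg; rewrite /same_pairing.
have -> : \int[mu]_x (W x * f (Z x)) = \int[mu]_x (W x * g (Z x)).
  by apply: eq_Rintegral => x _; rewrite fg.
by have -> : \int[mu']_x (W' x * f (Z' x)) = \int[mu']_x (W' x * g (Z' x));
  first by apply: eq_Rintegral => x _; rewrite fg.
Qed.

Lemma same_pairingB f g (M N : R) :
  measurable_fun setT f -> (forall z, `|f z| <= M) ->
  measurable_fun setT g -> (forall z, `|g z| <= N) ->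
  same_pairing f -> same_pairing g -> same_pairing (fun z => f z - g z).
Proof.
move=> mf fM mg gN; rewrite /same_pairing => Kf Kg.
under eq_Rintegral do rewrite mulrBr.
under [RHS]eq_Rintegral do rewrite mulrBr.
rewrite !RintegralB ?Kf ?Kg//.
- by apply: integrable_mul_bounded iW' _ (fun x => fM (Z' x)); exact: measurableT_comp.
- by apply: integrable_mul_bounded iW' _ (fun x => gN (Z' x)); exact: measurableT_comp.
- by apply: integrable_mul_bounded iW _ (fun x => fM (Z x)); exact: measurableT_comp.
- by apply: integrable_mul_bounded iW _ (fun x => gN (Z x)); exact: measurableT_comp.
Qed.

Lemma same_pairing0 : same_pairing (fun=> 0).
Proof.
rewrite /same_pairing.
by under eq_Rintegral do rewrite mulr0; under [RHS]eq_Rintegral do rewrite mulr0;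
  rewrite !Rintegral_cst// !mul0r.
Qed.

Lemma same_pairingZ k f (M : R) :
  measurable_fun setT f -> (forall z, `|f z| <= M) ->
  same_pairing f -> same_pairing (fun z => k * f z).
Proof.
move=> mf fM; rewrite /same_pairing => Kf.
under eq_Rintegral do rewrite mulrCA.
under [RHS]eq_Rintegral do rewrite mulrCA.
rewrite !RintegralZl ?Kf//.
- by apply: integrable_mul_bounded iW' _ (fun x => fM (Z' x)); exact: measurableT_comp.
- by apply: integrable_mul_bounded iW _ (fun x => fM (Z x)); exact: measurableT_comp.
Qed.

Lemma same_pairingD f g (M N : R) :
  measurable_fun setT f -> (forall z, `|f z| <= M) ->
  measurable_fun setT g -> (forall z, `|g z| <= N) ->
  same_pairing f -> same_pairing g -> same_pairing (fun z => f z + g z).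
Proof.
move=> mf fM mg gN Kf Kg.
have Kg' : same_pairing (fun z => -1 * g z) by exact: same_pairingZ gN Kg.
have mg' : measurable_fun setT (fun z => -1 * g z) by exact: measurable_funM.
have g'N z : `|-1 * g z| <= N by rewrite mulN1r normrN.
have := same_pairingB mf fM mg' g'N Kf Kg'.
by apply: same_pairing_eq => z _; rewrite mulN1r opprK.
Qed.

Lemma same_pairing_sum (f : nat -> R -> R) (M : R) n :
  (forall i, measurable_fun setT (f i)) -> (forall i z, `|f i z| <= M) ->
  (forall i, (i < n)%N -> same_pairing (f i)) ->
  same_pairing (fun z => \sum_(i < n) f i z).
Proof.
move=> mf fM; elim: n => [|n IH] Kf.
  by apply: (same_pairing_eq _ same_pairing0) => z _; rewrite big_ord0.
apply: (@same_pairing_eq (fun z => \sum_(i < n) f i z + f n z)).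
  by move=> z _; rewrite big_ord_recr.
apply: (@same_pairingD _ _ (\sum_(i < n) M) M) => //.
- exact: measurable_sum.
- by move=> z; apply: le_trans (ler_norm_sum _ _ _) _; exact: ler_sum.
- by apply: IH => i ilt; apply: Kf; rewrite ltnS ltnW.
- exact: Kf.
Qed.

Lemma same_pairing_lim (g : nat -> R -> R) (f : R -> R) (M : R) :
  (forall n, measurable_fun setT (g n)) -> (forall n z, `|g n z| <= M) ->
  (forall z, 0 <= z -> g ^~ z @ \oo --> f z) ->
  (forall n, same_pairing (g n)) -> same_pairing f.
Proof.
move=> mg gM gf Kg.
have h1 := @bounded_cvg_Rintegral _ _ _ mu W (f \o Z) (fun n => g n \o Z) M iW
  (fun n => measurableT_comp (mg n) mZ) (fun n x => gM n (Z x))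
  (fun x => gf _ (Z0 x)).
have h2 := @bounded_cvg_Rintegral _ _ _ mu' W' (f \o Z') (fun n => g n \o Z') M iW'
  (fun n => measurableT_comp (mg n) mZ') (fun n x => gM n (Z' x))
  (fun x => gf _ (Z'0 x)).
have e : (fun n => \int[mu]_x (W x * (g n \o Z) x)) =
         (fun n => \int[mu']_x (W' x * (g n \o Z') x)).
  by apply/funext => n; exact: Kg.
rewrite e in h1.
exact: cvg_unique h1 h2.
Qed.

(* Binning the values of [f] into [n] levels writes it, up to [1/n], as a
   combination of indicators. *)
Lemma same_pairing_fun :
  (forall B, measurable B -> same_pairing \1_B) ->
  forall f, measurable_fun setT f -> (forall z, 0 <= f z <= 1) -> same_pairing f.
Proof.
move=> KB f mf f01.
pose B n j := [set z | j.+1%:R / n.+1%:R <= f z].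
have mB n j : measurable (B n j).
  have := mf measurableT `[j.+1%:R / n.+1%:R, +oo[%classic (measurable_itv _).
  rewrite setTI; congr measurable; apply/seteqP; split => z /=;
    by rewrite /B/= in_itv/= andbT.
pose g n z := n.+1%:R^-1 * \sum_(j < n.+1) (\1_(B n j) z : R).
(* The levels [j + 1] not exceeding [(n+1) f z] are counted by its integer part; [f z <= 1] ensures
   that [n + 1] levels suffice. *)
have gE n z : g n z = (Num.truncn (n.+1%:R * f z))%:R / n.+1%:R.
  rewrite /g mulrC; congr (_ / _).
  have /andP[f0 f1] := f01 z.
  set m := Num.truncn _.
  have mn : (m <= n.+1)%N.
    rewrite -(ler_nat R); apply: le_trans (_ : n.+1%:R * f z <= _).
      by rewrite truncn_le mulr_ge0.
    by rewrite ler_piMr.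
  rewrite (eq_bigr (fun j : 'I_n.+1 => (nat_of_bool (j < m)%N)%:R)); last first.
    move=> j _; rewrite indicE; congr (nat_of_bool _)%:R.
    have -> : (z \in B n j) = (j.+1%:R / n.+1%:R <= f z).
      by apply/idP/idP; rewrite inE.
    by rewrite ler_pdivrMr// [_ * n.+1%:R]mulrC /m truncn_gt_nat.
  rewrite -natr_sum; congr (_%:R).
  rewrite -(subnKC mn) big_split_ord/=.
  rewrite (eq_bigr (fun=> 1%N)); last by move=> i _; rewrite /= ltn_ord.
  rewrite sum1_card card_ord [X in (_ + X)%N]big1 ?addn0// => i _.
  by rewrite ltnNge leq_addr.
apply: (@same_pairing_lim g _ 1).
- move=> n; apply: measurable_funM => //; apply: measurable_sum => j.
  exact: measurable_indic.
- move=> n z; rewrite gE ger0_norm ?divr_ge0// ler_pdivrMr// mul1r.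
  have /andP[f0 f1] := f01 z.
  apply: le_trans (_ : n.+1%:R * f z <= _); first by rewrite truncn_le mulr_ge0.
  by rewrite ler_piMr.
- move=> z _; apply/cvgrPdist_le => /= e e0.
  near=> n.
  have /andP[f0 f1] := f01 z.
  have /andP[h1 h2] := truncn_itv (mulr_ge0 (ler0n R n.+1) f0).
  rewrite gE; apply: le_trans (_ : n.+1%:R^-1 <= _).
    rewrite -[X in `|X - _|](@mulfK _ n.+1%:R) ?pnatr_eq0// -mulrBl normrM.
    rewrite (@ger0_norm _ n.+1%:R^-1)// ler_piMl//.
    rewrite (mulrC n.+1%:R) in h1 h2 *; set m := Num.truncn _ in h1 h2 *.
    by rewrite -[m.+1%:R]natr1 in h2; rewrite ger0_norm; lra.
  have ne : e^-1 <= n%:R by near: n; exact: nbhs_infty_ger.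
  by rewrite invf_ple ?posrE// (le_trans ne)// ler_nat.
- move=> n; apply: (@same_pairingZ _ (fun z => \sum_(j < n.+1) (\1_(B n j) z : R)) (\sum_(j < n.+1) 1)).
  + by apply: measurable_sum => j; exact: measurable_indic.
  + move=> z; apply: le_trans (ler_norm_sum _ _ _) _; apply: ler_sum => j _.
    by rewrite indicE ger0_norm//; case: (_ \in _).
  + apply: (@same_pairing_sum (fun j => \1_(B n j)) 1).
    * by move=> j; exact: measurable_indic.
    * by move=> j z; rewrite indicE ger0_norm//; case: (_ \in _).
    * by move=> j _; exact: KB.
Unshelve. all: by end_near. Qed.

Lemma sum_indic_trivIset (S : Type) (F : nat -> set S) n z : trivIset setT F ->
  \sum_(i < n) \1_(F i) z =
  (`[< exists i : nat, (i < n)%N /\ F i z >])%:R :> R.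
Proof.
move=> tF; case: asboolP => [[i [ilt Fiz]]|nF].
  rewrite (bigD1 (Ordinal ilt))//= indicE mem_set// big1 ?addr0// => j ji.
  rewrite indicE memNset// => Fjz; move/eqP: ji; apply; apply: val_inj => /=.
  by apply: (tF j i) => //; exists z.
rewrite big1// => i _; rewrite indicE memNset// => Fiz.
by apply: nF; exists i; split.
Qed.

(** Disjointness keeps the partial sums of indicators at most 1, the uniform bound that
    [same_pairing_lim] asks for. *)
Lemma same_pairing_bigcup (F : nat -> set R) :
  (forall i, measurable (F i)) -> trivIset setT F ->
  (forall i, same_pairing \1_(F i)) -> same_pairing \1_(\bigcup_i F i).
Proof.
move=> mF tF KF.
have i1 (B : set R) z : `|\1_B z : R| <= 1.
  by rewrite indicE ger0_norm//; case: (_ \in _).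
apply: (@same_pairing_lim (fun n z => \sum_(i < n) \1_(F i) z) _ 1).
- by move=> n; apply: measurable_sum => i; exact: measurable_indic.
- move=> n z; rewrite sum_indic_trivIset//; case: asboolP => _.
    by rewrite normr1.
  by rewrite normr0.
- move=> z _; apply: cvg_near_cst; have [[i _ Fiz]|nF] := pselect ((\bigcup_k F k) z).
    exists i.+1 => // n /= ilt; rewrite sum_indic_trivIset// indicE mem_set; last by exists i.
    by rewrite asboolT//; exists i.
  exists 0%N => // n _; rewrite sum_indic_trivIset// indicE memNset// asboolF// => -[i [_ Fiz]].
  by apply: nF; exists i.
- by move=> n; apply: (@same_pairing_sum (fun i => \1_(F i)) 1).
Qed.

(** Dynkin's theorem: open half-lines are stable under intersection and generate the Borel sets. A
    half-line with [a < 0] contains every value of [Z] and [Z'], so there its indicator acts as the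
    constant 1. *)
Lemma same_pairing_set :
  same_pairing (fun=> 1) ->
  (forall a, 0 <= a -> same_pairing \1_(`]a, +oo[%classic : set R)) ->
  forall B, measurable B -> same_pairing \1_B.
Proof.
move=> K1 Kt.
have i1 (B : set R) z : `|\1_B z : R| <= 1.
  by rewrite indicE ger0_norm//; case: (_ \in _).
pose G := @RGenOInfty.G R.
have GE : @measurable _ R = <<s G >> by exact: RGenOInfty.measurableE.
move=> B mB; have {mB} : <<s G >> B by rewrite -GE.
apply: (@dynkin_induction _ _ G (fun S => same_pairing \1_S) GE) => //.
- move=> _ _ [a ->] [b ->]; exists (Num.max a b).
  by apply/seteqP; split => z /=; rewrite !in_itv/= !andbT gt_max => /andP.
- by apply: same_pairing_eq K1 => z _; rewrite indicT.
- move=> _ [a ->]; have [a0|a0] := leP 0 a; first exact: Kt.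
  apply: same_pairing_eq K1 => z z0; rewrite indicE mem_set//=.
  by rewrite in_itv/= andbT (lt_le_trans a0).
- move=> S mS KS.
  have := @same_pairingB (fun=> 1) \1_S `|1 : R| 1 (measurable_cst _)
    (fun=> lexx _) (measurable_indic mS) (i1 S) K1 KS.
  apply: same_pairing_eq => z _.
  by rewrite indicC indicE; case: (_ \in _); rewrite ?subr0 ?subrr.
- by move=> F mF tF KF; exact: same_pairing_bigcup.
Qed.

Let bernoulli_ineq (x : R) n : 0 <= x <= 1 -> 1 - n%:R * x <= (1 - x) ^+ n.
Proof.
move=> /andP[x0 x1]; elim: n => [|n IH]; first by rewrite mul0r subr0.
rewrite exprS; apply: le_trans (_ : (1 - x) * (1 - n%:R * x) <= _).
  rewrite -natr1.
  have : 0 <= n%:R * (x * x) by rewrite !mulr_ge0.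
  by nra.
by rewrite ler_wpM2l// subr_ge0.
Qed.

(* The polynomials [(1 - e^{-n^2 z})^M] with [M] about [e^{n^2 a + n}] tend to
   the indicator of [z > a]. *)
Lemma same_pairing_tail :
  (forall s, 0 <= s -> same_pairing (fun z => expR (- (s * z)))) ->
  forall a, 0 <= a -> same_pairing \1_(`]a, +oo[%classic : set R).
Proof.
move=> Ke a a0.
(* The absolute value changes nothing on the ranges of [Z] and [Z'], and bounds the exponential on
   the whole line. *)
have me (s : R) : measurable_fun setT (fun z : R => expR (- (s * `|z|))).
  apply: measurableT_comp => //; apply: measurableT_comp => //.
  by apply: measurable_funM => //; exact: measurableT_comp.
have e01 (s z : R) : 0 <= s -> 0 <= expR (- (s * `|z|)) <= 1.
  by move=> s0; rewrite expR_ge0 expR_le1 oppr_le0 mulr_ge0.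
have mh (s : R) M : measurable_fun setT (fun z : R => (1 - expR (- (s * `|z|))) ^+ M).
  by apply: measurable_funX; apply: measurable_funB.
have h1 (s : R) M (z : R) : 0 <= s -> `|(1 - expR (- (s * `|z|))) ^+ M| <= 1.
  move=> s0; have /andP[e0 e1] := e01 s z s0.
  by rewrite ger0_norm ?exprn_ge0 ?exprn_ile1//; lra.
(* The extra factor [e^{-j s z}] makes the induction on [M] work: splitting off one factor
   [1 - e^{-s z}] gives the difference of the cases [j] and [j + 1] at the lower power. *)
have Kp (s : R) M : 0 <= s ->
    forall j, same_pairing (fun z => expR (- (j%:R * s * `|z|)) * (1 - expR (- (s * `|z|))) ^+ M).
  move=> s0; elim: M => [|M IH] j.
    have js : 0 <= j%:R * s by rewrite mulr_ge0.
    by apply: same_pairing_eq (Ke _ js) => z z0; rewrite expr0 mulr1 ger0_norm.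
  have mjs i : measurable_fun setT (fun z : R =>
      expR (- (i%:R * s * `|z|)) * (1 - expR (- (s * `|z|))) ^+ M).
    exact: measurable_funM.
  have bjs i (z : R) : `|expR (- (i%:R * s * `|z|)) * (1 - expR (- (s * `|z|))) ^+ M| <= 1.
    have /andP[e0 e1] := e01 (i%:R * s) z (mulr_ge0 (ler0n _ _) s0).
    by rewrite normrM mulr_ile1// ?h1// ger0_norm.
  apply: same_pairing_eq (same_pairingB (mjs j) (bjs j) (mjs j.+1) (bjs j.+1) (IH j) (IH j.+1)).
  move=> z _; rewrite exprS -natr1 !mulrDl mul1r opprD expRD.
  by ring.
pose s n : R := n%:R ^+ 2.
pose M n := (Num.truncn (expR (s n * a + n%:R))).+1.
have s0 n : 0 <= s n by exact: exprn_ge0.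
apply: (@same_pairing_lim (fun n z => (1 - expR (- (s n * `|z|))) ^+ M n) _ 1).
- by move=> n; exact: mh.
- by move=> n z; exact: h1.
- move=> z z0.
  have cn : @expR R (- n%:R) @[n --> \oo] --> 0 by exact: cvgn_expR.
  have [za|az] := leP z a.
  (* For [z <= a], [(1 - v)^M <= e^{-M v}] with [v = e^{-n^2 z}], and
     [M v >= e^{n^2 (a - z) + n} >= n]. *)
  + rewrite indicE memNset /=; last by rewrite in_itv/= andbT ltNge za.
    apply: (squeeze_cvgr _ (cvg_cst 0) cn); near=> n.
    have /andP[e0 e1] := e01 (s n) z (s0 n).
    rewrite exprn_ge0 ?subr_ge0//=.
    apply: le_trans (_ : expR (- expR (- (s n * `|z|))) ^+ M n <= _).
      by apply: lerXn2r; rewrite ?nnegrE ?subr_ge0 ?expR_ge0//; exact: expR_ge1Dx.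
    rewrite -expRM_natl ler_expR mulrN lerN2.
    apply: le_trans (_ : expR (s n * a + n%:R) * expR (- (s n * `|z|)) <= _).
      rewrite -expRD ger0_norm//; apply: le_trans (expR_ge1Dx _).
      have : 0 <= s n * (a - z) by rewrite mulr_ge0// subr_ge0.
      by lra.
    by rewrite ler_wpM2r ?expR_ge0// ltW// truncnS_gt.
  (* For [z > a], Bernoulli's inequality gives at least [1 - M e^{-n^2 z}]. As
     [M <= 2 e^{n^2 a + n}], the defect is at most [2 e^{-n}] once [n (z - a) >= 2]. *)
  + rewrite indicE mem_set /=; last by rewrite in_itv/= andbT az.
    rewrite mulr1n.
    have c1 : 1 - 2 * @expR R (- n%:R) @[n --> \oo] --> (1 : R).
      rewrite [X in _ --> X](_ : 1 = 1 - 2 * 0 :> R); last by rewrite mulr0 subr0.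
      by apply: cvgB; [exact: cvg_cst|apply: cvgM => //; exact: cvg_cst].
    apply: squeeze_cvgr c1 (cvg_cst _); near=> n.
    have e01' := e01 (s n) z (s0 n).
    have /andP[e0 e1] := e01'.
    apply/andP; split; last by apply: exprn_ile1; lra.
    apply: le_trans (bernoulli_ineq _ e01'); rewrite lerB//.
    have big1 : 1 <= expR (s n * a + n%:R).
      by rewrite -[leLHS](@expR0 R) ler_expR addr_ge0// mulr_ge0.
    apply: le_trans (_ : (2 * expR (s n * a + n%:R)) * expR (- (s n * `|z|)) <= _).
      rewrite ler_wpM2r// /M -natr1.
      have : (Num.truncn (expR (s n * a + n%:R)))%:R <= expR (s n * a + n%:R).
        by rewrite truncn_le expR_ge0.
      by lra.
    rewrite -mulrA ler_wpM2l// -expRD ler_expR ger0_norm//.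
    have nd : 2 / (z - a) <= n%:R by near: n; exact: nbhs_infty_ger.
    rewrite ler_pdivrMr ?subr_gt0// in nd.
    have : n%:R * 2 <= n%:R * (n%:R * (z - a)) by rewrite ler_wpM2l.
    by rewrite /s expr2; lra.
- move=> n; apply: same_pairing_eq (Kp _ (M n) (s0 n) 0%N) => z _.
  by rewrite !mul0r oppr0 expR0 mul1r.
Unshelve. all: by end_near. Qed.

Lemma same_pairing_of_laplace :
  (forall s, 0 <= s -> same_pairing (fun z => expR (- (s * z)))) ->
  forall f, measurable_fun setT f -> (forall z, 0 <= f z <= 1) -> same_pairing f.
Proof.
move=> Ke; apply: same_pairing_fun; apply: same_pairing_set.
  by apply: same_pairing_eq (Ke _ (lexx 0)) => z _; rewrite mul0r oppr0 expR0.
exact: same_pairing_tail.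
Qed.

End PairingTransfer.

(** * Product formulas *)

Section Coordinates.
Context {d} {T : measurableType d} {R : realType} (P : probability T R).

Definition unit_fun (f : R -> R) : Prop :=
  measurable_fun setT f /\ forall z, 0 <= f z <= 1.

Lemma integrable_unit (f : T -> R) : measurable_fun setT f ->
  (forall x, 0 <= f x <= 1) -> P.-integrable setT (EFin \o f).
Proof.
move=> mf f01.
have i1 : P.-integrable setT (EFin \o (fun=> 1 : R)).
  exact: finite_measure_integrable_cst.
have fM x : `|f x| <= 1 by have /andP[f0 f1] := f01 x; rewrite ger0_norm.
have := integrable_mul_bounded i1 mf fM; apply: eq_integrable => //.
by move=> x _ /=; rewrite mul1r.
Qed.

(** Countable additivity, read off [same_pairing_bigcup]: [f] and [g] are the weights, the index [V]
    is the real variable and the disjoint sets are the points [n]. *)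
Lemma eq_Rintegral_partition (V : T -> nat) (f g : T -> R) :
  (forall n, measurable (V @^-1` [set n])) ->
  P.-integrable setT (EFin \o f) -> P.-integrable setT (EFin \o g) ->
  (forall n, \int[P]_x (f x * \1_(V @^-1` [set n]) x) =
             \int[P]_x (g x * \1_(V @^-1` [set n]) x)) ->
  \int[P]_x f x = \int[P]_x g x.
Proof.
move=> mV intf intg fg.
pose Z x : R := (V x)%:R.
have mZ : measurable_fun setT Z.
  move=> _ B mB; rewrite setTI.
  rewrite (_ : _ @^-1` _ = \bigcup_(n in [set n | B n%:R]) V @^-1` [set n]).
    by apply: bigcup_measurable => n _; exact: mV.
  apply/seteqP; split => [x Bx|x [n Bn Vn]]; first by exists (V x).
  by rewrite /preimage/= /Z Vn.
have Z0 x : 0 <= Z x by [].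
have K : same_pairing P P f Z g Z \1_(\bigcup_n [set n%:R]).
  apply: same_pairing_bigcup => //.
    by move=> i j _ _ [x [-> /eqP]]; rewrite eqr_nat => /eqP.
  move=> n; rewrite /same_pairing; have := fg n.
  have e x : \1_(V @^-1` [set n]) x = \1_[set n%:R] (Z x) :> R.
    rewrite !indicE; congr (nat_of_bool _)%:R; apply/idP/idP; rewrite !inE /Z /=.
      by move=> ->.
    by move=> /eqP; rewrite eqr_nat => /eqP.
  under eq_Rintegral do rewrite e.
  by under [RHS]eq_Rintegral do rewrite e.
move: K; rewrite /same_pairing.
have e x : \1_(\bigcup_n [set n%:R]) (Z x) = 1 :> R.
  by rewrite indicE mem_set//; exists (V x).
under eq_Rintegral do rewrite e mulr1.
by under [RHS]eq_Rintegral do rewrite e mulr1.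
Qed.

(** The arbitrary weight [W] is there to hold the factors of the other coordinates, and [c] to hold
    the values of their functionals. *)
Definition determines (E : set (R -> R)) (Z : T -> R) (l : (R -> R) -> R) : Prop :=
  forall (W : T -> R) (c : R), measurable_fun setT W -> (forall x, 0 <= W x <= 1) ->
  (forall f, E f -> \int[P]_x (W x * f (Z x)) = c * l f) ->
  forall f, unit_fun f -> \int[P]_x (W x * f (Z x)) = c * l f.

(** Induction on the number [m] of leading coordinates that already carry arbitrary unit functions
    while the others stay in their classes [E i]. To free coordinate [m], all other factors together
    with [A] form the weight in [determines]. *)
Lemma determines_prod N (A : T -> R) (Z : nat -> T -> R)
    (l : nat -> (R -> R) -> R) (E : nat -> set (R -> R)) (c : R) :
  measurable_fun setT A -> (forall x, 0 <= A x <= 1) ->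
  (forall i, (i < N)%N -> measurable_fun setT (Z i)) ->
  (forall i f, (i < N)%N -> E i f -> unit_fun f) ->
  (forall i, (i < N)%N -> determines (E i) (Z i) (l i)) ->
  (forall f, (forall i, (i < N)%N -> E i (f i)) ->
     \int[P]_x (A x * \prod_(i < N) f i (Z i x)) = c * \prod_(i < N) l i (f i)) ->
  forall f, (forall i, (i < N)%N -> unit_fun (f i)) ->
     \int[P]_x (A x * \prod_(i < N) f i (Z i x)) = c * \prod_(i < N) l i (f i).
Proof.
move=> mA A01 mZ Eu dE base.
suff H m : (m <= N)%N -> forall f, (forall i, (i < m)%N -> unit_fun (f i)) ->
    (forall i, (m <= i < N)%N -> E i (f i)) ->
    \int[P]_x (A x * \prod_(i < N) f i (Z i x)) = c * \prod_(i < N) l i (f i).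
  move=> f uf; apply: (H N) => // i /andP[Ni].
  by rewrite ltnNge Ni.
elim: m => [|m IH] mN f uf Ef.
  by apply: base => i iN; apply: Ef.
have ufN i : (i < N)%N -> unit_fun (f i).
  by case: (ltnP i m.+1) => [im|mi] iN; [exact: uf|apply: (Eu i) => //; apply: Ef; rewrite mi].
pose mo := Ordinal mN.
have split_int (g : R -> R) (f' : nat -> R -> R) : f' m = g ->
    (forall i, i != m -> f' i = f i) ->
    (\int[P]_x (A x * \prod_(i < N) f' i (Z i x)) =
     \int[P]_x (A x * (\prod_(i < N | i != mo) f i (Z i x)) * g (Z m x))) /\
    (c * \prod_(i < N) l i (f' i) = c * (\prod_(i < N | i != mo) l i (f i)) * l m g).
  move=> f'm f'E; split.
    apply: eq_Rintegral => x _; rewrite -mulrA; congr (_ * _).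
    rewrite (bigD1 mo)//= f'm mulrC; congr (_ * _).
    by apply: eq_bigr => i im; rewrite f'E.
  rewrite -mulrA; congr (_ * _).
  rewrite (bigD1 mo)//= f'm mulrC; congr (_ * _).
  by apply: eq_bigr => i im; rewrite f'E.
have [-> ->] := split_int (f m) f erefl (fun _ _ => erefl).
apply: (dE m mN) => //; last by apply: ufN.
- apply: measurable_funM => //.
  under eq_fun do rewrite big_mkcond.
  apply: measurable_prod => i _; case: (i != mo) => //.
  by apply: measurableT_comp; [case: (ufN i (ltn_ord i))|exact: mZ].
- move=> x; have /andP[A0 A1] := A01 x.
  have p0 : 0 <= \prod_(i < N | i != mo) f i (Z i x).
    by apply: prodr_ge0 => i _; have [_ /(_ (Z i x)) /andP[]] := ufN i (ltn_ord i).
  have p1 : \prod_(i < N | i != mo) f i (Z i x) <= 1.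
    by apply: prodr_ile1 => i _; have [_ /(_ (Z i x))] := ufN i (ltn_ord i).
  by rewrite mulr_ge0//= mulr_ile1.
- move=> g Eg.
  pose f' i := if i == m then g else f i.
  have f'm : f' m = g by rewrite /f' eqxx.
  have f'E i : i != m -> f' i = f i by rewrite /f' => /negbTE ->.
  have [<- <-] := split_int g f' f'm f'E.
  apply: (IH (ltnW mN)).
  + by move=> i im; rewrite f'E ?(ltn_eqF im)//; apply: uf; rewrite ltnW.
  + move=> i /andP[mi iN]; rewrite /f'; case: eqP => [-> //|/eqP ne].
    by apply: Ef; rewrite iN andbT ltn_neqAle eq_sym ne.
Qed.

Section Reference.
Context {d'} {T' : measurableType d'} (mu' : {measure set T' -> \bar R}).
Variables (Z : T -> R) (W' Z' : T' -> R).
Hypotheses (iW' : mu'.-integrable setT (EFin \o W'))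
  (mZ : measurable_fun setT Z) (mZ' : measurable_fun setT Z')
  (Z0 : forall x, 0 <= Z x) (Z'0 : forall x, 0 <= Z' x).

Let pairing f := \int[mu']_x (W' x * f (Z' x)).

Let pairingP (W : T -> R) c f : unit_fun f ->
  same_pairing P mu' W Z (fun x => c * W' x) Z' f <->
  \int[P]_x (W x * f (Z x)) = c * pairing f.
Proof.
move=> [mf f01]; rewrite /same_pairing /pairing -RintegralZl//.
  by under [X in _ = X <-> _]eq_Rintegral do rewrite -mulrA.
apply: (@integrable_mul_bounded _ _ _ mu' W' (f \o Z') 1) => //.
  exact: measurableT_comp.
by move=> x; have /andP[f0 f1] := f01 (Z' x); rewrite ger0_norm.
Qed.

Let iWc c : mu'.-integrable setT (EFin \o (fun x => c * W' x)).
Proof.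
have := integrableZl measurableT c iW'; apply: eq_integrable => //.
Qed.

Lemma unit_fun_exp s : 0 <= s -> unit_fun (fun z => expR (- (s * `|z|))).
Proof.
move=> s0; split; last by move=> z; rewrite expR_ge0 expR_le1 oppr_le0 mulr_ge0.
apply: measurableT_comp => //; apply: measurableT_comp => //.
by apply: measurable_funM => //; exact: measurableT_comp.
Qed.

Lemma unit_fun_indic (B : set R) : measurable B -> unit_fun \1_B.
Proof.
move=> mB; split; first exact: measurable_indic.
by move=> z; rewrite indicE; case: (_ \in _); rewrite /= ?lexx ?ler01.
Qed.

(** Three test classes for three sources of product formulas: exponentials for the sojourns, Borel
    sets for the increments of [D], and tails for the holding times. *)
Lemma determines_laplace :
  determines [set f | exists2 s, 0 <= s & f = fun z => expR (- (s * `|z|))] Z pairing.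
Proof.
move=> W c mW W01 KE f uf; apply/pairingP => //.
case: uf => mf f01.
apply: same_pairing_of_laplace => //; first exact: integrable_unit.
move=> s s0; apply: (@same_pairing_eq _ _ _ _ _ _ _ _ _ _ _ _ _ (fun z => expR (- (s * `|z|)))) => //.
  by move=> z z0; rewrite ger0_norm.
apply/pairingP; first exact: unit_fun_exp.
by apply: KE; exists s.
Qed.

Lemma determines_set :
  determines [set f | exists2 B, measurable B & f = \1_B] Z pairing.
Proof.
move=> W c mW W01 KE f uf; apply/pairingP => //.
case: uf => mf f01.
apply: same_pairing_fun => //; first exact: integrable_unit.
move=> B mB; apply/pairingP; first exact: unit_fun_indic.
by apply: KE; exists B.
Qed.

Lemma determines_tail :
  determines [set f | f = (fun=> 1) \/ exists2 a, 0 <= a & f = \1_(`]a, +oo[%classic)]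
    Z pairing.
Proof.
move=> W c mW W01 KE f uf; apply/pairingP => //.
case: uf => mf f01.
have iW : P.-integrable setT (EFin \o W) by exact: integrable_unit.
apply: same_pairing_fun => //; apply: same_pairing_set => //.
  apply/pairingP; last by apply: KE; left.
  by split => // z; rewrite ler01 lexx.
move=> a a0; apply/pairingP; first exact: unit_fun_indic.
by apply: KE; right; exists a.
Qed.

End Reference.

End Coordinates.

(** * Right-continuous processes *)

Section MeasurableSelection.
Context {d} {T : measurableType d} {R : realType}.

Lemma measurable_lt_set (f g : T -> R) :
  measurable_fun setT f -> measurable_fun setT g -> measurable [set w | f w < g w].
Proof.
move=> mf mg; have /(_ measurableT [set true]) := measurable_fun_ltr mf mg.
by rewrite setTI; apply.
Qed.

Lemma measurable_le_set (f g : T -> R) :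
  measurable_fun setT f -> measurable_fun setT g -> measurable [set w | f w <= g w].
Proof.
move=> mf mg; rewrite (_ : [set w | _] = ~` [set w | g w < f w]).
  by apply: measurableC; exact: measurable_lt_set.
by apply/seteqP; split => w /=; rewrite leNgt => /negP.
Qed.

Lemma measurable_preimage_nat (V : T -> nat) (B : set nat) :
  (forall n, measurable (V @^-1` [set n])) -> measurable (V @^-1` B).
Proof.
move=> mV; rewrite (_ : _ @^-1` _ = \bigcup_(n in B) V @^-1` [set n]).
  by apply: bigcup_measurable => n _; exact: mV.
by apply/seteqP; split => [w Bw|w [n Bn /= ->]//]; exists (V w).
Qed.

Lemma grid_dense (u v : R) : 0 <= u -> u < v ->
  exists j k : nat, u < j%:R / k.+1%:R < v.
Proof.
move=> u0 uv; pose k := Num.truncn (v - u)^-1.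
have kP : (v - u)^-1 < k.+1%:R by exact: truncnS_gt.
have vu : 0 < v - u by rewrite subr_gt0.
have k0 : 0 < k.+1%:R :> R by [].
pose j := (Num.truncn (u * k.+1%:R)).+1; exists j, k.
have /andP[h1 h2] := truncn_itv (mulr_ge0 u0 (ltW k0)).
rewrite ltr_pdivlMr// h2/= ltr_pdivrMr// /j -natr1.
have : 1 < (v - u) * k.+1%:R by rewrite mulrC -ltr_pdivrMr// div1r.
by rewrite mulrBl; lra.
Qed.

(** Being open to the right, the set of [u] meets every right neighbourhood of its points at some
    [j / (k+1)], so comparing the infimum with [c] takes only countably many events. *)
Lemma measurable_inf_right_open (E : R -> set T) :
  (forall u, 0 <= u -> measurable (E u)) ->
  (forall w u, E u w -> 0 <= u /\ exists2 e, 0 < e & forall v, u <= v < u + e -> E v w) ->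
  measurable_fun setT (fun w => inf [set u | E u w]).
Proof.
move=> mE oE.
apply: (measurability (@RGenInftyO.G R)); first exact: RGenInftyO.measurableE.
move=> _ [_ [c ->] <-]; rewrite setTI.
pose q j k : R := j%:R / k.+1%:R.
have q0 j k : 0 <= q j k by rewrite divr_ge0.
pose A := \bigcup_j \bigcup_k (if q j k < c then E (q j k) else set0).
(* The infimum of an empty set is 0, which lies below [c] exactly when [0 < c]. *)
pose N := if 0 < c then ~` (\bigcup_j \bigcup_k E (q j k)) else set0.
rewrite (_ : _ @^-1` _ = A `|` N); last first.
  have hit w : [set u | E u w] !=set0 -> (\bigcup_j \bigcup_k E (q j k)) w.
    move=> [u /= Eu]; have [u0 [e e0 Ee]] := oE _ _ Eu.
    have ue : u < u + e by rewrite ltrDl.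
    have [j [k /andP[h1 h2]]] := grid_dense u0 ue.
    by exists j => //; exists k => //; apply: Ee; rewrite (ltW h1).
  have lbE w : has_lbound [set u | E u w].
    by exists 0 => u /= /oE[].
  apply/seteqP; split => w /=; rewrite in_itv/=.
  - have [nE|] := eqVneq [set u | E u w] set0.
      rewrite nE inf0 => c0; right; rewrite /N c0 => -[j _ [k _ Ew]].
      by have : [set u | E u w] (q j k) by []; rewrite nE.
    move=> /set0P nE /(inf_lt nE)[u /= Eu uc]; left.
    have [u0 [e e0 Ee]] := oE _ _ Eu.
    have um : u < Num.min (u + e) c by rewrite lt_min uc andbT ltrDl.
    have [j [k /andP[h1]]] := grid_dense u0 um; rewrite lt_min => /andP[h2 h3].
    exists j => //; exists k => //; rewrite /q h3; apply: Ee.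
    by rewrite (ltW h1).
  - case=> [[j _ [k _]]|].
      case: ifPn => // qc Ew; apply: le_lt_trans qc.
      exact: ge_inf.
    rewrite /N; case: ifPn => // c0 nh.
    have -> : [set u | E u w] = set0; last by rewrite inf0.
    by apply: contra_notP nh => /eqP/set0P; exact: hit.
apply: measurableU.
  apply: bigcup_measurable => j _; apply: bigcup_measurable => k _.
  by case: ifPn => // _; exact: mE.
rewrite /N; case: ifPn => // _; apply: measurableC.
by apply: bigcup_measurable => j _; apply: bigcup_measurable => k _; exact: mE.
Qed.

Section RightContinuousProcess.
Variable L : R -> T -> nat.
Hypothesis mL : forall u, 0 <= u -> forall m, measurable (L u @^-1` [set m]).
Hypothesis rcL : forall w u, 0 <= u ->
  exists2 e, 0 < e & forall v, u <= v < u + e -> L v w = L u w.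

(** The grid point following [tau] lies strictly to its right and tends to it, so by right
    continuity [L] at that point is eventually [L] at [tau]: the event is a limit inferior of events
    at fixed times. *)
Lemma measurable_process_at (tau : T -> R) :
  measurable_fun setT tau -> (forall w, 0 <= tau w) ->
  forall m, measurable [set w | L (tau w) w = m].
Proof.
move=> mtau tau0 m.
pose j k w := Num.truncn (k.+1%:R * tau w).
pose A k := \bigcup_i ([set w | j k w = i] `&` (L (i.+1%:R / k.+1%:R) @^-1` [set m])).
have mj k i : measurable [set w | j k w = i].
  rewrite (_ : [set w | _] = [set w | i%:R <= k.+1%:R * tau w] `&`
                             [set w | k.+1%:R * tau w < i.+1%:R]).
    by apply: measurableI; [apply: measurable_le_set|apply: measurable_lt_set] => //;
       exact: measurable_funM.
  have h w : 0 <= k.+1%:R * tau w by rewrite mulr_ge0.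
  apply/seteqP; split => w /=.
    by move=> <-; have /andP[] := truncn_itv (h w).
  by move=> [h1 h2]; apply: truncn_def; rewrite h1.
rewrite (_ : [set w | _] = \bigcup_K \bigcap_(k in [set k | (K <= k)%N]) A k).
  apply: bigcup_measurable => K _; apply: bigcap_measurable; first by exists K => /=.
  move=> k _; apply: bigcup_measurable => i _; apply: measurableI => //.
  by apply: mL; rewrite divr_ge0.
have near_tau w : exists K, forall k, (K <= k)%N ->
    L ((j k w).+1%:R / k.+1%:R) w = L (tau w) w.
  have [e e0 He] := rcL w (tau0 w).
  exists (Num.truncn e^-1) => k Kk; apply: He.
  have k0 : 0 < k.+1%:R :> R by [].
  have /andP[h1 h2] := truncn_itv (mulr_ge0 (ltW k0) (tau0 w)).
  rewrite ler_pdivlMr// ltr_pdivrMr// mulrC (ltW h2)/= -natr1 mulrDl.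
  have : 1 < e * k.+1%:R.
    rewrite mulrC -ltr_pdivrMr// div1r (lt_le_trans (truncnS_gt _))//.
    by rewrite ler_nat.
  by rewrite [tau w * _]mulrC; move: h1; rewrite /j; lra.
apply/seteqP; split => w /=.
  move=> Lm; have [K HK] := near_tau w.
  exists K => // k /= Kk; exists (j k w) => //; split => //=.
  by rewrite HK.
move=> [K _ HK]; have [K' HK'] := near_tau w.
have [|i _ [/= ji Li]] := HK (maxn K K'); first by rewrite /= leq_maxl.
by rewrite -(HK' (maxn K K')) ?leq_maxr// ji.
Qed.

Lemma trans_time_ge0 n w : 0 <= trans_time L n w.
Proof.
elim: n => //= n IH; set E := [set u | _].
have [->|/set0P E0] := eqVneq E set0; first by rewrite inf0.
by apply: lb_le_inf => // u /= [h _]; rewrite (le_trans IH) ?ltW.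
Qed.

Lemma measurable_trans_time n : measurable_fun setT (trans_time L n).
Proof.
elim: n => [|n IH]; first exact: measurable_cst.
apply: (@measurable_inf_right_open
  (fun u => [set w | trans_time L n w < u /\ L u w != L (trans_time L n w) w])).
  move=> u u0.
  rewrite (_ : [set w | _] = [set w | trans_time L n w < u] `&`
    \bigcup_m ([set w | L (trans_time L n w) w = m] `&` ~` (L u @^-1` [set m]))).
    apply: measurableI; first exact: measurable_lt_set.
    apply: bigcup_measurable => m _; apply: measurableI.
      by apply: measurable_process_at => // w; exact: trans_time_ge0.
    by apply: measurableC; exact: mL.
  apply/seteqP; split => w /=.
    move=> [h1 /eqP h2]; split => //.
    by exists (L (trans_time L n w) w).
  by move=> [h1 [m _ [/= h2 h3]]]; split => //; apply/eqP; rewrite h2.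
move=> w u /= [h1 h2].
have u0 : 0 <= u by rewrite (le_trans (trans_time_ge0 n w)) ?ltW.
split => //; have [e e0 He] := rcL w u0; exists e => // v uv.
rewrite He//; split => //; rewrite (lt_le_trans h1)//.
by case/andP: uv.
Qed.

Lemma measurable_at_trans_time n m :
  measurable [set w | L (trans_time L n w) w = m].
Proof.
apply: measurable_process_at; first exact: measurable_trans_time.
by move=> w; exact: trans_time_ge0.
Qed.

Let visit_set n w m := L (trans_time L m w) w != 0%N /\
   (\sum_(i < m) (L (trans_time L i w) w != 0%N))%N = n.

Let visit_set_uniq n w m m' : visit_set n w m -> visit_set n w m' -> m = m'.
Proof.
wlog mm' : m m' / (m < m')%N.
  move=> H v v'; case: (ltngtP m m') => // h; first exact: H.
  by apply/esym; exact: H.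
move=> [v1 v2] [v1' v2']; exfalso; move: v2'.
rewrite -(subnKC mm') big_split_ord/= big_ord_recr/= v2 v1/=.
by move=> /eqP; rewrite -addnA -[X in _ == X]addn0 eqn_add2l.
Qed.

Lemma nz_visitE n w m : L (trans_time L m w) w != 0%N ->
  (\sum_(i < m) (L (trans_time L i w) w != 0%N))%N = n -> nz_visit L n w = m.
Proof.
move=> h1 h2; apply: xget_unique => // m' vm'.
exact: (@visit_set_uniq n w).
Qed.

Lemma measurable_nz_visit n m : measurable [set w | nz_visit L n w = m].
Proof.
have mnz i : measurable [set w | L (trans_time L i w) w != 0%N].
  rewrite (_ : [set w | _] = ~` [set w | L (trans_time L i w) w = 0%N]).
    by apply: measurableC; exact: measurable_at_trans_time.
  by apply/seteqP; split => w /= /eqP.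
have mv m' : measurable [set w | visit_set n w m'].
  apply: measurableI; first exact: mnz.
  have e w : \sum_(i < m') \1_[set w | L (trans_time L i w) w != 0%N] w =
             (\sum_(i < m') (L (trans_time L i w) w != 0%N))%:R :> R.
    by rewrite natr_sum; apply: eq_bigr => i _; rewrite indicE mem_setE.
  have ms : measurable_fun setT
      (fun w => \sum_(i < m') \1_[set w | L (trans_time L i w) w != 0%N] w : R).
    by apply: measurable_sum => i; exact: measurable_indic.
  have /(_ measurableT [set n%:R] (measurable_set1 _)) := ms; rewrite setTI.
  congr measurable; apply/seteqP; split => w /=; rewrite e; last by move=> ->.
  by move=> /eqP; rewrite eqr_nat => /eqP.
(* When there is no such visit, [xget] returns its default 0. *)
rewrite (_ : [set w | _] = [set w | visit_set n w m] `|`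
   (if m == 0%N then ~` \bigcup_m' [set w | visit_set n w m'] else set0)).
  apply: measurableU => //; case: ifP => // _; apply: measurableC.
  by apply: bigcup_measurable => i _; exact: mv.
apply/seteqP; split => w /=.
  move=> <-; rewrite /nz_visit; case: xgetP => [i _ vi|nv].
    by left.
  by right; rewrite eqxx => -[i _]; exact: nv.
case=> [[v1 v2]|]; first exact: nz_visitE.
case: eqP => // -> nv; rewrite /nz_visit xgetPN// => i vi.
by apply: nv; exists i.
Qed.

Lemma measurable_nz_sojourn n : measurable_fun setT (nz_sojourn L n).
Proof.
move=> _ B mB; rewrite setTI.
rewrite (_ : _ @^-1` _ = \bigcup_m ([set w | nz_visit L n w = m] `&`
   (fun w => trans_time L m.+1 w - trans_time L m w) @^-1` B)).
  apply: bigcup_measurable => m _; apply: measurableI; first exact: measurable_nz_visit.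
  rewrite -[X in measurable X]setTI.
  by apply: measurable_funB => //; exact: measurable_trans_time.
apply/seteqP; split => w /=; first by move=> Bw; exists (nz_visit L n w).
by move=> [m _ [/= h]]; rewrite /nz_sojourn h.
Qed.

End RightContinuousProcess.

(** The infimum is attained at [tau m.+1], where the value has already changed. This serves both for
    the queue in its own clock and for the time-changed length. *)
Lemma trans_timeE (L : R -> T -> nat) (w : T) (tau : nat -> R) :
  tau 0%N = 0 -> (forall m, tau m < tau m.+1) ->
  (forall m u, tau m <= u < tau m.+1 -> L u w = L (tau m) w) ->
  (forall m, L (tau m.+1) w != L (tau m) w) ->
  forall m, trans_time L m w = tau m.
Proof.
move=> t0 tS Lc Ln; elim => [//|m IH] /=; rewrite IH.
set E := [set u | _].
have Et : E (tau m.+1) by split.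
have lb : lbound E (tau m.+1).
  move=> u [h1 /eqP h2]; rewrite leNgt; apply/negP => h3.
  by apply: h2; apply: Lc; rewrite h3 (ltW h1).
apply/eqP; rewrite eq_le lb_le_inf//; last by exists (tau m.+1).
by rewrite andbT ge_inf//; exists (tau m.+1).
Qed.

End MeasurableSelection.

(** * Time-changed paths *)

Section InverseSubordinator.
Context {d} {T : measurableType d} {R : realType} (D : R -> T -> R).
Hypothesis mD : forall t, measurable_fun setT (D t).
Hypothesis D0 : forall w, D 0 w = 0.
Hypothesis Dle : forall w s t, 0 <= s -> s <= t -> D s w <= D t w.

Lemma inv_sub_ge0 t w : 0 <= inv_sub D t w.
Proof.
rewrite /inv_sub; set E := [set x | _].
have [->|/set0P E0] := eqVneq E set0; first by rewrite inf0.
by apply: lb_le_inf => // x /= [/ltW].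
Qed.

Lemma measurable_inv_sub t : measurable_fun setT (inv_sub D t).
Proof.
apply: (@measurable_inf_right_open _ _ _ (fun x => [set w | 0 < x /\ t < D x w])).
  move=> x _; rewrite (_ : [set w | _] = if 0 < x then [set w | t < D x w] else set0).
    by case: ifP => // _; exact: measurable_lt_set.
  apply/seteqP; split => w /=; first by move=> [-> ].
  by case: ifP.
move=> w x [x0 tx]; split; first exact: ltW.
exists 1 => // v /andP[xv _]; split; first exact: lt_le_trans xv.
by apply: (lt_le_trans tx); apply: Dle => //; exact: ltW.
Qed.

(** A point [x] within [e] of the infimum has [D x w > u], and hence is a candidate for every level
    [v] in [[u, D x w[]. If [D] never exceeds [u], it exceeds no higher level either, and both
    infima are the default 0. *)
Lemma inv_sub_right_continuous w u e : 0 < e ->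
  exists2 de, 0 < de & forall v, u <= v < u + de ->
    inv_sub D u w <= inv_sub D v w < inv_sub D u w + e.
Proof.
move=> e0.
have lbE t : has_lbound [set x | 0 < x /\ t < D x w] by exists 0 => x /= [/ltW].
have [E0|/set0P nE] := eqVneq [set x | 0 < x /\ u < D x w] set0.
  exists 1 => // v /andP[uv _]; rewrite /inv_sub E0.
  have -> : [set x | 0 < x /\ v < D x w] = set0.
    rewrite -subset0 => x /= [x0 vx].
    have : [set x | 0 < x /\ u < D x w] x by split => //; exact: le_lt_trans vx.
    by rewrite E0.
  by rewrite inf0 lexx add0r.
have [x [x0 ux] xlt] : exists2 x, 0 < x /\ u < D x w & x < inv_sub D u w + e.
  by apply: inf_lt => //; rewrite ltrDl.
exists (D x w - u); first by rewrite subr_gt0.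
move=> v /andP[uv]; rewrite addrC subrK => vx.
apply/andP; split; last first.
  by apply: le_lt_trans xlt; apply: ge_inf => //; split.
apply: lb_le_inf; first by exists x; split.
move=> y /= [y0 vy]; apply: ge_inf => //; split => //.
exact: le_lt_trans vy.
Qed.

End InverseSubordinator.

Section JumpHoldPath.
Context {d} {T : measurableType d} {R : realType}.
Variables (X : nat -> T -> nat * nat) (H : nat -> T -> R).
Hypothesis H0 : forall n w, 0 < H n w.
Hypothesis nonexp : forall w t, exists n, t < jtime H n w.

Lemma jtime0 w : jtime H 0 w = 0. Proof. by rewrite /jtime big_ord0. Qed.

Lemma jtimeS m w : jtime H m.+1 w = jtime H m w + H m w.
Proof. by rewrite /jtime big_ord_recr. Qed.

Lemma lt_jtime m w : jtime H m w < jtime H m.+1 w.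
Proof. by rewrite jtimeS ltrDl. Qed.

Lemma le_jtime w m n : (m <= n)%N -> jtime H m w <= jtime H n w.
Proof.
elim: n => [|n IH]; first by rewrite leqn0 => /eqP ->.
rewrite leq_eqVlt => /predU1P[->//|]; rewrite ltnS => /IH h.
by rewrite (le_trans h)// ltW// lt_jtime.
Qed.

Lemma jtime_ge0 m w : 0 <= jtime H m w.
Proof. by rewrite -(jtime0 w) le_jtime. Qed.

Lemma ctmc_pathE m t w : jtime H m w <= t < jtime H m.+1 w ->
  ctmc_path X H t w = X m w.
Proof.
move=> mt; rewrite /ctmc_path (@xget_unique _ _ _ m)// => n /= nt.
have key i j : jtime H i w <= t -> t < jtime H j.+1 w -> (i <= j)%N.
  move=> h1 h2; rewrite leqNgt; apply/negP => /(le_jtime w) h3.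
  by have := lt_le_trans h2 (le_trans h3 h1); rewrite ltxx.
move: mt nt => /andP[m1 m2] /andP[n1 n2].
by apply/eqP; rewrite eqn_leq !key.
Qed.

Lemma jtime_cover t w : 0 <= t -> exists m, jtime H m w <= t < jtime H m.+1 w.
Proof.
move=> t0; have ex := nonexp w t.
have exb : exists n, t < jtime H n w by [].
case: (ex_minnP exb) => -[|m]; first by rewrite jtime0 ltNge t0.
move=> tm minm; exists m; rewrite tm andbT leNgt; apply/negP => /minm.
by rewrite ltnn.
Qed.

Lemma ctmc_path_right_continuous w t : 0 <= t ->
  exists2 e, 0 < e & forall v, t <= v < t + e -> ctmc_path X H v w = ctmc_path X H t w.
Proof.
move=> t0; have [m /andP[m1 m2]] := jtime_cover w t0.
exists (jtime H m.+1 w - t); first by rewrite subr_gt0.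
move=> v /andP[tv]; rewrite addrC subrK => vm.
by rewrite !(@ctmc_pathE m) ?m1//= (le_trans m1 tv).
Qed.

Hypothesis mX : forall n x, measurable (X n @^-1` [set x]).
Hypothesis mH : forall n, measurable_fun setT (H n).

Lemma measurable_jtime n : measurable_fun setT (jtime H n).
Proof. by apply: measurable_sum => i; exact: mH. Qed.

Lemma measurable_ctmc_path t x : 0 <= t -> measurable (ctmc_path X H t @^-1` [set x]).
Proof.
move=> t0; rewrite (_ : _ @^-1` _ = \bigcup_m (([set w | jtime H m w <= t] `&`
    [set w | t < jtime H m.+1 w]) `&` (X m @^-1` [set x]))).
  apply: bigcup_measurable => m _; apply: measurableI => //; apply: measurableI.
    by apply: measurable_le_set => //; exact: measurable_jtime.
  by apply: measurable_lt_set => //; exact: measurable_jtime.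
apply/seteqP; split => w /=.
  move=> <-; have [m m12] := jtime_cover w t0; have /andP[m1 m2] := m12.
  by exists m => //; split => //=; rewrite (ctmc_pathE m12).
by move=> [m _ [[/= m1 m2] <-]]; apply: ctmc_pathE; rewrite m1.
Qed.

End JumpHoldPath.

Section TimeChangedPath.
Context {d} {T : measurableType d} {R : realType}.
Variables (k : nat) (X : nat -> T -> nat * nat) (H : nat -> T -> R) (D : R -> T -> R).
Hypothesis H0 : forall n w, 0 < H n w.
Hypothesis nonexp : forall w t, exists n, t < jtime H n w.
Hypothesis D0 : forall w, D 0 w = 0.
Hypothesis Dle : forall w s t, 0 <= s -> s <= t -> D s w <= D t w.

Let L := qlen k (ctmc_path X H) D.

Lemma qlen_right_continuous w u : 0 <= u ->
  exists2 e, 0 < e & forall v, u <= v < u + e -> L v w = L u w.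
Proof.
move=> u0; have [e e0 He] := ctmc_path_right_continuous X H0 nonexp w (inv_sub_ge0 D u w).
have [de de0 Hde] := inv_sub_right_continuous D w u e0.
by exists de => // v uv; rewrite /L /qlen He ?Hde.
Qed.

Section Measurability.
Hypothesis mX : forall n x, measurable (X n @^-1` [set x]).
Hypothesis mH : forall n, measurable_fun setT (H n).
Hypothesis mD : forall t, measurable_fun setT (D t).

Lemma measurable_qlen u m : measurable (L u @^-1` [set m]).
Proof.
(* States are coded by natural numbers, since [measurable_process_at] is about processes with values
   in [nat]. *)
pose Q t w := pickle (ctmc_path X H t w).
have mQ t : 0 <= t -> forall n, measurable (Q t @^-1` [set n]).
  move=> t0 n; rewrite (_ : _ @^-1` _ =
    if @pickle_inv (nat * nat)%type n is Some x then ctmc_path X H t @^-1` [set x] else set0).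
    by case: pickle_inv => // x; exact: measurable_ctmc_path.
  apply/seteqP; split => w /=; first by move=> <-; rewrite pickleK_inv.
  case E : (pickle_inv n) => [x|] //=; rewrite /Q => ->.
  by have := @pickle_invK (nat * nat)%type n; rewrite E.
have rcQ w t : 0 <= t -> exists2 e, 0 < e & forall v, t <= v < t + e -> Q v w = Q t w.
  move=> t0; have [e e0 He] := ctmc_path_right_continuous X H0 nonexp w t0.
  by exists e => // v tv; rewrite /Q He.
have mQY := measurable_process_at mQ rcQ (measurable_inv_sub mD Dle u) (inv_sub_ge0 D u).
have := measurable_preimage_nat
  [set n | gk k (odflt (0, 0)%N (unpickle n)) = m] mQY.
by congr measurable; apply/seteqP; split => w /=; rewrite /Q pickleK.
Qed.

End Measurability.

Section Pathwise.
Variable w : T.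
Hypothesis Dlt : forall s t, 0 <= s -> s < t -> D s w < D t w.
Hypothesis Dunb : forall K, exists2 t, 0 <= t & K < D t w.
Hypothesis Xneq : forall m, gk k (X m w) != gk k (X m.+1 w).

(* The time change reaches [J] at the left limit [D (J-)], not at [D J]: one has
   [J <= inv_sub D u w] iff [D x w <= u] for all [x < J]. *)
Definition left_value (J : R) : R := sup [set D x w | x in [set x | 0 <= x < J]].

Lemma left_value0 : left_value 0 = 0.
Proof.
rewrite /left_value (_ : [set x | _] = set0) ?image_set0 ?sup0//.
by rewrite -subset0 => x /= /andP[x0 /(le_lt_trans x0)]; rewrite ltxx.
Qed.

Lemma left_value_le J u : (0 <= u) -> (forall x, 0 <= x < J -> D x w <= u) -> left_value J <= u.
Proof.
move=> u0 h; rewrite /left_value; set E := image _ _.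
have [->|/set0P nE] := eqVneq E set0; first by rewrite sup0.
by apply: ge_sup => // _ [x xJ <-]; exact: h.
Qed.

Lemma le_left_value J x : 0 <= x < J -> D x w <= left_value J.
Proof.
move=> xJ; apply: ub_le_sup; last by exists x.
exists (D J w) => _ [y /andP[y0 yJ] <-]; apply: Dle => //; exact: ltW.
Qed.

(** The midpoint [m] separates the two: [D(J-) <= D J < D m <= D(J'-)]. *)
Lemma left_value_lt J J' : 0 <= J -> J < J' -> left_value J < left_value J'.
Proof.
move=> J0 JJ'.
have [m1 m2] := midf_lt JJ'.
have m0 : 0 <= (J + J') / 2 by rewrite (le_trans J0) ?ltW.
apply: le_lt_trans (_ : D J w < _).
  apply: left_value_le; first by rewrite -(D0 w) Dle.
  by move=> x /andP[x0 xJ]; apply: Dle => //; exact: ltW.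
apply: (lt_le_trans (Dlt J0 m1)); apply: le_left_value.
by rewrite m0.
Qed.

Lemma inv_sub_between J J' u : 0 <= u -> left_value J <= u < left_value J' ->
  J <= inv_sub D u w < J'.
Proof.
move=> u0 /andP[h1 h2]; apply/andP; split.
  apply: lb_le_inf.
    have [t t0 tu] := Dunb u; exists t; split => //.
    rewrite lt_neqAle t0 andbT eq_sym; apply/eqP => te.
    by move: tu; rewrite te D0 ltNge u0.
  move=> x /= [x0 ux]; rewrite leNgt; apply/negP => xJ.
  have : D x w <= left_value J by apply: le_left_value; rewrite xJ ltW.
  by move=> /le_trans/(_ h1); rewrite leNgt ux.
have [x /andP[x0 xJ'] ux] : exists2 x, 0 <= x < J' & u < D x w.
  apply: contrapT => nx.
  have : left_value J' <= u.
    apply: left_value_le => // x xJ; rewrite leNgt; apply/negP => ux.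
    by apply: nx; exists x.
  by rewrite leNgt h2.
apply: le_lt_trans xJ'; apply: ge_inf; first by exists 0 => y /= [/ltW].
split => //; rewrite lt_neqAle x0 andbT eq_sym; apply/eqP => xe.
by move: ux; rewrite xe D0 ltNge u0.
Qed.

Lemma left_value_ge0 J : 0 <= left_value J.
Proof.
have [J0|J0] := leP J 0.
  rewrite /left_value (_ : [set x | _] = set0) ?image_set0 ?sup0//.
  rewrite -subset0 => x /= /andP[x0 xJ].
  by have := le_lt_trans x0 (lt_le_trans xJ J0); rewrite ltxx.
by rewrite -(D0 w); apply: le_left_value; rewrite lexx J0.
Qed.

Lemma qlen_between m u :
  left_value (jtime H m w) <= u < left_value (jtime H m.+1 w) -> L u w = gk k (X m w).
Proof.
move=> hu; rewrite /L /qlen; congr (gk k _); apply: ctmc_pathE => //.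
apply: inv_sub_between => //; case/andP: hu => h _.
exact: le_trans (left_value_ge0 _) h.
Qed.

Lemma left_value_jtime_lt m : left_value (jtime H m w) < left_value (jtime H m.+1 w).
Proof. by apply: left_value_lt; [exact: jtime_ge0|exact: lt_jtime]. Qed.

Lemma qlen_left_value m : L (left_value (jtime H m w)) w = gk k (X m w).
Proof. by apply: qlen_between; rewrite lexx left_value_jtime_lt. Qed.

Lemma trans_time_qlen m : trans_time L m w = left_value (jtime H m w).
Proof.
apply: (@trans_timeE _ _ _ L w (fun m => left_value (jtime H m w))).
- by rewrite jtime0 left_value0.
- exact: left_value_jtime_lt.
- by move=> n u /qlen_between ->; rewrite qlen_left_value.
- by move=> n; rewrite !qlen_left_value eq_sym.
Qed.

Lemma cvg_left_value (J : R) (t : nat -> R) :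
  (forall n, 0 <= t n < J) -> t @ \oo --> J -> (fun n => D (t n) w) @ \oo --> left_value J.
Proof.
move=> tJ tcv; apply/cvgrPdist_le => e e0.
have J0 : 0 < J by have /andP[a b] := tJ 0%N; exact: le_lt_trans a b.
have [_ [x /andP[x0 xJ] <-] xe] : exists2 y,
    [set D x w | x in [set x | 0 <= x < J]] y & left_value J - e < y.
  apply: sup_gt; first by exists (D 0 w), 0 => //=; rewrite lexx.
  by rewrite ltrBlDr ltrDl.
near=> n; have /andP[t0 tJn] := tJ n.
have xt : x <= t n by apply: ltW; near: n; exact: (cvgr_gt J).
have h1 : D (t n) w <= left_value J by exact: le_left_value.
have h2 : D x w <= D (t n) w by exact: Dle.
rewrite ger0_norm ?subr_ge0//.
by lra.
Unshelve. all: by end_near. Qed.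

End Pathwise.

End TimeChangedPath.

(** * The tempered subordinator *)

Section LaplaceExponent.
Context {R : realType} (th al : R).
Hypotheses (th0 : 0 < th) (al01 : 0 < al < 1).

Definition laplace_exponent (s : R) : R := powR (s + th) al - powR th al.

Lemma laplace_exponent0 : laplace_exponent 0 = 0.
Proof. by rewrite /laplace_exponent add0r subrr. Qed.

Lemma laplace_exponent_ge0 s : 0 <= s -> 0 <= laplace_exponent s.
Proof.
move=> s0; have /andP[al0 _] := al01; rewrite subr_ge0.
by apply: ge0_ler_powR; rewrite ?nnegrE ?(ltW al0)// ?addr_ge0 ?(ltW th0)// lerDr.
Qed.

(** For [s = y^(1/al)] with [y >= K + th^al], dropping [th] from [s + th] still leaves
    [(s + th)^al >= y]. *)
Lemma laplace_exponent_unbounded (K : R) : exists2 s, 0 <= s & K <= laplace_exponent s.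
Proof.
have /andP[al0 _] := al01.
pose y := Num.max 0 K + powR th al.
have y0 : 0 <= y by rewrite addr_ge0 ?powR_ge0// le_max lexx.
exists (powR y al^-1); first exact: powR_ge0.
rewrite /laplace_exponent lerBrDr.
apply: le_trans (_ : y <= _); first by rewrite lerD2r le_max lexx orbT.
rewrite -[leLHS](powRr1 y0) -(mulVf (lt0r_neq0 al0)) powRrM.
by apply: ge0_ler_powR; rewrite ?nnegrE ?(ltW al0)// ?addr_ge0 ?powR_ge0 ?(ltW th0)// lerDl ltW.
Qed.

End LaplaceExponent.

Section AlmostSure.
Context {d} {T : measurableType d} {R : realType} (P : probability T R).

Lemma probability_eq0 (A : set T) : measurable A ->
  (forall e : R, 0 < e -> (P A <= e%:E)%E) -> P A = 0%E.
Proof.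
move=> mA h; apply/eqP; rewrite eq_le measure_ge0 andbT.
apply/lee_addgt0Pr => e e0; rewrite add0e; exact: h.
Qed.

Lemma ae_not (A : set T) : measurable A -> P A = 0%E -> {ae P, forall w, ~ A w}.
Proof. by move=> mA A0; exists A; split => // w /= /contrapT. Qed.

Lemma ae_forall_countable (I : countType) (A : I -> set T) :
  (forall i, {ae P, forall w, A i w}) -> {ae P, forall w i, A i w}.
Proof.
move=> h.
have h' n : {ae P, forall w, if @unpickle I n is Some i then A i w else True}.
  by case: unpickle => [i|]; [exact: h|exact: aeW].
have := ae_foralln h'; apply: filterS => w hw i.
by have := hw (pickle i); rewrite pickleK.
Qed.

End AlmostSure.

Section TemperedSubordinator.
Context {d} {T : measurableType d} {R : realType} (P : probability T R).
Variables (th al : R) (D : R -> T -> R).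
Hypotheses (th0 : 0 < th) (al01 : 0 < al < 1).
Hypothesis TS : tempered_subordinator P th al D.

Let mD : forall t, measurable_fun setT (D t). Proof. by case: TS. Qed.
Let D0 : forall w, D 0 w = 0. Proof. by case: TS => _ []. Qed.
Let Dle : forall w s t, 0 <= s -> s <= t -> D s w <= D t w.
Proof. by case: TS => _ [_ []]. Qed.
Let psi := laplace_exponent th al.

Lemma subordinator_ge0 t w : 0 <= t -> 0 <= D t w.
Proof. by move=> t0; rewrite -(D0 w) Dle. Qed.

Lemma subordinator_laplace (t s : R) : 0 <= t -> 0 <= s ->
  \int[P]_w expR (- (s * D t w)) = expR (- (t * psi s)).
Proof.
move=> t0 s0; case: TS => _ [_ [_ [_ [_ [_ h]]]]].
by rewrite /Rintegral h.
Qed.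

(** Chernoff bound: the indicator of [D h <= K] is at most [e^{s (K - D h)}]. *)
Lemma subordinator_le_bound (h K s : R) : 0 <= h -> 0 <= s ->
  (P [set w | (D h w <= K)%R] <= (expR (s * K - h * psi s)%R)%:E)%E.
Proof.
move=> h0 s0.
have mA : measurable [set w | D h w <= K] by exact: measurable_le_set.
have PE := @integral_indic _ _ _ P setT measurableT _ mA.
rewrite setIT in PE; rewrite -PE expRB -expRN -subordinator_laplace// /Rintegral.
have me : measurable_fun setT (fun w => expR (- (s * D h w))).
  by apply: measurableT_comp => //; apply: measurableT_comp => //; exact: measurable_funM.
have i1 : P.-integrable setT (fun w => (expR (- (s * D h w)))%:E).
  apply: integrable_unit => // w.
  by rewrite expR_ge0 expR_le1 oppr_le0 mulr_ge0// subordinator_ge0.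
rewrite EFinM fineK; last exact: integrable_fin_num.
rewrite -ge0_integralZl ?lee_fin ?expR_ge0//.
- apply: ge0_le_integral => //.
  + by apply/measurable_EFinP; exact: measurable_indic.
  + by apply: emeasurable_funM => //; exact/measurable_EFinP.
  + move=> w _; rewrite -EFinM lee_fin indicE; case: (boolP (w \in _)) => [|_] /=; last first.
      by rewrite mulr_ge0 ?expR_ge0.
    move=> /set_mem/= DK; rewrite -expRD -[leLHS](@expR0 R) ler_expR -mulrBr.
    by rewrite mulr_ge0// subr_ge0.
- exact/measurable_EFinP.
Qed.

(** By stationarity and the Chernoff bound at [K = 0], an increment over a length [h] vanishes with
    probability at most [e^{-h psi u}] for every [u >= 0], and [psi] is unbounded. This settles
    countably many pairs of grid points; monotonicity places two of them between [s] and [t]. *)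
Lemma ae_subordinator_increasing :
  {ae P, forall w s t, 0 <= s -> s < t -> D s w < D t w}.
Proof.
pose q (j k : nat) : R := j%:R / k.+1%:R.
have q0 j k : 0 <= q j k by rewrite divr_ge0.
have key (s t : R) : 0 <= s -> s < t -> {ae P, forall w, D s w < D t w}.
  move=> s0 st; have h0 : 0 < t - s by rewrite subr_gt0.
  pose A := [set w | D t w - D s w <= 0].
  have mA : measurable A.
    by apply: measurable_le_set => //; exact: measurable_funB.
  have PA : P A = P [set w | D (t - s) w <= 0].
    case: TS => _ [_ [_ [_ [_ [st_inc _]]]]].
    have := st_inc s (t - s) `]-oo, 0]%classic s0 (ltW h0) (measurable_itv _).
    rewrite [s + _]addrC subrK; congr (P _ = P _); apply/seteqP; split => w /=;
      by rewrite in_itv.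
  have PA0 : P A = 0%E.
    apply: probability_eq0 => // e e0; rewrite PA.
    have [u u0 hu] := laplace_exponent_unbounded th0 al01 (- ln e / (t - s)).
    apply: le_trans (subordinator_le_bound 0 (ltW h0) u0) _.
    rewrite lee_fin mulr0 sub0r -[leRHS](@lnK _ e) ?posrE// ler_expR lerNl.
    by rewrite mulrC -ler_pdivrMr.
  by apply: filterS (ae_not mA PA0) => w; rewrite /A/= => /negP; rewrite -ltNge subr_gt0.
have : {ae P, forall w (p : (nat * nat) * (nat * nat)),
    q p.1.1 p.1.2 < q p.2.1 p.2.2 -> D (q p.1.1 p.1.2) w < D (q p.2.1 p.2.2) w}.
  apply: (ae_forall_countable (A := fun p => [set w | q p.1.1 p.1.2 < q p.2.1 p.2.2 ->
    D (q p.1.1 p.1.2) w < D (q p.2.1 p.2.2) w])) => -[[i j] [i' j']] /=.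
  have [qq|_] := boolP (q i j < q i' j'); last exact: aeW.
  by apply: filterS (key _ _ (q0 i j) qq) => w h _.
apply: filterS => w h s t s0 st.
have [i [j /andP[h1 h2]]] := grid_dense s0 st.
have [i' [j' /andP[h3 h4]]] := grid_dense (q0 i j) h2.
apply: le_lt_trans (_ : D (q i j) w < _); first by rewrite Dle// ltW.
apply: lt_le_trans (_ : D (q i' j') w <= _); last by rewrite Dle// ltW.
exact: (h ((i, j), (i', j'))).
Qed.

(** With [s] fixed such that [psi s >= 1], the Chernoff bound gives [P(D n <= K) <= e^{s K - n}],
    which is arbitrarily small for large [n]. *)
Lemma ae_subordinator_unbounded :
  {ae P, forall w K, exists2 t, 0 <= t & K < D t w}.
Proof.
have key (K : nat) : {ae P, forall w, exists n : nat, K%:R < D n%:R w}.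
  pose A := \bigcap_(n in [set: nat]) [set w | D n%:R w <= K%:R].
  have mA : measurable A.
    by apply: bigcapT_measurable => n; exact: measurable_le_set.
  have PA0 : P A = 0%E.
    apply: probability_eq0 => // e e0.
    have [s s0 hs] := laplace_exponent_unbounded th0 al01 1.
    pose n := (Num.truncn (s * K%:R - ln e)).+1.
    apply: (@le_trans _ _ (P [set w | D n%:R w <= K%:R])).
      apply: le_measure; rewrite ?inE//; first exact: measurable_le_set.
      by move=> w; apply.
    apply: le_trans (subordinator_le_bound K%:R (ler0n _ n) s0) _.
    rewrite lee_fin -[leRHS](@lnK _ e) ?posrE// ler_expR.
    have : s * K%:R - ln e < n%:R by exact: truncnS_gt.
    have : n%:R * 1 <= n%:R * psi s by rewrite ler_wpM2l.
    by lra.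
  apply: filterS (ae_not mA PA0) => w nA; apply: contrapT => nex; apply: nA.
  by move=> n _ /=; rewrite leNgt; apply/negP => h; apply: nex; exists n.
have := ae_foralln key; apply: filterS => w h K.
have [n hn] := h (Num.truncn K).+1.
by exists n%:R => //; apply: lt_trans hn; exact: truncnS_gt.
Qed.

End TemperedSubordinator.

(** * The jump chain *)

Section ExponentialReference.
Context {R : realType}.
Let mu := @lebesgue_measure R.

(** Expectation of [f] under the exponential law of rate [q]. The density vanishes on negative
    reals; the absolute value makes the reference variable nonnegative everywhere, as the uniqueness
    lemmas demand. *)
Definition exp_pairing (q : R) (f : R -> R) : R :=
  \int[mu]_x (exponential_pdf q x * f `|x|).

Lemma exp_pairing1 q : 0 < q -> exp_pairing q (fun=> 1) = 1.
Proof.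
move=> q0; rewrite /exp_pairing; under eq_Rintegral do rewrite mulr1.
by rewrite /Rintegral integral_exponential_pdf.
Qed.

Lemma exp_pairing_exp q p : 0 < q -> 0 <= p ->
  exp_pairing q (fun z => expR (- (p * `|z|))) = q / (q + p).
Proof.
move=> q0 p0; have qp0 : 0 < q + p by rewrite ltr_wpDr.
rewrite /exp_pairing.
have e x : exponential_pdf q x * expR (- (p * `| `|x| |)) =
           q / (q + p) * exponential_pdf (q + p) x.
  have [x0|x0] := leP 0 x; last by rewrite !lt0_exponential_pdf// mul0r mulr0.
  rewrite !exponential_pdfE// normr_id ger0_norm// mulrA -mulrA -expRD.
  by rewrite divfK ?gt_eqF//; congr (_ * expR _); ring.
under eq_Rintegral do rewrite e.
rewrite RintegralZl//; last exact: integrable_exponential_pdf.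
by rewrite /Rintegral integral_exponential_pdf// mulr1.
Qed.

Lemma exp_pairing_tail q a : 0 < q -> 0 <= a ->
  exp_pairing q \1_(`]a, +oo[%classic : set R) = expR (- (q * a)).
Proof.
move=> q0 a0; rewrite /exp_pairing.
have e x : exponential_pdf q x * \1_(`]a, +oo[%classic : set R) `|x| =
           (exponential_pdf q \_ `]a, +oo[%classic) x.
  rewrite patchE indicE; have [x0|x0] := leP 0 x.
    by rewrite ger0_norm//; case: (x \in _); rewrite ?mulr1 ?mulr0.
  rewrite lt0_exponential_pdf// mul0r; case: ifP => //.
under eq_Rintegral do rewrite e.
rewrite -Rintegral_mkcond /Rintegral integral_itv_obnd_cbnd; last first.
  by apply: measurable_funTS; apply/measurable_EFinP; exact: measurable_exponential_pdf.
have cN : continuous (fun z : R^o => expR (- q * z)).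
  move=> z; apply: continuous_comp; last exact: continuous_expR.
  by apply: continuousM => //; apply: (@continuousN _ R^o); exact: cst_continuous.
rewrite (@ge0_continuous_FTC2y _ _ (fun x => - expR (- q * x)) _ 0)//.
- by rewrite -EFinB/= sub0r opprK mulNr.
- by move=> x _; apply: exponential_pdf_ge0; exact: ltW.
- apply: (@continuous_subspaceW R^o _ _ [set` `[0, +oo[%R]).
    by apply: subset_itvr; rewrite bnd_simp.
  exact: within_continuous_exponential_pdf.
- rewrite -oppr0; apply: cvgN.
  rewrite (_ : (fun x => expR (- q * x)) =
               (fun z => expR (- z)) \o (fun z => q * z)); last first.
    by apply/funext => x /=; rewrite mulNr.
  apply: (@cvg_comp _ _ _ _ _ _ (pinfty_nbhs R)); last exact: cvgr_expR.
  exact: gt0_cvgMry.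
- by apply: cvgN; apply/cvg_at_right_filter; exact: cN.
- move=> x; rewrite in_itv/= andbT => ax; apply: derive1_exponential_pdf.
  by rewrite in_itv/= andbT (le_lt_trans a0).
Qed.

End ExponentialReference.

Section ErlangStates.
Context {R : realType} (k : nat) (la mu : R).
Hypothesis k0 : (0 < k)%N.

Definition erlang_state (x : nat * nat) : bool :=
  (x == (0, 0)%N) || [&& (0 < x.1)%N, (0 < x.2)%N & (x.2 <= k)%N].

Lemma gk_eq0 x : erlang_state x -> (gk k x == 0%N) = (x == (0, 0)%N).
Proof.
rewrite /gk /erlang_state; have [-> //|_] := eqVneq x (0, 0)%N.
by move=> /= /and3P[_ h _]; rewrite addn_eq0 (gtn_eqF h) andbF.
Qed.

(** An arrival raises [gk] by [k] and a phase completion lowers it by 1, so with [k > 0] every jump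
    of the queue shows in its length. From the empty queue only an arrival is possible, whence no
    two consecutive zeros. *)
Lemma jump_prob_neq0 x y : erlang_state x -> jump_prob k la mu x y != 0 ->
  [/\ erlang_state y, gk k x != gk k y & gk k x = 0%N -> gk k y != 0%N].
Proof.
have gk1 a b : gk k (a.+1, b) = (k * a + b)%N by [].
move=> sx; rewrite /jump_prob; case: (eqVneq x (0, 0)%N) => [->|x0].
  case: (eqVneq y (1, k)%N) => [->|_]; last by rewrite eqxx.
  move=> _; rewrite gk1 muln0 add0n /erlang_state/= leqnn k0 /=.
  by rewrite (_ : gk k (0, 0)%N = 0%N)// eq_sym -lt0n k0.
move: sx; rewrite /erlang_state (negbTE x0)/=; case: x x0 => -[//|a] [//|b] /= x0.
move=> bk.
have [-> _|nup] := eqVneq y (a.+2, b.+1).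
  rewrite !gk1; split => //; last by rewrite addnS.
  by rewrite mulnS; lia.
rewrite mul0r add0r /phase_down/=.
case: (eqVneq y _) => [->|_]; last by rewrite !mul0r eqxx.
case: b bk x0 nup => [|b] bk x0 nup _ /=; last first.
  rewrite !gk1 /= ltnW//; split => //; last by rewrite addnS.
  by rewrite eqn_add2l; lia.
case: a x0 nup => [|a] x0 nup /=; first by rewrite gk1 muln0 /gk eqxx.
rewrite !gk1 k0 leqnn /=; split => //; last by rewrite addn1.
by rewrite mulnS; lia.
Qed.

End ErlangStates.

Section JumpHold.
Context {d} {T : measurableType d} {R : realType} (P : probability T R).
Variables (k : nat) (la mu : R) (X : nat -> T -> nat * nat) (H : nat -> T -> R).
Hypotheses (k0 : (0 < k)%N) (la0 : 0 < la) (mu0 : 0 < mu).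
Hypothesis JH : erlang_jump_hold P k la mu X H.

Let mX : forall n x, measurable (X n @^-1` [set x]). Proof. by case: JH. Qed.
Let mH : forall n, measurable_fun setT (H n). Proof. by case: JH. Qed.
Let H0 : forall n w, 0 < H n w. Proof. by case: JH. Qed.

Definition path_event (n : nat) (x : nat -> nat * nat) : set T :=
  [set w | forall i, (i <= n)%N -> X i w = x i].

Definition path_prob (n : nat) (x : nat -> nat * nat) : R :=
  (x 0%N == (0, 0)%N)%:R * \prod_(i < n) jump_prob k la mu (x i) (x i.+1).

Lemma exit_rate_gt0 x : 0 < exit_rate k la mu x.
Proof. by rewrite /exit_rate; case: ifP => // _; rewrite addr_gt0// mulr_gt0// ltr0n. Qed.

Lemma measurable_path_event n x : measurable (path_event n x).
Proof.
rewrite (_ : path_event n x = \bigcap_(i in [set i | (i <= n)%N]) (X i @^-1` [set x i])).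
  by apply: bigcap_measurable => //; exists 0%N.
by apply/seteqP; split => w /= h i ilt; exact: h.
Qed.

Lemma path_event_tail n x (a : nat -> R) : (forall i, 0 <= a i) ->
  P (path_event n x `&` [set w | forall i, (i < n)%N -> a i < H i w]) =
  (path_prob n x * \prod_(i < n) expR (- (exit_rate k la mu (x i) * a i)))%:E.
Proof.
move=> a0; case: JH => _ _ _ _ h; have := h n x a a0.
by rewrite big_split/= mulrA.
Qed.

Lemma probability_path_event n x : P (path_event n x) = (path_prob n x)%:E.
Proof.
have := @path_event_tail n x (fun=> 0) (fun=> lexx 0).
rewrite big1 ?mulr1; last by move=> i _; rewrite mulr0 oppr0 expR0.
move=> <-; congr (P _); apply/seteqP; split => w; last by case.
by move=> h; split => // i _; exact: H0.
Qed.

(** The definition of the chain gives the formula for tails only; [determines_prod] extends it to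
    general test functions, one holding time at a time. *)
Lemma path_event_holding n x (f : nat -> R -> R) :
  (forall i, (i < n)%N -> unit_fun (f i)) ->
  \int[P]_w (\1_(path_event n x) w * \prod_(i < n) f i (H i w)) =
  path_prob n x * \prod_(i < n) exp_pairing (exit_rate k la mu (x i)) (f i).
Proof.
move=> uf.
pose E := [set f : R -> R | f = (fun=> 1) \/ exists2 a, 0 <= a & f = \1_(`]a, +oo[%classic)].
apply: (@determines_prod _ _ _ _ n _ H (fun i => exp_pairing (exit_rate k la mu (x i)))
  (fun=> E)) uf.
- by apply: measurable_indic; exact: measurable_path_event.
- by move=> w; rewrite indicE; case: (_ \in _); rewrite /= ?lexx ?ler01.
- by [].
- move=> i g _ [->|[a a0 ->]]; last exact: unit_fun_indic.
  by split => // z; rewrite ler01 lexx.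
- move=> i _; apply: determines_tail => //.
  + by apply: integrable_exponential_pdf; exact: exit_rate_gt0.
  + by move=> w; exact: ltW.
- move=> f' Ef'.
  (* Holding times are positive, so the constant 1 acts on them as the tail at [a = 0], and every
     test function becomes a tail. *)
  have /choice[a aP] : forall i, exists a : R, 0 <= a /\ ((i < n)%N ->
      (forall z, 0 < z -> f' i z = (a < z)%R%:R) /\
      exp_pairing (exit_rate k la mu (x i)) (f' i) = expR (- (exit_rate k la mu (x i) * a))).
    move=> i; have [iltn|_] := ltnP i n; last by exists 0.
    case: (Ef' i iltn) => [->|[a a0 ->]].
      exists 0; split => // _; split; first by move=> z ->.
      by rewrite exp_pairing1 ?exit_rate_gt0// mulr0 oppr0 expR0.
    exists a; split => // _; split; last by rewrite exp_pairing_tail ?exit_rate_gt0.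
    move=> z _; rewrite indicE; congr (nat_of_bool _)%:R.
    by apply/idP/idP; rewrite inE/= in_itv/= andbT.
  have [a0 aP'] : (forall i, 0 <= a i) /\ (forall i, (i < n)%N ->
      (forall z, 0 < z -> f' i z = (a i < z)%R%:R) /\
      exp_pairing (exit_rate k la mu (x i)) (f' i) = expR (- (exit_rate k la mu (x i) * a i))).
    by split => i; case: (aP i).
  set B := path_event n x `&` [set w | forall i, (i < n)%N -> a i < H i w].
  have mB : measurable B.
    apply: measurableI; first exact: measurable_path_event.
    rewrite (_ : [set w | _] = \bigcap_(i in [set i | (i < n)%N]) [set w | a i < H i w]).
      by apply: bigcap_measurableType => i _; exact: measurable_lt_set.
    by apply/seteqP; split => w /= h i ilt; exact: h.
  have e w : \1_(path_event n x) w * \prod_(i < n) f' i (H i w) = \1_B w.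
    rewrite !indicE; have [Aw|nAw] := boolP (w \in path_event n x); last first.
      by rewrite mul0r memNset// => -[/mem_set Aw]; rewrite Aw in nAw.
    rewrite mul1r; have [Bw|nBw] := boolP (w \in B).
      rewrite big1// => i _; have [-> // _] := aP' i (ltn_ord i).
      by move: Bw; rewrite inE => -[_ /(_ i (ltn_ord i)) ->].
    have [i ni] : exists i : 'I_n, ~~ (a i < H i w).
      apply/existsP; apply: contraNT nBw; rewrite negb_exists => /forallP h.
      rewrite inE; split; first exact: set_mem Aw.
      by move=> i ilt; have := h (Ordinal ilt); rewrite negbK.
    rewrite (bigD1 i)//=; have [-> // _] := aP' i (ltn_ord i).
    by rewrite (negbTE ni) mul0r.
  under eq_Rintegral do rewrite e.
  transitivity (fine (P B)); first by rewrite /Rintegral integral_indic// setIT.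
  rewrite [P B](path_event_tail n x a0)/=.
  by congr (_ * _); apply: eq_bigr => i _; have [_ ->] := aP' i (ltn_ord i).
Qed.

(** Finite paths, coded as lists, are countable in number, so almost surely no initial path of
    probability 0 occurs; a non-zero path probability has only non-zero factors. *)
Lemma ae_jump_chain :
  {ae P, forall w, X 0%N w = (0, 0)%N /\
     forall i, jump_prob k la mu (X i w) (X i.+1 w) != 0}.
Proof.
have key : {ae P, forall w (p : nat * seq (nat * nat)),
    path_event p.1 (nth (0, 0)%N p.2) w -> path_prob p.1 (nth (0, 0)%N p.2) != 0}.
  apply: (ae_forall_countable (A := fun p => [set w |
    path_event p.1 (nth (0, 0)%N p.2) w -> path_prob p.1 (nth (0, 0)%N p.2) != 0])) => p.
  have [p0|_] := eqVneq (path_prob p.1 (nth (0, 0)%N p.2)) 0; last exact: aeW.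
  have PE : P (path_event p.1 (nth (0, 0)%N p.2)) = 0%E.
    by rewrite probability_path_event p0.
  by apply: filterS (ae_not (measurable_path_event _ _) PE) => w nA /nA.
apply: filterS key => w h.
have hn n : path_prob n (X ^~ w) != 0.
  have := h (n, [seq X i w | i <- iota 0 n.+1]).
  rewrite /= /path_prob => hh.
  have e i : (i <= n)%N -> nth (0, 0)%N [seq X i w | i <- iota 0 n.+1] i = X i w.
    move=> iln; rewrite (nth_map 0%N) ?size_iota// nth_iota//.
  have := hh _; rewrite e//.
  under eq_bigr => i _ do rewrite !e ?ltn_ord ?(ltnW (ltn_ord i))//.
  by apply => i iln; rewrite e.
split.
  have := hn 0%N; rewrite /path_prob; case: (X 0%N w =P _) => // _.
  by rewrite mul0r eqxx.
move=> i; have := hn i.+1; rewrite /path_prob big_ord_recr/= !mulf_eq0.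
by rewrite !negb_or => /andP[_ /andP[]].
Qed.

Lemma ae_jump_chain_states :
  {ae P, forall w, X 0%N w = (0, 0)%N /\ forall i,
    [/\ erlang_state k (X i w), gk k (X i w) != gk k (X i.+1 w) &
        gk k (X i w) = 0%N -> gk k (X i.+1 w) != 0%N]}.
Proof.
apply: filterS ae_jump_chain => w [x0 h]; split => // i.
suff si : erlang_state k (X i w).
  by have [] := jump_prob_neq0 k0 si (h i).
elim: i => [|i IH]; first by rewrite x0.
by have [] := jump_prob_neq0 k0 IH (h i).
Qed.

End JumpHold.

(** * Joint Laplace transform of the sojourn times *)

Section Glue.
Context {d} {T : measurableType d} {R : realType}.

Lemma measurable_glue (V : T -> nat) (F : nat -> T -> R) :
  (forall n, measurable (V @^-1` [set n])) ->
  (forall n, measurable_fun setT (F n)) -> measurable_fun setT (fun w => F (V w) w).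
Proof.
move=> mV mF _ B mB; rewrite setTI.
rewrite (_ : _ @^-1` _ = \bigcup_n (V @^-1` [set n] `&` F n @^-1` B)).
  apply: bigcup_measurable => n _; apply: measurableI => //.
  by rewrite -[X in measurable X]setTI; exact: mF.
apply/seteqP; split => w /=; first by move=> h; exists (V w).
by move=> [n _ [/= <-]].
Qed.

Lemma measurable_truncn_level (f : T -> R) (j : nat) :
  measurable_fun setT f -> measurable [set w | (Num.truncn (f w)).-1 = j].
Proof.
move=> mf.
have mt i : measurable [set w | (i <= Num.truncn (f w))%N].
  case: i => [|i].
    by rewrite (_ : [set w | _] = setT)//; apply/seteqP; split => w.
  rewrite (_ : [set w | _] = [set w | i.+1%:R <= f w]); first exact: measurable_le_set.
  by apply/seteqP; split => w /=; rewrite truncn_gt_nat.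
have mE i : measurable [set w | Num.truncn (f w) = i].
  rewrite (_ : [set w | _] = [set w | (i <= Num.truncn (f w))%N] `&`
     ~` [set w | (i.+1 <= Num.truncn (f w))%N]).
    by apply: measurableI => //; exact: measurableC.
  apply/seteqP; split => w /=; first by move=> ->; rewrite leqnn ltnn.
  by move=> [h1 /negP]; rewrite -leqNgt => h2; apply/eqP; rewrite eqn_leq h2.
have := @measurable_preimage_nat _ _ (fun w => Num.truncn (f w))
  [set i | i.-1 = j] mE.
exact.
Qed.

End Glue.

(** * Increments of the subordinator on an event independent of it *)

Section IndependentIncrements.
Context {d} {T : measurableType d} {R : realType} (P : probability T R).
Variables (th al : R) (D : R -> T -> R) (E : set T).
Hypothesis TS : tempered_subordinator P th al D.
Hypothesis mE : measurable E.
Hypothesis E_indep : forall B : set T,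
  <<s [set B' | exists t (C : set R), [/\ 0 <= t, measurable C & B' = D t @^-1` C]] >> B ->
  P (E `&` B) = (P E * P B)%E.

Let mD : forall t, measurable_fun setT (D t). Proof. by case: TS. Qed.

(** Stationarity is given on Borel sets; [same_pairing_fun] carries it over to the exponential. *)
Lemma increment_laplace t h s : 0 <= t -> 0 <= h -> 0 <= s ->
  \int[P]_w expR (- (s * (D (t + h) w - D t w))) =
  expR (- (h * laplace_exponent th al s)).
Proof.
move=> t0 h0 s0; rewrite -(subordinator_laplace TS)//.
have Dle : forall w s t, 0 <= s -> s <= t -> D s w <= D t w.
  by case: TS => _ [_ []].
have i1 : P.-integrable setT (EFin \o (fun=> 1 : R)).
  exact: finite_measure_integrable_cst.
have mI : measurable_fun setT (fun w => D (t + h) w - D t w) by exact: measurable_funB.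
have K : same_pairing P P (fun=> 1) (fun w => D (t + h) w - D t w) (fun=> 1) (D h)
    (fun z => expR (- (s * `|z|))).
  have [me e01] := unit_fun_exp s0.
  apply: same_pairing_fun => //.
  - by move=> w; rewrite subr_ge0 Dle// lerDl.
  - by move=> w; exact: (subordinator_ge0 TS).
  move=> B mB; rewrite /same_pairing.
  have ind (Z : T -> R) : measurable_fun setT Z ->
      \int[P]_w (1 * \1_B (Z w)) = fine (P (Z @^-1` B)).
    move=> mZ; rewrite /Rintegral.
    have mZB : measurable (Z @^-1` B) by rewrite -[X in measurable X]setTI; exact: mZ.
    have := @integral_indic _ _ _ P setT measurableT _ mZB; rewrite setIT => <-.
    by congr fine; apply: eq_integral => w _; rewrite mul1r.
  rewrite !ind//; case: TS => _ [_ [_ [_ [_ [st _]]]]].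
  by rewrite st.
move: K; rewrite /same_pairing.
under eq_Rintegral => w _ do rewrite mul1r ger0_norm ?subr_ge0 ?Dle ?lerDl//.
under [X in _ = X -> _]eq_Rintegral => w _ do
  rewrite mul1r ger0_norm ?(subordinator_ge0 TS)//.
by [].
Qed.

Lemma increments_laplace n (t s : nat -> R) : 0 <= t 0%N ->
  (forall i, t i <= t i.+1) -> (forall i, 0 <= s i) ->
  \int[P]_w (\1_E w * \prod_(i < n) expR (- (s i * (D (t i.+1) w - D (t i) w)))) =
  fine (P E) * \prod_(i < n) expR (- ((t i.+1 - t i) * laplace_exponent th al (s i))).
Proof.
move=> t0 tS s0.
have Dle : forall w s t, 0 <= s -> s <= t -> D s w <= D t w.
  by case: TS => _ [_ []].
have tn0 i : 0 <= t i by elim: i => // i IH; rewrite (le_trans IH).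
pose Z i w := D (t i.+1) w - D (t i) w.
have Z0 i w : 0 <= Z i w by rewrite subr_ge0 Dle.
have mZ i : measurable_fun setT (Z i) by exact: measurable_funB.
have i1 : P.-integrable setT (EFin \o (fun=> 1 : R)).
  exact: finite_measure_integrable_cst.
have mZB i (B : set R) : measurable B -> measurable (Z i @^-1` B).
  by move=> mB; rewrite -[X in measurable X]setTI; exact: mZ.
pose l i f := \int[P]_w (1 * f (Z i w)) : R.
have lB i (B : set R) : measurable B -> l i \1_B = fine (P (Z i @^-1` B)).
  move=> mB; have := @integral_indic _ _ _ P setT measurableT _ (mZB i B mB).
  rewrite setIT => <-; rewrite /l /Rintegral; congr fine.
  by apply: eq_integral => w _; rewrite mul1r.
pose f i (z : R) : R := expR (- (s i * `|z|)).
have main : \int[P]_w (\1_E w * \prod_(i < n) f i (Z i w)) =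
    fine (P E) * \prod_(i < n) l i (f i).
  apply: (@determines_prod _ _ _ P n \1_E Z l
    (fun=> [set f | exists2 B, measurable B & f = \1_B])) => //.
  - by move=> w; rewrite indicE; case: (_ \in _); rewrite /= ?lexx ?ler01.
  - by move=> i g _ [B mB ->]; exact: unit_fun_indic.
  - by move=> i _; exact: determines_set.
  - move=> g Eg.
    have /choice[B BP] : forall i, exists B : set R, measurable B /\
        ((i < n)%N -> g i = \1_B).
      move=> i; have [iltn|_] := ltnP i n; last by exists setT.
      by have [B mB ->] := Eg i iltn; exists B.
    have mB i : measurable (B i) by case: (BP i).
    have gE i : (i < n)%N -> g i = \1_(B i) by case: (BP i).
    pose C := [set w | forall i : 'I_n, B i (Z i w)].
    have CE : C = \bigcap_(i in [set i | (i < n)%N]) (Z i @^-1` B i).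
      apply/seteqP; split => w /= h i; first by move=> ilt; exact: (h (Ordinal ilt)).
      exact: (h i (ltn_ord i)).
    have mC : measurable C by rewrite CE; apply: bigcap_measurableType => i _; exact: mZB.
    have PC : P C = (\prod_(i < n) P (Z i @^-1` B i))%E.
      case: TS => _ [_ [_ [_ [ind _]]]].
      exact: (ind n t t0 tS (fun i : 'I_n => B i) (fun i => mB i)).
    (* [E_indep] speaks of events generated by [D], so [C] has to be measurable for that smaller
       sigma-algebra. *)
    have GC : <<s [set B' | exists t (C : set R),
        [/\ 0 <= t, measurable C & B' = D t @^-1` C]] >> C.
      pose G := [set B' | exists t (C : set R), [/\ 0 <= t, measurable C & B' = D t @^-1` C]].
      have mDG u : 0 <= u -> measurable_fun (setT : set (g_sigma_algebraType G)) (D u).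
        move=> u0 _ A mA; rewrite setTI; apply: sub_gen_smallest.
        by exists u, A.
      have : @measurable _ (g_sigma_algebraType G) C.
        rewrite CE; apply: bigcap_measurableType => i _.
        rewrite -[X in measurable X]setTI.
        by apply: measurable_funB => //; exact: mDG.
      exact.
    transitivity (fine (P (E `&` C))).
      rewrite -[E `&` C]setIT -integral_indic//; last exact: measurableI.
      congr fine; apply: eq_integral => w _; congr EFin.
      rewrite indicI/=; congr (_ * _); rewrite [RHS]indicE.
      have [Cw|nCw] := boolP (w \in C).
        rewrite big1// => i _; rewrite gE// indicE mem_set//.
        by move: Cw; rewrite inE => /(_ i).
      have [i ni] : exists i : 'I_n, Z i w \notin B i.
        apply/existsP; apply: contraNT nCw; rewrite negb_exists => /forallP h.
        rewrite inE => i; have := h i; rewrite negbK; exact: set_mem.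
      by rewrite (bigD1 i)//= gE// indicE (negbTE ni) mul0r.
    rewrite (E_indep GC) fineM ?fin_num_measure//.
    congr (_ * _); rewrite PC.
    rewrite (eq_bigr (fun i : 'I_n => (l i (g i))%:E)); last first.
      by move=> i _; rewrite gE// lB// fineK// fin_num_measure//; exact: mZB.
    by rewrite prodEFin.
  - by move=> i _; exact: unit_fun_exp.
transitivity (\int[P]_w (\1_E w * \prod_(i < n) f i (Z i w))).
  apply: eq_Rintegral => w _; congr (_ * _); apply: eq_bigr => i _.
  by rewrite /f ger0_norm.
rewrite main; congr (_ * _); apply: eq_bigr => i _.
rewrite /l /f; under eq_Rintegral => w _ do rewrite mul1r ger0_norm//.
rewrite /Z -[t i.+1](subrK (t i)) [_ - _ + _]addrC increment_laplace//; last by rewrite subr_ge0.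
by rewrite addrAC subrr add0r.
Qed.

End IndependentIncrements.

Section SeqEvents.
Context {d} {T : measurableType d} {C : countType} (c0 : C).

Definition seq_code (U : nat -> T -> C) (M : nat) (w : T) : nat :=
  pickle [seq U i w | i <- iota 0 M].

Definition code_nth (c i : nat) : C := nth c0 (odflt [::] (unpickle c)) i.

Lemma code_nthE U M w i : (i < M)%N -> code_nth (seq_code U M w) i = U i w.
Proof.
move=> iM; rewrite /code_nth pickleK/= (nth_map 0%N) ?size_iota//.
by rewrite nth_iota.
Qed.

(** A number that does not code a list of length [M] has an empty fibre; the test recognises this by
    encoding the decoded entries again. *)
Lemma seq_codeE U M c : [set w | seq_code U M w = c] =
  if pickle [seq code_nth c i | i <- iota 0 M] == c
  then [set w | forall i, (i < M)%N -> U i w = code_nth c i] else set0.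
Proof.
apply/seteqP; split => w /=.
  move=> <-; rewrite ifT.
    by move=> i iM; rewrite code_nthE.
  apply/eqP; congr pickle; apply/eq_in_map => i; rewrite mem_iota => iM.
  by rewrite code_nthE.
case: eqP => // pc h; rewrite -[RHS]pc; congr pickle.
by apply/eq_in_map => i; rewrite mem_iota => /h.
Qed.

Lemma measurable_seq_code U M c : (forall i x, measurable (U i @^-1` [set x])) ->
  measurable [set w | seq_code U M w = c].
Proof.
move=> mU; rewrite seq_codeE; case: ifP => // _.
rewrite (_ : [set w | _] = \bigcap_(i in [set i | (i < M)%N]) (U i @^-1` [set code_nth c i])).
  by apply: bigcap_measurableType => i _; exact: mU.
by apply/seteqP; split => w /= h i ilt; exact: h.
Qed.

End SeqEvents.

Section AeConvergence.
Context {d} {T : measurableType d} {R : realType} (P : probability T R).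

Lemma ae_bounded_cvg_Rintegral (f : T -> R) (g : nat -> T -> R) (M : R) :
  measurable_fun setT f -> (forall n, measurable_fun setT (g n)) ->
  (forall n x, `|g n x| <= M) -> {ae P, forall x, g ^~ x @ \oo --> f x} ->
  (\int[P]_x g n x) @[n --> \oo] --> \int[P]_x f x.
Proof.
move=> mf mg gM gf.
have iM : P.-integrable setT (EFin \o (fun=> M)) by exact: finite_measure_integrable_cst.
have [] := @dominated_convergence _ _ _ P setT measurableT
  (fun n x => (g n x)%:E) (EFin \o f) (EFin \o (fun=> M)).
- by move=> n; exact/measurable_EFinP.
- exact/measurable_EFinP.
- by apply: filterS gf => x gfx _; apply: cvg_EFin => //; exact: nearW.
- exact: iM.
- by apply: aeW => x n _; rewrite lee_fin.
move=> intf _ cv.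
apply: fine_cvg; rewrite fineK//; exact: integrable_fin_num.
Qed.

Lemma ae_eq_Rintegral (f g : T -> R) :
  measurable_fun setT f -> measurable_fun setT g ->
  {ae P, forall w, f w = g w} -> \int[P]_w f w = \int[P]_w g w.
Proof.
move=> mf mg fg; rewrite /Rintegral; congr fine.
apply: ae_eq_integral => //; [exact/measurable_EFinP|exact/measurable_EFinP|].
by apply: filterS fg => w -> _.
Qed.

End AeConvergence.

Lemma cvg_expRN {R : realType} (u : nat -> R) (l : R) :
  u @ \oo --> l -> (fun n => expR (- u n)) @ \oo --> expR (- l).
Proof.
move=> ul; apply: (@cvg_comp _ _ _ _ expR _ _ _ (cvgN ul)).
exact: continuous_expR.
Qed.

Section TransitionLaplace.
Context {R : realType} {d : measure_display} {T : measurableType d}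
  (P : probability T R).
Variables (k : nat) (la mu th al : R)
  (X : nat -> T -> nat * nat) (H : nat -> T -> R) (D : R -> T -> R).
Hypotheses (k0 : (0 < k)%N) (la0 : 0 < la) (mu0 : 0 < mu) (th0 : 0 < th)
  (al01 : 0 < al < 1).
Hypothesis JH : erlang_jump_hold P k la mu X H.
Hypothesis TS : tempered_subordinator P th al D.
Hypothesis QD : indep_processes P (ctmc_path X H) D.

Let mX : forall n x, measurable (X n @^-1` [set x]). Proof. by case: JH. Qed.
Let mH : forall n, measurable_fun setT (H n). Proof. by case: JH. Qed.
Let H0 : forall n w, 0 < H n w. Proof. by case: JH. Qed.
Let nonexp : forall w t, exists n, t < jtime H n w. Proof. by case: JH. Qed.
Let mD : forall t, measurable_fun setT (D t). Proof. by case: TS. Qed.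
Let D0 : forall w, D 0 w = 0. Proof. by case: TS => _ []. Qed.
Let Dle : forall w s t, 0 <= s -> s <= t -> D s w <= D t w.
Proof. by case: TS => _ [_ []]. Qed.

Let Q := ctmc_path X H.
Let L := qlen k Q D.
Let psi := laplace_exponent th al.

(* The jump chain and the holding times are recovered from the path of [Q]
   alone, so that they are measurable for the sigma-algebra independent of [D]. *)
Let GQ := [set A | exists t x, 0 <= t /\ A = Q t @^-1` [set x]].
Let TQ := g_sigma_algebraType GQ.

Let code (u : R) (w : TQ) : nat := pickle (Q u w).

Let mcode u : 0 <= u -> forall m, measurable (code u @^-1` [set m]).
Proof.
move=> u0 n; rewrite (_ : _ @^-1` _ =
    if @pickle_inv (nat * nat)%type n is Some x then Q u @^-1` [set x] else set0).
  case: pickle_inv => // x; apply: sub_gen_smallest.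
  by exists u, x.
apply/seteqP; split => w /=; first by move=> <-; rewrite pickleK_inv.
case E : (pickle_inv n) => [x|] //=; rewrite /code => ->.
by have := @pickle_invK (nat * nat)%type n; rewrite E.
Qed.

Let rcode (w : TQ) u : 0 <= u ->
  exists2 e, 0 < e & forall v, u <= v < u + e -> code v w = code u w.
Proof.
move=> u0; have [e e0 He] := ctmc_path_right_continuous X H0 nonexp w u0.
by exists e => // v uv; rewrite /code /Q He.
Qed.

Let jumpQ i (w : TQ) : R := trans_time code i w.
Let stateQ i (w : TQ) : nat := code (jumpQ i w) w.
(* Rounding strictly below [(n+1) H] keeps the discretised jump times strictly
   before the true ones, so that [D] converges there to its left limit. *)
Let kap n i (w : TQ) : nat := (Num.truncn (n.+1%:R * (jumpQ i.+1 w - jumpQ i w))).-1.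

Let mkap n i j : measurable (kap n i @^-1` [set j]).
Proof.
have mj l : measurable_fun setT (jumpQ l) by exact: measurable_trans_time.
by apply: measurable_truncn_level; apply: measurable_funM => //; exact: measurable_funB.
Qed.

Let sub_GQ (A : set T) : <<s GQ >> A -> measurable A.
Proof.
apply: smallest_sub; first exact: sigma_algebra_measurable.
by move=> _ [t [x [t0 ->]]]; exact: measurable_ctmc_path.
Qed.

Definition good_path (w : T) : Prop :=
  [/\ X 0%N w = (0, 0)%N,
      forall i, [/\ erlang_state k (X i w), gk k (X i w) != gk k (X i.+1 w) &
        gk k (X i w) = 0%N -> gk k (X i.+1 w) != 0%N],
      forall s t, 0 <= s -> s < t -> D s w < D t w &
      forall K, exists2 t, 0 <= t & K < D t w].

Lemma ae_good_path : {ae P, forall w, good_path w}.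
Proof.
have h1 := ae_jump_chain_states k0 JH.
have h2 := ae_subordinator_increasing th0 al01 TS.
have h3 := ae_subordinator_unbounded th0 al01 TS.
by apply: filterS3 h1 h2 h3 => w [a b] c e; split.
Qed.

Let jumpQE w i : good_path w -> jumpQ i w = jtime H i w.
Proof.
move=> [_ st _ _].
apply: (@trans_timeE _ TQ _ code w (fun i => jtime H i w)) => //.
- exact: jtime0.
- by move=> m; exact: lt_jtime.
- move=> m u mu'; rewrite /code /Q !(@ctmc_pathE _ _ _ _ _ H0 m)//.
  by rewrite lexx lt_jtime.
- move=> m; rewrite /code /Q (@ctmc_pathE _ _ _ _ _ H0 m.+1) ?lexx ?lt_jtime//.
  rewrite (@ctmc_pathE _ _ _ _ _ H0 m) ?lexx ?lt_jtime//.
  apply/eqP => /(pcan_inj pickleK) e.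
  by have [_ + _] := st m; rewrite e eqxx.
Qed.

Let stateQE w i : good_path w -> stateQ i w = pickle (X i w).
Proof.
move=> gw; rewrite /stateQ jumpQE// /code /Q; congr pickle.
by apply: ctmc_pathE; rewrite // lexx lt_jtime.
Qed.

Let kapE w n i : good_path w -> kap n i w = (Num.truncn (n.+1%:R * H i w)).-1.
Proof. by move=> gw; rewrite /kap !jumpQE// jtimeS addrAC subrr add0r. Qed.

(** A copy of [path_event X M x] inside the sigma-algebra of [Q]; the two agree on good paths. *)
Let AQ M (x : nat -> nat * nat) : set T :=
  [set w | forall i, (i <= M)%N -> stateQ i w = pickle (x i)].

Let mAQ M x : @measurable _ TQ (AQ M x).
Proof.
rewrite (_ : AQ M x = \bigcap_(i in [set i | (i <= M)%N]) (stateQ i @^-1` [set pickle (x i)])).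
  by apply: bigcap_measurableType => i _; exact: measurable_at_trans_time.
by apply/seteqP; split => w /= h i ilt; exact: h.
Qed.

(** The rounded jump times; [ctime] computes them from the code of the rounded holding times, so
    that they are constants once the code is fixed. *)
Let time n i (w : T) : R := \sum_(l < i) (kap n l w)%:R / n.+1%:R.
Let ctime n c i : R := \sum_(l < i) (code_nth 0%N c l)%:R / n.+1%:R.

Let timeE n M i w : (i <= M)%N -> ctime n (seq_code (kap n) M w) i = time n i w.
Proof.
move=> iM; apply: eq_bigr => l _; rewrite code_nthE//.
exact: leq_trans (ltn_ord l) iM.
Qed.

Section Discretized.
Variables (M : nat) (x : nat -> nat * nat) (s : nat -> R).
Hypothesis s0 : forall i, 0 <= s i.

(** [G] below is [F] with the increments of [D] averaged out. *)
Let F n c (w : T) : R := \1_(AQ M x) w *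
  \prod_(i < M) expR (- (s i * (D (ctime n c i.+1) w - D (ctime n c i) w))).
Let G n c (w : T) : R := \1_(AQ M x) w *
  \prod_(i < M) expR (- ((ctime n c i.+1 - ctime n c i) * psi (s i))).
Let V n (w : T) : nat := seq_code (kap n) M w.

Let ctime_ge0 n c i : 0 <= ctime n c i.
Proof. by apply: sumr_ge0 => l _; rewrite divr_ge0. Qed.

Let ctimeS n c i : ctime n c i <= ctime n c i.+1.
Proof. by rewrite /ctime big_ord_recr/= lerDl divr_ge0. Qed.

Let psi0 i : 0 <= psi (s i). Proof. exact: laplace_exponent_ge0. Qed.

Let mF n c : measurable_fun setT (F n c).
Proof.
apply: measurable_funM; first by apply: measurable_indic; apply: sub_GQ; exact: mAQ.
apply: measurable_prod => i _; apply: measurableT_comp => //.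
apply: measurableT_comp => //; apply: measurable_funM => //.
exact: measurable_funB.
Qed.

Let mG n c : measurable_fun setT (G n c).
Proof.
by apply: measurable_funM => //; apply: measurable_indic; apply: sub_GQ; exact: mAQ.
Qed.

Let mV n c : measurable (V n @^-1` [set c]).
Proof. by apply: sub_GQ; apply: (@measurable_seq_code _ TQ _ 0%N) => i j; exact: mkap. Qed.

Let F01 n c w : 0 <= F n c w <= 1.
Proof.
have p01 : 0 <= \prod_(i < M) expR (- (s i * (D (ctime n c i.+1) w - D (ctime n c i) w))) <= 1.
  apply/andP; split; first by apply: prodr_ge0 => i _; exact: expR_ge0.
  apply: prodr_ile1 => i _; rewrite expR_ge0 expR_le1 oppr_le0 mulr_ge0//.
  by rewrite subr_ge0 Dle.
by rewrite /F indicE; case: (_ \in _); rewrite /= ?mul1r ?mul0r ?lexx ?ler01.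
Qed.

Let G01 n c w : 0 <= G n c w <= 1.
Proof.
have p01 : 0 <= \prod_(i < M) expR (- ((ctime n c i.+1 - ctime n c i) * psi (s i))) <= 1.
  apply/andP; split; first by apply: prodr_ge0 => i _; exact: expR_ge0.
  apply: prodr_ile1 => i _; rewrite expR_ge0 expR_le1 oppr_le0 mulr_ge0//.
  by rewrite subr_ge0.
by rewrite /G indicE; case: (_ \in _); rewrite /= ?mul1r ?mul0r ?lexx ?ler01.
Qed.

(** On the fibre of a code [c] the times are the constants [ctime n c], and the fibre cut with
    [AQ M x] is an event of [Q], so [increments_laplace] applies there; the fibres are then
    summed. *)
Let discrete_identity n : \int[P]_w F n (V n w) w = \int[P]_w G n (V n w) w.
Proof.
have mFV : measurable_fun setT (fun w => F n (V n w) w) by exact: measurable_glue.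
have mGV : measurable_fun setT (fun w => G n (V n w) w) by exact: measurable_glue.
have iF : P.-integrable setT (EFin \o (fun w => F n (V n w) w)).
  by apply: (integrable_unit _ mFV) => w; exact: F01.
have iG : P.-integrable setT (EFin \o (fun w => G n (V n w) w)).
  by apply: (integrable_unit _ mGV) => w; exact: G01.
apply: (eq_Rintegral_partition (mV n) iF iG) => c; pose E := AQ M x `&` (V n @^-1` [set c]).
have GE : <<s GQ >> E.
  have : @measurable _ TQ E.
    apply: measurableI => //.
    by apply: (@measurable_seq_code _ TQ _ 0%N) => i j; exact: mkap.
  exact.
have mE := sub_GQ GE.
have eE w (Y : R) : \1_(AQ M x) w * Y * \1_(V n @^-1` [set c]) w = \1_E w * Y.
  by rewrite indicI/= mulrAC.
have iV w : \1_(V n @^-1` [set c]) w = (V n w == c)%:R :> R.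
  rewrite indicE; congr (nat_of_bool _)%:R.
  by apply/idP/eqP; rewrite inE.
transitivity (\int[P]_w (\1_E w *
    \prod_(i < M) expR (- (s i * (D (ctime n c i.+1) w - D (ctime n c i) w))))).
  apply: eq_Rintegral => w _; rewrite -eE /F iV.
  by case: eqP => [->|_] //; rewrite !mulr0.
rewrite (increments_laplace TS mE (fun B GB => QD GE GB) M (ctime_ge0 n c 0) (ctimeS n c) s0).
transitivity (\int[P]_w (\1_E w *
    \prod_(i < M) expR (- ((ctime n c i.+1 - ctime n c i) * psi (s i))))).
  rewrite RintegralZr//; last exact: integrable_indic.
  congr (_ * _).
  by rewrite /Rintegral integral_indic// setIT.
apply: eq_Rintegral => w _; rewrite -eE /G iV.
by case: eqP => [->|_] //; rewrite !mulr0.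
Qed.

Let kapH (w : T) i : good_path w ->
  (fun n => (kap n i w)%:R / n.+1%:R) @ \oo --> H i w.
Proof.
move=> gw; apply/cvgrPdist_le => e e0; near=> n.
rewrite kapE//; set m := Num.truncn _.
have n0 : 0 < n.+1%:R :> R by [].
have /andP[h1 h2] := truncn_itv (mulr_ge0 (ltW n0) (ltW (H0 i w))).
rewrite -/m in h1 h2.
(* Integer part and predecessor together lose at most two units of [1 / (n+1)]. *)
have en : 2 <= e * n.+1%:R.
  rewrite mulrC -ler_pdivrMr// (@le_trans _ _ n%:R)//; last by rewrite ler_nat.
  by near: n; exact: nbhs_infty_ger.
have m1 : m%:R - 1 <= m.-1%:R :> R by case: (m) => [|m'] /=; rewrite -?natr1; lra.
have m2 : m.-1%:R <= m%:R :> R by rewrite ler_nat leq_pred.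
rewrite ler_norml; apply/andP; split.
  rewrite lerBrDr addrC -lerBrDr opprK ler_pdivrMr//.
  by have := H0 i w; nra.
rewrite lerBlDr -lerBlDl ler_pdivlMr// mulrBl.
by rewrite -natr1 in h2; lra.
Unshelve. all: by end_near. Qed.

Let kap_lt (w : T) n i : good_path w -> (kap n i w)%:R / n.+1%:R < H i w.
Proof.
move=> gw; rewrite kapE// ltr_pdivrMr// [H i w * _]mulrC.
have nH : 0 < n.+1%:R * H i w by rewrite mulr_gt0.
have /andP[h1 h2] := truncn_itv (ltW nH).
case E : (Num.truncn (n.+1%:R * H i w)) => [|m] //=.
by apply: lt_le_trans h1; rewrite E ltr_nat.
Qed.

Let D_time (w : T) i : good_path w ->
  (fun n => D (time n i w) w) @ \oo --> trans_time L i w.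
Proof.
move=> gw; have [_ st Dlt Dunb] := gw.
have Xn m : gk k (X m w) != gk k (X m.+1 w) by have [] := st m.
rewrite (@trans_time_qlen _ _ _ k X H D H0 D0 Dle w Dlt Dunb Xn).
(* Nothing lies strictly below the jump time 0; there both sides are 0. *)
case: i => [|i].
  rewrite jtime0 left_value0; apply: cvg_near_cst; apply: nearW => n.
  by rewrite /time big_ord0 D0.
apply: cvg_left_value => //.
  move=> n; apply/andP; split; first by apply: sumr_ge0 => l _; rewrite divr_ge0.
  rewrite /time /jtime; elim: i => [|i IH].
    by rewrite !big_ord_recr !big_ord0 /= !add0r kap_lt.
  rewrite big_ord_recr [ltRHS]big_ord_recr/= ltrD// kap_lt//.
by apply: (cvg_big (@add_continuous _)) => l _; exact: kapH.
Qed.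

(** Dominated convergence in [discrete_identity]: [F] tends to the left-hand integrand and [G] to
    the path indicator times [prod e^{-psi(s_i) H_i}]. An exponential holding time of rate [q] has
    transform [q / (q + p)] at [p = psi(s_i)]. *)
Lemma transition_laplace :
  \int[P]_w (\1_(path_event X M x) w *
     \prod_(i < M) expR (- (s i * (trans_time L i.+1 w - trans_time L i w)))) =
  path_prob k la mu M x * \prod_(i < M)
     (exit_rate k la mu (x i) / (exit_rate k la mu (x i) + psi (s i))).
Proof.
have mFV n : measurable_fun setT (fun w => F n (V n w) w) by exact: measurable_glue.
have mGV n : measurable_fun setT (fun w => G n (V n w) w) by exact: measurable_glue.
have mA : measurable (path_event X M x) by exact: (measurable_path_event JH).
have mtau i : measurable_fun setT (trans_time L i).
  apply: measurable_trans_time.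
    by move=> u _ m; exact: measurable_qlen.
  by move=> w u; exact: qlen_right_continuous.
have AE w : good_path w -> \1_(AQ M x) w = \1_(path_event X M x) w :> R.
  move=> gw; rewrite !indicE; congr (nat_of_bool _)%:R; apply/idP/idP; rewrite !inE => h i iM.
    by have := h i iM; rewrite stateQE// => /(pcan_inj pickleK).
  by rewrite stateQE// h.
pose f w := \1_(path_event X M x) w *
     \prod_(i < M) expR (- (s i * (trans_time L i.+1 w - trans_time L i w))).
pose g w := \1_(path_event X M x) w *
     \prod_(i < M) expR (- (psi (s i) * `|H i w|)).
have cF : (\int[P]_w F n (V n w) w) @[n --> \oo] --> \int[P]_w f w.
  apply: (@ae_bounded_cvg_Rintegral _ _ _ P _ _ 1) => //.
  - apply: measurable_funM; first exact: measurable_indic.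
    apply: measurable_prod => i _; apply: measurableT_comp => //.
    apply: measurableT_comp => //; apply: measurable_funM => //.
    exact: measurable_funB.
  - by move=> n w; have /andP[a b] := F01 n (V n w) w; rewrite ger0_norm.
  - apply: filterS ae_good_path => w gw; rewrite /F /f AE//.
    apply: cvgM; first exact: cvg_cst.
    apply: (cvg_big (@mul_continuous _)) => i _.
    apply: cvg_expRN; apply: cvgM; first exact: cvg_cst.
    rewrite (_ : (fun n => _) = (fun n => D (time n i.+1 w) w - D (time n i w) w)).
      by apply: cvgB; exact: D_time.
    by apply/funext => n; rewrite !timeE// ltnW.
have cG : (\int[P]_w G n (V n w) w) @[n --> \oo] --> \int[P]_w g w.
  apply: (@ae_bounded_cvg_Rintegral _ _ _ P _ _ 1) => //.
  - apply: measurable_funM; first exact: measurable_indic.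
    apply: measurable_prod => i _; apply: measurableT_comp => //.
    apply: measurableT_comp => //; apply: measurable_funM => //.
    exact: measurableT_comp.
  - by move=> n w; have /andP[a b] := G01 n (V n w) w; rewrite ger0_norm.
  - apply: filterS ae_good_path => w gw; rewrite /G /g AE//.
    apply: cvgM; first exact: cvg_cst.
    apply: (cvg_big (@mul_continuous _)) => i _.
    rewrite mulrC ger0_norm ?ltW//.
    apply: cvg_expRN; apply: cvgM; last exact: cvg_cst.
    rewrite (_ : (fun n => _) = (fun n => (kap n i w)%:R / n.+1%:R)); first exact: kapH.
    apply/funext => n; rewrite !timeE//; last exact: ltnW.
    by rewrite /time big_ord_recr/= addrAC subrr add0r.
have e : (fun n => \int[P]_w F n (V n w) w) = (fun n => \int[P]_w G n (V n w) w).
  by apply/funext => n; exact: discrete_identity.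
rewrite e in cF; rewrite -/f (cvg_unique _ cF cG)//.
pose h i (z : R) : R := expR (- (psi (s i) * `|z|)).
have uh i : (i < M)%N -> unit_fun (h i) by move=> _; exact: unit_fun_exp.
rewrite [LHS](path_event_holding k0 la0 mu0 JH x uh).
congr (_ * _); apply: eq_bigr => i _.
by rewrite /h exp_pairing_exp//; exact: exit_rate_gt0.
Qed.

End Discretized.

Lemma measurable_trans_time_qlen i : measurable_fun setT (trans_time L i).
Proof.
apply: measurable_trans_time; first by move=> u _ m; exact: measurable_qlen.
by move=> w u; exact: qlen_right_continuous.
Qed.

Lemma measurable_nz_sojourn_qlen n : measurable_fun setT (nz_sojourn L n).
Proof.
apply: measurable_nz_sojourn; first by move=> u _ m; exact: measurable_qlen.
by move=> w u; exact: qlen_right_continuous.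
Qed.

Let visits (x : nat -> nat * nat) m : nat := (\sum_(i < m) (gk k (x i) != 0))%N.

Let visitsS x m : visits x m.+1 = (visits x m + (gk k (x m) != 0))%N.
Proof. by rewrite /visits big_ord_recr. Qed.

(** Of two consecutive states at least one is non-zero. *)
Let visits_double x n :
  (forall i, (i < n.*2)%N -> gk k (x i) = 0%N -> gk k (x i.+1) != 0%N) ->
  (n <= visits x n.*2)%N.
Proof.
elim: n => // n IH h; rewrite doubleS !visitsS -addnA.
have h' : (n <= visits x n.*2)%N.
  apply: IH => i ilt; apply: h; rewrite doubleS.
  exact: leq_trans ilt (leqW (leqnSn _)).
rewrite -addn1 leq_add//.
have [e0|//] := eqVneq (gk k (x n.*2)) 0%N.
by rewrite h// doubleS ltnS leqnSn.
Qed.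

(** At the non-zero steps the counter [visits x i] runs through 0, 1, 2, ... without repetition,
    which turns a product over transitions into one over sojourns. *)
Let prod_visits (x : nat -> nat * nat) M N (h : nat -> R) :
  \prod_(i < M) (if (gk k (x i) != 0%N) && (visits x i < N)%N
                 then h (visits x i) else 1) =
  \prod_(j < minn N (visits x M)) h j.
Proof.
elim: M => [|M IH]; first by rewrite big_ord0 /visits big_ord0 minn0 big_ord0.
rewrite big_ord_recr/= IH visitsS.
case: eqP => _ /=; first by rewrite addn0 mulr1.
case: (boolP (visits x M < N)%N) => [lt|]; last rewrite -leqNgt => ge.
  by rewrite addn1 (minn_idPr (ltnW lt)) (minn_idPr lt) big_ord_recr.
by rewrite mulr1 addn1 (minn_idPl ge) (minn_idPl (leqW ge)).
Qed.

Let c : R := la + k%:R * mu.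

Let sojournE w i : good_path w -> gk k (X i w) != 0%N ->
  nz_sojourn L (visits (X ^~ w) i) w = trans_time L i.+1 w - trans_time L i w.
Proof.
move=> gw Xi; have [_ st Dlt Dunb] := gw.
have Xn m : gk k (X m w) != gk k (X m.+1 w) by have [] := st m.
have LE m : L (trans_time L m w) w = gk k (X m w).
  by rewrite (@trans_time_qlen _ _ _ k X H D H0 D0 Dle w Dlt Dunb Xn); exact: qlen_left_value.
rewrite /nz_sojourn; suff -> : nz_visit L (visits (X ^~ w) i) w = i by [].
apply: nz_visitE; first by rewrite LE.
by apply: eq_bigr => j _; rewrite LE.
Qed.

Let trans_time_lt w i : good_path w -> trans_time L i w < trans_time L i.+1 w.
Proof.
move=> gw; have [_ st Dlt Dunb] := gw.
have Xn m : gk k (X m w) != gk k (X m.+1 w) by have [] := st m.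
rewrite !(@trans_time_qlen _ _ _ k X H D H0 D0 Dle w Dlt Dunb Xn).
exact: left_value_jtime_lt.
Qed.

(** On a good path the visit number [n] exists: at the first step where the count of non-zero visits
    exceeds [n], the preceding state is that visit. Its sojourn lies between two strictly ordered
    transition times. *)
Lemma ae_nz_sojourn_gt0 : {ae P, forall w n, 0 < nz_sojourn L n w}.
Proof.
apply: filterS ae_good_path => w gw n.
have ex : exists m, (n < visits (X ^~ w) m)%N.
  exists n.+1.*2; apply: (@visits_double _ n.+1) => i _.
  by have [_ st _ _] := gw; have [] := st i.
case: (ex_minnP ex) => -[|m]; first by rewrite /visits big_ord0.
rewrite visitsS => nm minm.
have mn : (visits (X ^~ w) m <= n)%N.
  by rewrite leqNgt; apply/negP => /minm; rewrite ltnn.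
have Xm : gk k (X m w) != 0%N.
  by apply: contraTN nm => /eqP ->; rewrite eqxx addn0 -leqNgt.
have <- : visits (X ^~ w) m = n.
  by apply/eqP; rewrite eqn_leq mn; move: nm; rewrite Xm addn1 ltnS.
by rewrite sojournE// subr_gt0 trans_time_lt.
Qed.

Lemma path_prob_neq0 M x : path_prob k la mu M x != 0 ->
  forall i, (i < M)%N -> erlang_state k (x i) /\
    (gk k (x i) = 0%N -> gk k (x i.+1) != 0%N).
Proof.
rewrite /path_prob mulf_eq0 negb_or => /andP[x0 /prodf_neq0 h].
have x00 : x 0%N = (0, 0)%N by move: x0; rewrite pnatr_eq0 eqb0 negbK => /eqP.
move=> i iM.
suff si : erlang_state k (x i).
  by have [] := jump_prob_neq0 k0 si (h (Ordinal iM) isT).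
elim: i iM => [|i IH] iM; first by rewrite x00.
have iM' := ltnW iM.
by have [] := jump_prob_neq0 k0 (IH iM') (h (Ordinal iM') isT).
Qed.

(** Restricted to any path event, the product has expectation equal to the probability of the event
    times one and the same constant; the path events partition the space. *)
Lemma sojourns_laplace N (sg : nat -> R) : (forall j, 0 <= sg j) ->
  \int[P]_w \prod_(j < N) expR (- (sg j * `|nz_sojourn L j w|)) =
  \prod_(j < N) (c / (c + psi (sg j))).
Proof.
move=> sg0.
(* By [visits_double], [2 N] transitions contain [N] non-zero visits. *)
pose M := N.*2.
(* [M] transitions join [M + 1] states. *)
pose V w := seq_code X M.+1 w.
pose Cst := \prod_(j < N) (c / (c + psi (sg j))).
have c0 : 0 < c by rewrite addr_gt0// mulr_gt0// ltr0n.
pose f w := \prod_(j < N) expR (- (sg j * `|nz_sojourn L j w|)).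
have mf : measurable_fun setT f.
  apply: measurable_prod => i _; apply: measurableT_comp => //.
  apply: measurableT_comp => //; apply: measurable_funM => //.
  by apply: measurableT_comp => //; exact: measurable_nz_sojourn_qlen.
have mV n : measurable (V @^-1` [set n]).
  by apply: (measurable_seq_code (0, 0)%N) => i y; exact: mX.
(* Visits to 0 and surplus visits get the parameter 0; as [psi 0 = 0], their factors are 1 on both
   sides. *)
pose s x i : R := if (gk k (x i) != 0%N) && (visits x i < N)%N then sg (visits x i) else 0.
have s0 x i : 0 <= s x i by rewrite /s; case: ifP.
pose g x w : R := \prod_(i < M) expR (- (s x i * (trans_time L i.+1 w - trans_time L i w))).
have mg x : measurable_fun setT (g x).
  apply: measurable_prod => i _; apply: measurableT_comp => //.
  apply: measurableT_comp => //; apply: measurable_funM => //.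
  by apply: measurable_funB => //; exact: measurable_trans_time_qlen.
have fE w x : good_path w -> path_event X M x w -> (N <= visits x M)%N -> f w = g x w.
  move=> gw xw Nv.
  have := @prod_visits x M N (fun j => expR (- (sg j * `|nz_sojourn L j w|))).
  rewrite (minn_idPl Nv) -/(f w) => <-; apply: eq_bigr => i _; rewrite /s.
  have vE : visits x i = visits (X ^~ w) i.
    apply: eq_bigr => j _; rewrite xw//.
    by rewrite (leq_trans (ltnW (ltn_ord j)))// ltnW.
  case: ifP => [/andP[xi _]|_]; last by rewrite mul0r oppr0 expR0.
  have iM := ltnW (ltn_ord i).
  by rewrite vE sojournE ?xw// gtr0_norm// subr_gt0 trans_time_lt.
have ratE x : (N <= visits x M)%N ->
    (forall i, (i < M)%N -> erlang_state k (x i)) ->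
    \prod_(i < M) (exit_rate k la mu (x i) / (exit_rate k la mu (x i) + psi (s x i))) = Cst.
  move=> Nv sx; rewrite /Cst.
  have := @prod_visits x M N (fun j => c / (c + psi (sg j))).
  rewrite (minn_idPl Nv) => <-; apply: eq_bigr => i _; rewrite /s.
  case: ifP => [/andP[xi _]|_].
    by rewrite /exit_rate -(gk_eq0 (sx i (ltn_ord i))) (negbTE xi).
  rewrite /psi laplace_exponent0 addr0 divff// gt_eqF//.
  exact: exit_rate_gt0.
have mA x : measurable (path_event X M x) by exact: (measurable_path_event JH).
have key x : \int[P]_w (\1_(path_event X M x) w * f w) =
             \int[P]_w (\1_(path_event X M x) w * Cst).
  rewrite RintegralZr//; last exact: integrable_indic.
  have -> : \int[P]_w \1_(path_event X M x) w = path_prob k la mu M x.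
    rewrite /Rintegral integral_indic// setIT.
    exact: (congr1 fine (probability_path_event JH M x)).
  (* An impossible path may break the state constraints behind [fE] and [ratE]; its indicator is
     almost surely 0, so both sides vanish. *)
  have [px|px] := eqVneq (path_prob k la mu M x) 0.
    rewrite px mul0r.
    rewrite (@ae_eq_Rintegral _ _ _ P _ (fun=> 0)).
    - by rewrite Rintegral_cst// mul0r.
    - by apply: measurable_funM => //; exact: measurable_indic.
    - exact: measurable_cst.
    have PE : P (path_event X M x) = 0%E by rewrite (probability_path_event JH) px.
    apply: filterS (ae_not (mA x) PE) => w nA.
    by rewrite indicE memNset// mul0r.
  have hx := path_prob_neq0 px.
  have Nv : (N <= visits x M)%N by apply: visits_double => i iM; have [] := hx i iM.
  rewrite -(ratE x Nv (fun i iM => (hx i iM).1)) -transition_laplace//.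
  apply: ae_eq_Rintegral.
  - by apply: measurable_funM => //; exact: measurable_indic.
  - by apply: measurable_funM; [exact: measurable_indic|exact: mg].
  apply: filterS ae_good_path => w gw; rewrite indicE.
  case: (boolP (w \in _)) => [/set_mem xw|_]; last by rewrite !mul0r.
  by rewrite (fE w x).
have f01 w : 0 <= f w <= 1.
  apply/andP; split; first by apply: prodr_ge0 => j _; exact: expR_ge0.
  by apply: prodr_ile1 => j _; rewrite expR_ge0 expR_le1 oppr_le0 mulr_ge0.
transitivity (\int[P]_w Cst); last first.
  by rewrite Rintegral_cst// [fine _](congr1 fine (probability_setT P)) mulr1.
apply: (eq_Rintegral_partition mV).
- exact: integrable_unit.
- exact: finite_measure_integrable_cst.
move=> n; pose x := code_nth (0, 0)%N n.
have VE : V @^-1` [set n] = if pickle [seq x i | i <- iota 0 M.+1] == n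
    then path_event X M x else set0.
  exact: (seq_codeE (0, 0)%N X M.+1 n).
rewrite VE; case: ifP => _.
  under eq_Rintegral do rewrite mulrC.
  by under [RHS]eq_Rintegral do rewrite mulrC.
under eq_Rintegral do rewrite indic0 mulr0.
by under [RHS]eq_Rintegral do rewrite indic0 mulr0.
Qed.

End TransitionLaplace.

(** * The Gamma function and Laplace transforms *)

Section GammaIntegral.
Context {R : realType}.
Implicit Types x s t u : R.
Let mu := @lebesgue_measure R.


Lemma powRD_ge0 t a b : 0 <= t -> 0 <= a -> 0 <= b ->
  powR t (a + b) = powR t a * powR t b.
Proof.
move=> t0 a0 b0; have [ab|ab] := eqVneq (a + b) 0; last first.
  by apply: powRD; rewrite (negbTE ab).
have -> : a = 0 by lra.
have -> : b = 0 by lra.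
by rewrite addr0 !powRr0 mulr1.
Qed.

Let powR_continuous x t : 0 < t -> {for t, continuous (fun u => powR u x)}.
Proof.
move=> t0; have dt : derivable (fun u => powR u x) t 1.
  by apply: derivable_powR; rewrite in_itv/= andbT.
exact: (@differentiable_continuous _ _ _ t _ ((derivable1_diffP _ _).1 dt)).
Qed.

Lemma powR_right_continuous x t : 0 <= x -> 0 <= t ->
  (fun u => powR u x) @ at_right t --> powR t x.
Proof.
move=> x0; rewrite le_eqVlt => /predU1P[<-|t0].
  move: x0; rewrite le_eqVlt => /predU1P[<-|x0].
    under eq_fun do rewrite powRr0.
    by rewrite powRr0; exact: cvg_cst.
  by rewrite powR0 ?gt_eqF//; exact: powR_cvg0.
apply: cvg_at_right_filter; exact: powR_continuous.
Qed.

Lemma continuous_expRM s : continuous (fun u => expR (- (s * u))).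
Proof.
move=> z; apply: continuous_comp; last exact: continuous_expR.
apply: (@continuousN _ R^o); apply: continuousM; first exact: cst_continuous.
exact: cvg_id.
Qed.

Let integrand x s u := powR u x * expR (- (s * u)).

Let integrand_within_continuous x s : 0 <= x ->
  {within `[0, +oo[, continuous (integrand x s)}.
Proof.
move=> x0; apply/continuous_within_itvcyP; split.
  move=> t; rewrite in_itv/= andbT => t0.
  apply: (@continuousM _ R (fun u => powR u x) (fun u => expR (- (s * u)))).
    exact: powR_continuous.
  exact: continuous_expRM.
apply: cvgM; first exact: powR_right_continuous.
by apply: cvg_at_right_filter; exact: continuous_expRM.
Qed.

Lemma measurable_expRM s : measurable_fun setT (fun u => expR (- (s * u))).
Proof. by apply: measurableT_comp => //; apply: measurableT_comp. Qed.

Let measurable_integrand x s : measurable_fun setT (integrand x s).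
Proof.
apply: (@measurable_funM _ _ _ _ (fun u => powR u x) (fun u => expR (- (s * u)))).
  exact: measurable_powR.
exact: measurable_expRM.
Qed.

Lemma exp_tail_integral s a : 0 < s ->
  (\int[mu]_(u in `[a, +oo[) (expR (- (s * u)))%:E = (expR (- (s * a)) / s)%:E)%E.
Proof.
move=> s0; pose F u := - (expR (- (s * u)) / s).
have dF u : is_derive u 1 F (expR (- (s * u))).
  by apply: is_derive_eq; rewrite /GRing.scale/=; field; rewrite gt_eqF.
have cF : continuous F.
  move=> u; have d1 : derivable F u 1 by exact: ex_derive.
  exact: (@differentiable_continuous _ _ _ u _ ((derivable1_diffP _ _).1 d1)).
rewrite (@ge0_continuous_FTC2y _ _ F _ 0)//.
- by rewrite -EFinB/= sub0r opprK.
- by apply: continuous_subspaceT; exact: continuous_expRM.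
- rewrite -oppr0 -(mul0r s^-1); apply: cvgN; apply: cvgM; last exact: cvg_cst.
  apply: (@cvg_comp _ _ _ (fun z => s * z) (fun z => expR (- z)) _ (pinfty_nbhs R)).
    exact: gt0_cvgMry.
  exact: cvgr_expR.
- by apply: cvg_at_right_filter; exact: cF.
- by move=> u _; rewrite derive1E derive_val.
Qed.

Lemma integrable_exp s a : 0 < s ->
  mu.-integrable `[a, +oo[ (EFin \o (fun u => expR (- (s * u)))).
Proof.
move=> s0; apply/integrableP; split.
  apply: measurable_funTS; apply/measurable_EFinP.
  exact: measurable_expRM.
under eq_integral do rewrite /= ger0_norm ?expR_ge0//.
by rewrite exp_tail_integral// ltry.
Qed.

(** For [t >= 1], [t^x <= t^n] with [n] the integer above [x], and the exponential series has
    [(a t)^n / n!] among its terms; for [t <= 1] the bound 1 suffices. *)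
Lemma powR_le_expR x a : 0 <= x -> 0 < a ->
  exists2 K, 0 <= K & forall t, 0 <= t -> powR t x <= K * expR (a * t).
Proof.
move=> x0 a0; pose n := (Num.truncn x).+1.
have an0 : 0 < a ^+ n by rewrite exprn_gt0.
exists (1 + n`!%:R / a ^+ n); first by rewrite addr_ge0// divr_ge0 ?ltW.
move=> t t0; have e1 : 1 <= expR (a * t).
  by rewrite -[leLHS](@expR0 R) ler_expR mulr_ge0// ltW.
have p0 : 0 <= n`!%:R / a ^+ n :> R by rewrite divr_ge0// ltW.
have [t1|t1] := leP t 1.
  apply: le_trans (_ : 1 <= _); last by nra.
  rewrite [leRHS](_ : 1 = powR 1 x); last by rewrite powR1.
  by rewrite ge0_ler_powR ?nnegrE.
apply: le_trans (_ : t ^+ n <= _).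
  by rewrite -powR_mulrn// ler_powR ?ltW// truncnS_gt.
apply: le_trans (_ : n`!%:R / a ^+ n * expR (a * t) <= _); last by rewrite ler_wpM2r ?expR_ge0// lerDr.
rewrite mulrAC ler_pdivlMr// -exprMn [t * a]mulrC.
have h := @expR_ge1Dxn R (a * t) (Num.truncn x) (mulr_ge0 (ltW a0) t0).
rewrite [leRHS]mulrC -ler_pdivrMr ?ltr0n ?fact_gt0//.
by apply: le_trans h; rewrite lerDr.
Qed.

Lemma integrable_powR_expR x s : 0 <= x -> 0 < s ->
  mu.-integrable `[0, +oo[ (EFin \o integrand x s).
Proof.
move=> x0 s0; have s2 : 0 < s / 2 by rewrite divr_gt0.
have [K K0 hK] := powR_le_expR x0 s2.
have iK : mu.-integrable `[0, +oo[ (EFin \o (fun u => K * expR (- (s / 2 * u)))).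
  have := @integrableZl _ _ _ mu `[0, +oo[%classic (measurable_itv _) K _ (integrable_exp 0 s2).
  by apply: eq_integrable.
apply: le_integrable iK => //.
  by apply: measurable_funTS; apply/measurable_EFinP; exact: measurable_integrand.
move=> u /=; rewrite in_itv/= andbT => u0; rewrite lee_fin.
rewrite !ger0_norm ?mulr_ge0 ?powR_ge0 ?expR_ge0//.
have -> : K * expR (- (s / 2 * u)) = K * expR (s / 2 * u) * expR (- (s * u)).
  by rewrite -(mulrA K) -expRD; congr (_ * expR _); field.
by rewrite ler_wpM2r ?expR_ge0// hK.
Qed.

(** Substitution [u = s t]; exponents [x >= 0] keep the integrand continuous up to 0. *)
Lemma gamma_scaling x s : 0 <= x -> 0 < s ->
  (\int[mu]_(u in `[0%R, +oo[) (integrand x 1 u)%:E =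
   (powR s (x + 1))%:E * \int[mu]_(t in `[0%R, +oo[) (integrand x s t)%:E)%E.
Proof.
move=> x0 s0.
pose F t := s * t.
have F0 : F 0 = 0 by rewrite /F mulr0.
have dF t : derivable F t 1 by exact: ex_derive.
have F' : F^`()%classic = (fun=> s).
  by apply/funext => t; rewrite derive1E /F derive_val /GRing.scale/= mulr1.
rewrite -[X in `[X, +oo[%classic]F0 increasing_ge0_integration_by_substitutiony; first last.
- by move=> u _; rewrite mulr_ge0 ?powR_ge0 ?expR_ge0.
- by rewrite F0; exact: integrand_within_continuous.
- exact: gt0_cvgMry.
- split; first by move=> t _; exact: dF.
  apply: cvg_at_right_filter.
  exact: (@differentiable_continuous _ _ _ 0 _ ((derivable1_diffP _ _).1 (dF 0))).
- by rewrite F'; exact: is_cvg_cst.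
- by rewrite F'; exact: is_cvg_cst.
- by rewrite F' => t _; exact: cst_continuous.
- by move=> u v _ _ uv; rewrite /F ltr_pM2l.
rewrite -ge0_integralZl//.
- rewrite F0; apply: eq_integral => t; rewrite inE/= in_itv/= andbT => t0.
  rewrite F' -EFinM; congr EFin.
  rewrite [LHS](_ : _ = powR (s * t) x * expR (- (1 * (s * t))) * s)// /integrand.
  rewrite mul1r powRM ?(ltW s0)// powRD_ge0 ?(ltW s0)// powRr1 ?ltW//.
  by ring.
- apply: measurable_funTS; apply/measurable_EFinP; exact: measurable_integrand.
- by move=> u _; rewrite lee_fin mulr_ge0 ?powR_ge0 ?expR_ge0.
- by rewrite lee_fin powR_ge0.
Qed.

Lemma GammaE x : 0 <= x ->
  Gamma (x + 1) = \int[mu]_(u in `[0, +oo[) integrand x 1 u.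
Proof.
move=> x0; rewrite /Gamma -[RHS]Rintegral_itv_obnd_cbnd; last first.
  apply: integrableS (integrable_powR_expR x0 ltr01) => //.
  by apply: subset_itvr; rewrite bnd_simp.
by apply: eq_Rintegral => u _; rewrite addrK /integrand mul1r.
Qed.

Lemma laplace_powR x s : 0 <= x -> 0 < s ->
  \int[mu]_(t in `[0, +oo[) integrand x s t = Gamma (x + 1) / powR s (x + 1).
Proof.
move=> x0 s0; have sx0 : 0 < powR s (x + 1) by exact: powR_gt0.
rewrite GammaE// /Rintegral (gamma_scaling x0 s0) fineM//; last first.
  by apply: integrable_fin_num => //; exact: integrable_powR_expR.
by rewrite mulrC mulKf// gt_eqF.
Qed.

(** Keep only the part of the integral over [u >= y], where [u^x >= y^x]. *)
Lemma Gamma_lower_bound x y : 0 <= x -> 0 <= y -> powR y x * expR (- y) <= Gamma (x + 1).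
Proof.
move=> x0 y0; rewrite GammaE//.
have sub : (`[y, +oo[%classic : set R) `<=` `[0, +oo[%classic.
  by apply: subset_itvr; rewrite bnd_simp.
have ig : mu.-integrable `[0, +oo[ (EFin \o integrand x 1) by exact: integrable_powR_expR.
rewrite -lee_fin /Rintegral fineK; last exact: integrable_fin_num.
apply: (@le_trans _ _ (\int[mu]_(u in `[y, +oo[) (integrand x 1 u)%:E)%E); last first.
  apply: ge0_subset_integral => //.
    by apply: measurable_funTS; apply/measurable_EFinP; exact: measurable_integrand.
  by move=> u _; rewrite lee_fin mulr_ge0 ?powR_ge0 ?expR_ge0.
have -> : (powR y x * expR (- y))%:E = (\int[mu]_(u in `[y, +oo[) (powR y x * expR (- (1 * u)))%:E)%E.
  under eq_integral do rewrite EFinM.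
  rewrite ge0_integralZl//.
  - by rewrite exp_tail_integral// divr1 mul1r EFinM.
  - apply: measurable_funTS; apply/measurable_EFinP.
    exact: measurable_expRM.
  - by rewrite lee_fin powR_ge0.
apply: ge0_le_integral => //.
- by move=> u _; rewrite lee_fin mulr_ge0 ?powR_ge0 ?expR_ge0.
- apply: measurable_funTS; apply/measurable_EFinP; apply: measurable_funM => //.
  exact: measurable_expRM.
- by apply: measurable_funTS; apply/measurable_EFinP; exact: measurable_integrand.
move=> u /=; rewrite in_itv/= andbT => yu; rewrite lee_fin ler_wpM2r ?expR_ge0//.
by apply: ge0_ler_powR; rewrite ?nnegrE// (le_trans y0).
Qed.

Lemma Gamma_gt0 x : 0 <= x -> 0 < Gamma (x + 1).
Proof.
move=> x0; apply: lt_le_trans (Gamma_lower_bound x0 ler01).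
by rewrite mulr_gt0 ?expR_gt0 ?powR_gt0.
Qed.

(** This is [Gamma_lower_bound] at [y = z t]. The free parameter [z] is what later makes the triple
    series geometric. *)
Lemma powR_Gamma_bound x z t : 0 <= x -> 0 < z -> 0 <= t ->
  powR t x / Gamma (x + 1) <= (powR z x)^-1 * expR (z * t).
Proof.
move=> x0 z0 t0; have zx := powR_gt0 x z0.
rewrite ler_pdivrMr ?Gamma_gt0// mulrAC -mulrA ler_pdivlMl// -powRM ?(ltW z0)//.
have := Gamma_lower_bound x0 (mulr_ge0 (ltW z0) t0).
by rewrite expRN ler_pdivrMr ?expR_gt0.
Qed.

End GammaIntegral.

(** * Term-by-term Laplace transforms *)

Section LaplaceSeries.
Context {R : realType}.
Implicit Types (z s t C A : R) (f g phi : R -> R).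
Let mu := @lebesgue_measure R.

(** Everything that must survive summation of a series: the exponential bound dominates the
    integrals for [s > z], and right continuity turns equal transforms into equality at every
    point. *)
Definition laplace_dominated z f C phi : Prop :=
  [/\ measurable_fun (`[0, +oo[%classic : set R) f,
      forall t, 0 <= t -> `|f t| <= C * expR (z * t),
      forall t, 0 <= t -> f @ at_right t --> f t &
      forall s, z < s -> \int[mu]_(t in `[0, +oo[) (f t * expR (- (s * t))) = phi s].

Let expR_bounded_integrable z f C s :
  measurable_fun (`[0, +oo[%classic : set R) f ->
  (forall t, 0 <= t -> `|f t| <= C * expR (z * t)) -> z < s ->
  mu.-integrable `[0, +oo[ (EFin \o (fun t => f t * expR (- (s * t)))).
Proof.
move=> mf fC zs; have sz : 0 < s - z by rewrite subr_gt0.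
have iC : mu.-integrable `[0, +oo[ (EFin \o (fun t => C * expR (- ((s - z) * t)))).
  have := @integrableZl _ _ _ mu `[0, +oo[%classic (measurable_itv _) C _ (integrable_exp 0 sz).
  by apply: eq_integrable.
apply: le_integrable iC => //.
  apply/measurable_EFinP; apply: measurable_funM => //.
  by apply: measurable_funTS; exact: measurable_expRM.
move=> t /=; rewrite in_itv/= andbT => t0; rewrite lee_fin normrM (ger0_norm (expR_ge0 _)).
apply: le_trans (ler_norm _).
have -> : - ((s - z) * t) = z * t + - (s * t) by ring.
by rewrite expRD mulrA ler_wpM2r ?expR_ge0// fC.
Qed.

Lemma laplace_dominated_integrable z f C phi s : laplace_dominated z f C phi -> z < s ->
  mu.-integrable `[0, +oo[ (EFin \o (fun t => f t * expR (- (s * t)))).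
Proof. by move=> [mf fC _ _]; exact: expR_bounded_integrable fC. Qed.

Lemma eq_laplace_dominated z f g C phi psi :
  (forall t, 0 <= t -> f t = g t) -> (forall s, z < s -> phi s = psi s) ->
  laplace_dominated z f C phi -> laplace_dominated z g C psi.
Proof.
move=> fg pq [mf fC rf If]; split.
- apply: eq_measurable_fun mf => t; rewrite inE/= in_itv/= andbT; exact: fg.
- by move=> t t0; rewrite -fg// fC.
- move=> t t0; rewrite -fg//; apply: cvg_trans (rf t t0).
  apply: near_eq_cvg; near=> u.
  have tu : t <= u by near: u; exact: nbhs_right_ge.
  by rewrite fg// (le_trans t0).
- move=> s zs; rewrite -pq// -If//; apply: eq_Rintegral => t.
  by rewrite inE/= in_itv/= andbT => t0; rewrite fg.
Unshelve. all: by end_near. Qed.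

Lemma laplace_dominatedZ z f C phi k : laplace_dominated z f C phi ->
  laplace_dominated z (fun t => k * f t) (`|k| * C) (fun s => k * phi s).
Proof.
move=> lf; have [mf fC rf If] := lf; split.
- exact: measurable_funM.
- by move=> t t0; rewrite normrM -mulrA ler_wpM2l// fC.
- by move=> t t0; apply: cvgM; [exact: cvg_cst|exact: rf].
- move=> s zs; rewrite -If// -RintegralZl//; last exact: laplace_dominated_integrable lf zs.
  by apply: eq_Rintegral => t _; rewrite mulrA.
Qed.

Lemma laplace_dominated_le z f C C' phi : C <= C' ->
  laplace_dominated z f C phi -> laplace_dominated z f C' phi.
Proof.
move=> CC' [mf fC rf If]; split => // t t0.
by rewrite (le_trans (fC t t0))// ler_wpM2r// expR_ge0.
Qed.

Lemma laplace_dominatedD z f g C C' phi psi :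
  laplace_dominated z f C phi -> laplace_dominated z g C' psi ->
  laplace_dominated z (fun t => f t + g t) (C + C') (fun s => phi s + psi s).
Proof.
move=> lf lg; have [mf fC rf If] := lf; have [mg gC rg Ig] := lg; split.
- exact: measurable_funD.
- by move=> t t0; rewrite mulrDl (le_trans (ler_normD _ _))// lerD ?fC ?gC.
- by move=> t t0; apply: cvgD; [exact: rf|exact: rg].
- move=> s zs; rewrite -If// -Ig// -RintegralD//;
    [|exact: laplace_dominated_integrable lf zs|exact: laplace_dominated_integrable lg zs].
  by apply: eq_Rintegral => t _; rewrite mulrDl.
Qed.

Lemma laplace_dominated_series z (f : nat -> R -> R) (C : nat -> R) (phi : nat -> R -> R) N :
  (forall n, laplace_dominated z (f n) (C n) (phi n)) ->
  laplace_dominated z (fun t => series (f ^~ t) N) (series C N)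
    (fun s => series (phi ^~ s) N).
Proof.
move=> lf; elim: N => [|N IH].
  rewrite /series/= big_geq//; under eq_fun do rewrite big_geq//.
  under [X in laplace_dominated _ _ _ X]eq_fun do rewrite big_geq//.
  split => //; first by move=> t t0; rewrite normr0 mul0r.
    by move=> t t0; exact: cvg_cst.
  move=> s zs; under eq_Rintegral do rewrite mul0r.
  by rewrite Rintegral_cst// mul0r.
have := laplace_dominatedD IH (lf N); rewrite -seriesSr.
by apply: eq_laplace_dominated => t _; rewrite seriesSr.
Qed.

Section GeometricallyDominatedSeries.
Variables (z A : R) (f : nat -> R -> R) (phi : nat -> R -> R) (Phi : R -> R).
Hypothesis A0 : 0 <= A.
Hypothesis lf : forall n, laplace_dominated z (f n) (A * 2^-1 ^+ n) (phi n).
Hypothesis cphi : forall s, z < s -> series (phi ^~ s) @ \oo --> Phi s.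

Let F t := limn (series (f ^~ t)).

Let half1 : `|2^-1 : R| < 1. Proof. by rewrite ger0_norm; lra. Qed.

Lemma geometrically_dominated_cvg t : 0 <= t -> cvgn (series (f ^~ t)).
Proof.
move=> t0; apply: normed_cvg.
apply: (@series_le_cvg _ _ (geometric (A * expR (z * t)) 2^-1)).
- by move=> n /=.
- by move=> n; apply: geometric_ge0; rewrite ?mulr_ge0 ?expR_ge0.
- move=> n /=; have [_ fC _ _] := lf n.
  by apply: le_trans (fC t t0) _; rewrite mulrAC.
- exact: is_cvg_geometric_series.
Qed.

Let tail_bound t N : 0 <= t ->
  `|F t - series (f ^~ t) N| <= 2 * A * 2^-1 ^+ N * expR (z * t).
Proof.
move=> t0.
(* The bound is the exact sum of [A 2^-n] over [N <= n < M], which makes the induction close. *)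
have key M : (N <= M)%N ->
    `|series (f ^~ t) M - series (f ^~ t) N| <=
    (2 * A * 2^-1 ^+ N - 2 * A * 2^-1 ^+ M) * expR (z * t).
  elim: M => [|M IH]; first by rewrite leqn0 => /eqP ->; rewrite !subrr normr0 mul0r.
  rewrite leq_eqVlt => /predU1P[<-|]; first by rewrite !subrr normr0 mul0r.
  rewrite ltnS => /IH h; rewrite seriesSr addrAC.
  apply: le_trans (ler_normD _ _) _.
  have [_ fC _ _] := lf M.
  apply: le_trans (lerD h (fC t t0)) _; rewrite -mulrDl ler_wpM2r ?expR_ge0//.
  by rewrite exprS; lra.
have cv : (fun M => `|series (f ^~ t) M - series (f ^~ t) N|) @ \oo -->
    `|F t - series (f ^~ t) N|.
  apply: cvg_norm; apply: cvgB; last exact: cvg_cst.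
  exact: geometrically_dominated_cvg.
apply: (cvgr_to_le cv); near=> M.
have NM : (N <= M)%N by near: M; exact: nbhs_infty_ge.
apply: le_trans (key M NM) _; rewrite ler_wpM2r ?expR_ge0// gerBl.
by rewrite !mulr_ge0// exprn_ge0.
Unshelve. all: by end_near. Qed.

(** The tail after [N] terms is at most [2 A 2^-N e^{z t}], uniformly small on [[t, t + 1]]: right
    continuity follows by splitting the error in three, the transform by dominated convergence. *)
Lemma laplace_dominated_limn :
  laplace_dominated z (fun t => limn (series (f ^~ t))) (2 * A) Phi.
Proof.
have lN N := laplace_dominated_series N lf.
have cvF t : 0 <= t -> series (f ^~ t) @ \oo --> F t.
  exact: geometrically_dominated_cvg.
have FA t : 0 <= t -> `|F t| <= 2 * A * expR (z * t).
  move=> t0; have := tail_bound 0 t0.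
  by rewrite /series/= big_geq// subr0 expr0 mulr1.
have mF : measurable_fun (`[0, +oo[%classic : set R) F.
  apply: (@measurable_fun_cvg _ _ _ _ (fun N t => series (f ^~ t) N)).
    by move=> N; have [] := lN N.
  by move=> t /=; rewrite in_itv/= andbT; exact: cvF.
split => //.
- move=> t t0; apply/cvgrPdist_le => e e0.
  have e3 : 0 < e / 3 by rewrite divr_gt0.
  pose B := 2 * A * expR (`|z| * (t + 1)).
  have B0 : 0 <= B by rewrite !mulr_ge0// expR_ge0.
  have [N HN] : exists N, B * 2^-1 ^+ N <= e / 3.
    have := @cvg_geometric R B 2^-1 half1.
    move=> /cvgrPdist_le /(_ _ e3) [N _ HN]; exists N.
    have := HN N (leqnn N); rewrite /= sub0r normrN; apply: le_trans.
    exact: ler_norm.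
  have tailB u : 0 <= u -> u <= t + 1 -> `|F u - series (f ^~ u) N| <= e / 3.
    move=> u0 ut; apply: le_trans (tail_bound N u0) _; apply: le_trans HN.
    rewrite /B -!mulrA ler_wpM2l// ler_wpM2l// mulrC ler_wpM2r ?exprn_ge0//.
    rewrite ler_expR; apply: le_trans (_ : `|z| * u <= _).
      by rewrite ler_wpM2r// ler_norm.
    by rewrite ler_wpM2l.
  have [_ _ rN _] := lN N.
  have /cvgrPdist_le /(_ _ e3) hN := rN t t0.
  near=> u.
  have u1 : u <= t + 1 by near: u; apply: nbhs_right_le; rewrite ltrDl.
  have tu : t <= u by near: u; exact: nbhs_right_ge.
  have h1 := tailB t t0 (ltac:(by rewrite lerDl)).
  have h2 := tailB u (le_trans t0 tu) u1.
  have h3 : `|series (f ^~ t) N - series (f ^~ u) N| <= e / 3 by near: u.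
  rewrite -/(F t) -/(F u).
  have -> : F t - F u = (F t - series (f ^~ t) N) +
     (series (f ^~ t) N - series (f ^~ u) N) - (F u - series (f ^~ u) N) by ring.
  apply: le_trans (ler_normB _ _) _.
  apply: le_trans (lerD (le_trans (ler_normD _ _) (lerD h1 h3)) h2) _.
  by lra.
- move=> s zs; have sz : 0 < s - z by rewrite subr_gt0.
  have cI : (fun N => \int[mu]_(t in `[0, +oo[) (series (f ^~ t) N * expR (- (s * t))))
      @ \oo --> \int[mu]_(t in `[0, +oo[) (F t * expR (- (s * t))).
    have iF : mu.-integrable `[0, +oo[ (EFin \o (fun t => F t * expR (- (s * t)))).
      exact: expR_bounded_integrable mF FA zs.
    apply: fine_cvg; rewrite fineK; last exact: integrable_fin_num.
    (* The constant [4 A] is [2 A] for the sum plus [2 A] for its tail. *)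
    apply: (@dominated_cvg _ _ _ mu `[0, +oo[%classic (measurable_itv _)
      (fun N t => (series (f ^~ t) N * expR (- (s * t)))%:E)
      (fun t => (F t * expR (- (s * t)))%:E)
      (fun t => (4 * A * expR (- ((s - z) * t)))%:E)) => //.
    + move=> N; apply/measurable_EFinP; apply: measurable_funM; first by have [] := lN N.
      by apply: measurable_funTS; exact: measurable_expRM.
    + move=> t /=; rewrite in_itv/= andbT => t0; apply: cvg_EFin; first exact: nearW.
      by apply: cvgM; [exact: cvF|exact: cvg_cst].
    + have := @integrableZl _ _ _ mu `[0, +oo[%classic (measurable_itv _) (4 * A) _ (integrable_exp 0 sz).
      by apply: eq_integrable.
    + move=> N t /=; rewrite in_itv/= andbT => t0; rewrite lee_fin normrM (ger0_norm (expR_ge0 _)).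
      have -> : - ((s - z) * t) = z * t + - (s * t) by ring.
      rewrite expRD mulrA ler_wpM2r ?expR_ge0//.
      have -> : series (f ^~ t) N = F t - (F t - series (f ^~ t) N) by ring.
      apply: le_trans (ler_normB _ _) _; apply: le_trans (lerD (FA t t0) (tail_bound N t0)) _.
      rewrite -mulrDl ler_wpM2r ?expR_ge0//.
      have : 2 * A * 2^-1 ^+ N <= 2 * A * 1.
        by rewrite ler_wpM2l ?mulr_ge0// exprn_ile1//; lra.
      by lra.
  have e : (fun N => \int[mu]_(t in `[0, +oo[) (series (f ^~ t) N * expR (- (s * t)))) =
           series (phi ^~ s).
    by apply/funext => N; have [_ _ _ ->] := lN N.
  by rewrite e in cI; exact: (cvg_unique _ cI (cphi zs)).
Unshelve. all: by end_near. Qed.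

End GeometricallyDominatedSeries.

End LaplaceSeries.

(** * The survival series *)

Section NegativeBinomialSeries.
Context {R : realType}.

(** The coefficient of [y^j] in [(1 - y)^(-r)]. *)
Definition neg_binomial (r j : nat) : R := poch r%:R j / j`!%:R.

Lemma neg_binomial0 r : neg_binomial r 0 = 1.
Proof. by rewrite /neg_binomial /poch big_ord0 fact0 divr1. Qed.

Lemma neg_binomial0S j : neg_binomial 0 j.+1 = 0.
Proof. by rewrite /neg_binomial /poch big_ord_recl/= addr0 !mul0r. Qed.

(** Pascal's rule, from which both the bound and the sum of the series follow by induction. *)
Lemma neg_binomialSS r j :
  neg_binomial r.+1 j.+1 = neg_binomial r.+1 j + neg_binomial r j.+1.
Proof.
rewrite /neg_binomial; have -> : poch r.+1%:R j.+1 = poch r.+1%:R j * (r.+1%:R + j%:R) :> R.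
  by rewrite /poch big_ord_recr.
have -> : poch r%:R j.+1 = r%:R * poch r.+1%:R j :> R.
  rewrite /poch big_ord_recl/= addr0; congr (_ * _); apply: eq_bigr => i _.
  by rewrite /bump/= add1n -!natrD addnS addSn.
rewrite factS natrM; field.
by rewrite !pnatr_eq0 -!lt0n fact_gt0 /=.
Qed.

Lemma neg_binomial_ge0 r j : 0 <= neg_binomial r j.
Proof. by apply: divr_ge0 => //; apply: prodr_ge0 => i _; rewrite addr_ge0. Qed.

Lemma neg_binomial_le r j : neg_binomial r j <= 2 ^+ (r + j).
Proof.
elim: r j => [|r IHr] j.
  case: j => [|j]; first by rewrite neg_binomial0 expr0.
  by rewrite neg_binomial0S exprn_ge0.
elim: j => [|j IHj]; first by rewrite neg_binomial0 exprn_ege1// ler1n.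
rewrite neg_binomialSS; apply: le_trans (lerD IHj (IHr j.+1)) _.
by rewrite addSnnS (exprS _ (r + j.+1)); lra.
Qed.

(** By Pascal's rule, [1 - y] times a partial sum for [r + 1] is the partial sum for [r] minus a
    boundary term, and that term is at most [2^(r+1) 2^-n] because [y <= 1/4]. *)
Lemma cvg_neg_binomial_series r (y : R) : 0 <= y <= 4^-1 ->
  series (fun j => neg_binomial r j * y ^+ j) @ \oo --> ((1 - y) ^+ r)^-1.
Proof.
move=> /andP[y0 y4].
have y1 : 1 - y != 0 by lra.
elim: r => [|r IH].
  rewrite expr0 invr1; apply: cvg_near_cst; exists 1%N => // -[//|n] _.
  rewrite /series/= big_nat_recl//= neg_binomial0 expr0 mulr1 big1 ?addr0// => i _.
  by rewrite neg_binomial0S mul0r.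
have rec n : series (fun j => neg_binomial r.+1 j * y ^+ j) n.+1 =
    (series (fun j => neg_binomial r j * y ^+ j) n.+1 - neg_binomial r.+1 n * y ^+ n.+1) / (1 - y).
  apply: (canRL (mulfK y1)); elim: n => [|n IHn].
    by rewrite /series/= !big_nat1 !neg_binomial0 expr0; ring.
  rewrite seriesSr mulrDl IHn [in RHS]seriesSr neg_binomialSS !exprS; ring.
rewrite -cvg_shiftS (_ : [sequence _]_n =
    (fun n => (series (fun j => neg_binomial r j * y ^+ j) n.+1 -
      neg_binomial r.+1 n * y ^+ n.+1) * (1 - y)^-1)); last by apply/funext => n; exact: rec.
have c1 : (fun n => series (fun j => neg_binomial r j * y ^+ j) n.+1) @ \oo -->
    ((1 - y) ^+ r)^-1 by rewrite cvg_shiftS.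
suff c2 : (fun n => neg_binomial r.+1 n * y ^+ n.+1) @ \oo --> (0 : R).
  have -> : ((1 - y) ^+ r.+1)^-1 = (((1 - y) ^+ r)^-1 - 0) * (1 - y)^-1.
    by rewrite subr0 exprSr invfM mulrC.
  by apply: cvgM; [exact: cvgB|exact: cvg_cst].
have c0 : geometric (2 ^+ r.+1 : R) 2^-1 @ \oo --> 0.
  by apply: cvg_geometric; rewrite ger0_norm; lra.
apply: squeeze_cvgr (cvg_cst _) c0; apply: nearW => n /=.
rewrite mulr_ge0 ?neg_binomial_ge0 ?exprn_ge0//=.
apply: le_trans (_ : 2 ^+ (r.+1 + n) * (4^-1) ^+ n <= _).
  apply: ler_pM; rewrite ?neg_binomial_ge0 ?exprn_ge0 ?neg_binomial_le//.
  apply: le_trans (_ : y ^+ n <= _); last by apply: lerXn2r; rewrite ?nnegrE.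
  by rewrite exprS ler_piMl ?exprn_ge0//; lra.
have -> : 2^-1 = 2 * 4^-1 :> R by lra.
by rewrite exprD -mulrA -exprMn.
Qed.

End NegativeBinomialSeries.

Section SurvivalSeries.
Context {R : realType} (th al c : R).
Hypotheses (th0 : 0 < th) (al0 : 0 < al) (c0 : 0 < c).
Implicit Types (s t z : R).

(** The inequalities bound [th / s] by 1/2 and both [(th / s)^al] and [c / s^al] by 1/4. The
    quarters leave room for the factor [2^(r+j)] of [neg_binomial_le]. *)
Lemma exists_abscissa : exists2 z, 0 < z & forall s, z <= s ->
  [/\ 0 < s, 2 * th <= s, 4 * powR th al <= powR s al & 4 * c <= powR s al].
Proof.
pose a := powR 4 al^-1; pose b := powR (4 * c) al^-1.
have a0 : 0 <= a by exact: powR_ge0.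
have b0 : 0 <= b by exact: powR_ge0.
have z0 : 0 < 2 * th + th * a + b.
  by rewrite ltr_wpDr// ltr_wpDr ?mulr_gt0// mulr_ge0// ltW.
exists (2 * th + th * a + b) => // s zs.
have tha : 0 <= th * a by rewrite mulr_ge0// ltW.
have s0 : 0 < s by apply: lt_le_trans zs.
have inv x : 0 <= x -> powR (powR x al^-1) al = x.
  by move=> x0; rewrite -powRrM mulVf ?gt_eqF// powRr1.
split => //; first by lra.
- rewrite -[X in X * _](inv 4)// -powRM ?(ltW th0)//.
  apply: ge0_ler_powR; rewrite ?nnegrE ?(ltW al0) ?mulr_ge0 ?(ltW th0) ?(ltW s0)// -/a.
  by apply: le_trans zs; rewrite mulrC -addrA addrCA lerDl addr_ge0// mulr_ge0// ltW.
- rewrite -[leLHS]inv ?mulr_ge0 ?(ltW c0)//.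
  by apply: ge0_ler_powR; rewrite ?nnegrE ?(ltW al0) ?(ltW s0)// -/b (le_trans _ zs)// lerDr addr_ge0// mulr_ge0// ltW.
Qed.

Let expo q r j : R := al * j%:R + r%:R * al + q%:R.

Let expo_ge0 q r j : 0 <= expo q r j.
Proof. by rewrite !addr_ge0// mulr_ge0// ltW. Qed.

Let powR_expo q r j s : 0 <= s ->
  powR s (expo q r j) = powR s al ^+ j * powR s al ^+ r * s ^+ q.
Proof.
move=> s0; rewrite /expo !powRD_ge0 ?addr_ge0 ?mulr_ge0 ?(ltW al0)//.
by rewrite powR_mulrn// !powRrM [powR (powR s r%:R) al]powRAC !powR_mulrn ?powR_ge0.
Qed.

(** The general term of the triple series, with all powers of [t] gathered over the Gamma factor so
    that [laplace_dominated_powR] applies. *)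
Let term q r j t : R := (th ^+ q * (- c) ^+ r * neg_binomial r j * powR th al ^+ j) *
  (powR t (expo q r j) / Gamma (expo q r j + 1)).

Lemma laplace_dominated_powR z x : 0 < z -> 0 <= x ->
  laplace_dominated z (fun t => powR t x / Gamma (x + 1)) (powR z x)^-1
    (fun s => (powR s (x + 1))^-1).
Proof.
move=> z0 x0; have G0 := Gamma_gt0 x0; split.
- apply: measurable_funTS; apply: measurable_funM => //; exact: measurable_powR.
- move=> t t0; rewrite ger0_norm; first exact: powR_Gamma_bound.
  by rewrite divr_ge0 ?powR_ge0 ?ltW.
- move=> t t0; apply: cvgM; last exact: cvg_cst.
  exact: powR_right_continuous.
- move=> s zs; have s0 := lt_trans z0 zs.
  transitivity ((Gamma (x + 1))^-1 *
      \int[lebesgue_measure]_(t in `[0, +oo[) (powR t x * expR (- (s * t)))).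
    rewrite -RintegralZl//; last exact: integrable_powR_expR.
    by apply: eq_Rintegral => t _; rewrite mulrAC mulrC mulrA.
  by rewrite laplace_powR// mulrA mulVf ?mul1r// gt_eqF.
Qed.

Section FixedAbscissa.
Variable z : R.
Hypothesis z0 : 0 < z.
Hypothesis bigz : forall s, z <= s ->
  [/\ 0 < s, 2 * th <= s, 4 * powR th al <= powR s al & 4 * c <= powR s al].

(** The ratio behind the sum over [j]; [x s] below, equal to [- c / (s^al - th^al)], is the ratio of
    the geometric sum over [r] that remains. *)
Let y s := powR th al / powR s al.
Let x s := - (c / (powR s al * (1 - y s))).

Let s_gt0 s : z < s -> 0 < s. Proof. by move=> /ltW/bigz[]. Qed.
Let ps_gt0 s : 0 < s -> 0 < powR s al. Proof. exact: powR_gt0. Qed.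

Let y_bound s : z < s -> 0 <= y s <= 4^-1.
Proof.
move=> zs; have [s0 _ h _] := bigz (ltW zs); have ps := ps_gt0 s0.
rewrite divr_ge0 ?powR_ge0//= ler_pdivrMr//; lra.
Qed.

Let x_bound s : z < s -> `|x s| < 1.
Proof.
move=> zs; have [s0 _ _ h] := bigz (ltW zs); have ps := ps_gt0 s0.
have /andP[y0 y4] := y_bound zs.
have p0 : 0 < powR s al * (1 - y s) by rewrite mulr_gt0//; lra.
rewrite normrN ger0_norm; last by rewrite divr_ge0// ltW.
by rewrite ltr_pdivrMr// mul1r; nra.
Qed.

Let term_dominated q r j : laplace_dominated z (term q r j)
  (2^-1 ^+ q * 2^-1 ^+ r * 2^-1 ^+ j)
  (fun s => (th / s) ^+ q / s * (- (c / powR s al)) ^+ r * (neg_binomial r j * y s ^+ j)).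
Proof.
have := laplace_dominatedZ (th ^+ q * (- c) ^+ r * neg_binomial r j * powR th al ^+ j)
  (laplace_dominated_powR z0 (expo_ge0 q r j)).
move=> H0; apply: laplace_dominated_le; last first.
  apply: eq_laplace_dominated H0 => //.
  move=> s zs; have s0 := s_gt0 zs; have ps := ps_gt0 s0.
  rewrite powRD_ge0 ?(ltW s0)// powRr1 ?(ltW s0)// powR_expo ?(ltW s0)//.
  rewrite !invfM -!exprVn /y -mulNr !exprMn; ring.
have [_ hq hy hc] := bigz (lexx z); have pz := ps_gt0 z0.
rewrite powR_expo ?(ltW z0)//.
have n0 := @neg_binomial_ge0 R r j; have nle := @neg_binomial_le R r j.
move: n0 nle; move: (neg_binomial r j) => nb n0 nle.
rewrite !normrM !normrX normrN (gtr0_norm th0) (gtr0_norm c0) (ger0_norm n0).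
rewrite (ger0_norm (powR_ge0 _ _)) !invfM -!exprVn.
have -> : th ^+ q * c ^+ r * nb * powR th al ^+ j *
    ((powR z al)^-1 ^+ j * (powR z al)^-1 ^+ r * z^-1 ^+ q) =
    (th / z) ^+ q * (c / powR z al) ^+ r * (nb * y z ^+ j).
  by rewrite /y !exprMn; ring.
have hz : 0 <= th / z <= 2^-1.
  by apply/andP; split; [rewrite divr_ge0// ltW|rewrite ler_pdivrMr//; lra].
have hcz : 0 <= c / powR z al <= 4^-1.
  by apply/andP; split; [rewrite divr_ge0// ltW|rewrite ler_pdivrMr//; lra].
have hyz : 0 <= y z <= 4^-1.
  by apply/andP; split; [rewrite divr_ge0// powR_ge0|rewrite ler_pdivrMr//; lra].
move: hz hcz hyz => /andP[hz1 hz2] /andP[hc1 hc2] /andP[hy1 hy2].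
have hzq := exprn_ge0 q hz1; have hcr := exprn_ge0 r hc1; have hyj := exprn_ge0 j hy1.
rewrite -!mulrA; apply: ler_pM => //.
- by rewrite mulr_ge0// mulr_ge0.
- by apply: lerXn2r; rewrite ?nnegrE// invr_ge0.
(* The powers of 2 from [neg_binomial_le] consume half of each ratio 1/4. *)
apply: le_trans (_ : 4^-1 ^+ r * (2 ^+ (r + j) * 4^-1 ^+ j) <= _).
  apply: ler_pM => //; first exact: mulr_ge0.
    by apply: lerXn2r; rewrite ?nnegrE// invr_ge0.
  by apply: ler_pM => //; apply: lerXn2r; rewrite ?nnegrE// invr_ge0.
have e2 : 2^-1 = 4^-1 * 2 :> R by lra.
rewrite exprD e2 !exprMn.
by rewrite le_eqVlt; apply/orP; left; apply/eqP; ring.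
Qed.

Let term_r q r t := limn (series (fun j => term q r j t)).
Let term_q q t := limn (series (fun r => term_r q r t)).

Let term_r_dominated q r : laplace_dominated z (term_r q r)
  (2 * 2^-1 ^+ q * 2^-1 ^+ r) (fun s => (th / s) ^+ q / s * x s ^+ r).
Proof.
rewrite -mulrA; apply: laplace_dominated_limn (term_dominated q r) _.
  by rewrite mulr_ge0// exprn_ge0// invr_ge0.
move=> s zs; have /andP[y0 y4] := y_bound zs; have ps := ps_gt0 (s_gt0 zs).
have -> : (th / s) ^+ q / s * x s ^+ r =
    (th / s) ^+ q / s * (- (c / powR s al)) ^+ r * ((1 - y s) ^+ r)^-1.
  rewrite -[RHS]mulrA -exprVn -exprMn; congr (_ * _ ^+ _).
  by rewrite /x mulNr; congr (- _); rewrite invfM mulrA.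
set K := _ * (- _) ^+ r.
rewrite (_ : series _ = (fun n => K * series (fun j => neg_binomial r j * y s ^+ j) n)).
  by apply: cvgM; [exact: cvg_cst|apply: cvg_neg_binomial_series; rewrite y0].
by apply/funext => n; rewrite /series/= mulr_sumr.
Qed.

Let term_q_dominated q : laplace_dominated z (term_q q)
  (4 * 2^-1 ^+ q) (fun s => (th / s) ^+ q / s / (1 - x s)).
Proof.
have -> : 4 * 2^-1 ^+ q = 2 * (2 * 2^-1 ^+ q) :> R by ring.
apply: laplace_dominated_limn (term_r_dominated q) _.
  by rewrite mulr_ge0// exprn_ge0// invr_ge0.
by move=> s zs; exact: cvg_geometric_series (x_bound zs).
Qed.

(** Each of the three summations doubles the constant, from 1 to 8; the sum over [q] is geometric
    with ratio [th / s]. *)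
Let total_dominated : laplace_dominated z (fun t => limn (series (fun q => term_q q t))) 8
  (fun s => (s - th)^-1 / (1 - x s)).
Proof.
have -> : 8 = 2 * 4 :> R by ring.
apply: (laplace_dominated_limn _ term_q_dominated) => // s zs.
have [s0 h _ _] := bigz (ltW zs).
have hs : `|th / s| < 1.
  by rewrite ger0_norm ?divr_ge0 ?(ltW th0) ?(ltW s0)// ltr_pdivrMr//; lra.
have -> : (s - th)^-1 / (1 - x s) = s^-1 / (1 - x s) / (1 - th / s).
  rewrite [RHS]mulrAC; congr (_ / _); rewrite -invfM; congr (_^-1).
  by field; rewrite gt_eqF.
rewrite (_ : series _ = series (geometric (s^-1 / (1 - x s)) (th / s))).
  exact: cvg_geometric_series.
by apply/funext => n; rewrite /series/=; apply: eq_bigr => q _; ring.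
Qed.

(** Convergence is assumed of the scaled series, the one that domination controls; for [u = 0] both
    sides are 0. *)
Let limn_seriesZ (u : R) (a : nat -> R) : cvgn (series (fun n => u * a n)) ->
  limn (series (fun n => u * a n)) = u * limn (series a).
Proof.
move=> cu; have e : series (fun n => u * a n) = (fun n => u * series a n).
  by apply/funext => n; rewrite /series/= mulr_sumr.
have [->|u0] := eqVneq u 0.
  rewrite mul0r; apply/cvg_lim => //; apply: cvg_near_cst; apply: nearW => n.
  by rewrite /series/= big1// => i _; rewrite mul0r.
have ca : cvgn (series a).
  rewrite (_ : series a = (fun n => u^-1 * series (fun n => u * a n) n)).
    by apply: is_cvgM => //; exact: is_cvg_cst.
  by apply/funext => n; rewrite e mulKf.
by rewrite e; apply/cvg_lim => //; apply: cvgM; [exact: cvg_cst|exact: ca].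
Qed.

Lemma survival_series_dominated :
  laplace_dominated z
    (fun t => limn (series (fun q : nat => (th * t) ^+ q *
       limn (series (fun r : nat => (- (c * powR t al)) ^+ r *
         ML3 al (r%:R * al + q%:R + 1) r%:R (powR th al * powR t al))))))
    8 (fun s => (s - th)^-1 / (1 - x s)).
Proof.
apply: eq_laplace_dominated total_dominated => // t t0.
congr (limn (series _)); apply/funext => q.
have h0 n : 0 <= 2^-1 ^+ n :> R by rewrite exprn_ge0// invr_ge0.
have cr := geometrically_dominated_cvg (mulr_ge0 (ler0n R 2) (h0 q)) (term_r_dominated q).
have cj r := geometrically_dominated_cvg (mulr_ge0 (h0 q) (h0 r)) (term_dominated q r).
pose u r := (th * t) ^+ q * (- (c * powR t al)) ^+ r.
have ej r : (fun j => u r * (poch r%:R j * (powR th al * powR t al) ^+ j /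
    (j`!%:R * Gamma (al * j%:R + (r%:R * al + q%:R + 1))))) = (fun j => term q r j t).
  apply/funext => j.
  by rewrite /u /term /neg_binomial powR_expo// /expo -!addrA invfM -mulNr !exprMn; ring.
have er : (fun r => (th * t) ^+ q * ((- (c * powR t al)) ^+ r *
    ML3 al (r%:R * al + q%:R + 1) r%:R (powR th al * powR t al))) = (fun r => term_r q r t).
  apply/funext => r; rewrite mulrA /ML3 -/(u r) -limn_seriesZ ej//.
  exact: cj.
rewrite /term_q -limn_seriesZ er//.
exact: cr.
Qed.

End FixedAbscissa.

End SurvivalSeries.

(** * Injectivity of the Laplace transform on right-continuous functions *)

Section LaplaceUniqueness.
Context {R : realType}.
Let mu := @lebesgue_measure R.

Let weighted (f : R -> R) s : R -> R :=
  (fun t => f t * expR (- (s * t))) \_ `[0, +oo[%classic.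

Let weighted_integrable z f C phi s : laplace_dominated z f C phi -> z < s ->
  mu.-integrable setT (EFin \o weighted f s).
Proof.
move=> lf zs; have := laplace_dominated_integrable lf zs.
rewrite integrable_mkcond// => h; apply: eq_integrable h => // t _.
by rewrite /weighted /= !patchE; case: ifP.
Qed.

(** Damped by [e^{-s1 t}] with [s1 > z] and extended by 0, both functions are integrable signed
    weights with equal transforms, so they have equal integrals on Borel sets. Where [f t < g t],
    right continuity gives an interval []t, t + de[] on which these integrals differ. *)
Lemma laplace_dominated_inj (z C C' : R) (f g phi : R -> R) :
  laplace_dominated z f C phi -> laplace_dominated z g C' phi ->
  forall t, 0 <= t -> f t = g t.
Proof.
move=> lf lg; pose s1 := z + 1; have zs1 : z < s1 by rewrite ltrDl.
have iF := weighted_integrable lf zs1; have iG := weighted_integrable lg zs1.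
have pairE (h : R -> R) (D : R) (psi : R -> R) (s : R) : laplace_dominated z h D psi -> 0 <= s ->
    \int[mu]_t (weighted h s1 t * expR (- (s * `|t|))) = psi (s1 + s).
  move=> lh s0; have zs : z < s1 + s by rewrite (lt_le_trans zs1)// lerDl.
  have [_ _ _ <- //] := lh; rewrite [RHS]Rintegral_mkcond.
  apply: eq_Rintegral => t _; rewrite /weighted !patchE.
  case: ifPn => [|_]; last by rewrite mul0r.
  rewrite inE/= in_itv/= andbT => t0; rewrite ger0_norm// -mulrA -expRD.
  by congr (_ * expR _); ring.
have K : forall B, measurable B ->
    \int[mu]_t (weighted f s1 t * \1_B `|t|) = \int[mu]_t (weighted g s1 t * \1_B `|t|).
  move=> B mB; have [mI I01] := unit_fun_indic mB.
  apply: (same_pairing_of_laplace iF iG) => //.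
  move=> s s0; exact: etrans (pairE _ _ _ _ lf s0) (esym (pairE _ _ _ _ lg s0)).
have lt_false : forall (f g : R -> R) (C C' : R), laplace_dominated z f C phi -> laplace_dominated z g C' phi ->
   (forall B, measurable B ->
    \int[mu]_t (weighted f s1 t * \1_B `|t|) = \int[mu]_t (weighted g s1 t * \1_B `|t|)) ->
   forall t, 0 <= t -> ~ f t < g t.
  move=> {K iF iG lf lg C C'}f {}g C C' lf lg K t t0 fg.
  have iF := weighted_integrable lf zs1; have iG := weighted_integrable lg zs1.
  pose e := (g t - f t) / 2.
  have e0 : 0 < e by rewrite divr_gt0// subr_gt0.
  have [_ _ rf _] := lf; have [_ _ rg _] := lg.
  have e2 : 0 < e / 2 by rewrite divr_gt0.
  have : \forall u \near at_right t, e <= g u - f u.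
    have /cvgrPdist_le/(_ _ e2) hf := rf t t0.
    have /cvgrPdist_le/(_ _ e2) hg := rg t t0.
    near=> u.
    have : `|f t - f u| <= e / 2 by near: u.
    have : `|g t - g u| <= e / 2 by near: u.
    rewrite !ler_norml => /andP[_ a] /andP[b _].
    have : g t - f t = 2 * e by rewrite /e; field.
    by lra.
  rewrite near_withinE => /nbhs_ballP[de /= de0 hde].
  pose B : set R := `]t, t + de[%classic.
  have mB : measurable B by exact: measurable_itv.
  (* A lower bound of the damping factor on [B], so that the weighted difference is at least [e m]
     there. *)
  pose m := expR (- (`|s1| * (t + de))).
  have m0 : 0 < m by exact: expR_gt0.
  have BE h u : weighted h s1 u * \1_B `|u| = weighted h s1 u * \1_B u.
    rewrite /weighted patchE; case: ifPn => [|_]; last by rewrite !mul0r.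
    by rewrite inE/= in_itv/= andbT => u0; rewrite ger0_norm.
  have := K B mB.
  under eq_Rintegral do rewrite BE; under [RHS]eq_Rintegral do rewrite BE.
  move=> KB.
  have mI : measurable_fun setT (\1_B : R -> R) by exact: measurable_indic.
  have I1 u : `|\1_B u : R| <= 1 by rewrite indicE ger0_norm//; case: (_ \in _).
  have iFB := integrable_mul_bounded iF mI I1.
  have iGB := integrable_mul_bounded iG mI I1.
  have iB1 : mu.-integrable setT (EFin \o (\1_B : R -> R)) by exact: integrable_indic_itv.
  have iB : mu.-integrable setT (EFin \o (fun u => e * m * \1_B u)).
    by have := integrableZl measurableT (e * m) iB1; apply: eq_integrable.
  have : \int[mu]_u (e * m * \1_B u) <=
         \int[mu]_u (weighted g s1 u * \1_B u - weighted f s1 u * \1_B u).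
    apply: le_Rintegral => //.
      have := integrableB measurableT iGB iFB; exact: eq_integrable.
    move=> u _; rewrite -mulrBl indicE; case: (boolP (u \in B)) => [|_]; last by rewrite !mulr0.
    rewrite inE /B/= in_itv/= => /andP[tu ude]; rewrite !mulr1.
    have u0 : 0 <= u by rewrite (le_trans t0)// ltW.
    rewrite /weighted !patchE mem_set/=; last by rewrite in_itv/= u0.
    rewrite -mulrBl; apply: ler_pM; rewrite ?(ltW e0) ?(ltW m0)//.
      apply: hde => //=; rewrite /ball/= ltr0_norm ?subr_lt0//; lra.
    rewrite /m ler_expR lerN2; apply: le_trans (_ : `|s1| * u <= _).
      by rewrite ler_wpM2r// ler_norm.
    by rewrite ler_wpM2l// ltW.
  rewrite RintegralB// KB subrr.
  rewrite RintegralZl//.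
  rewrite /Rintegral integral_indic// setIT.
  have muB : mu B = de%:E.
    by rewrite /mu /B lebesgue_measure_itv/= lte_fin ltrDl de0 -EFinB addrAC subrr add0r.
  rewrite [fine _](congr1 fine muB)/=; apply/negP; rewrite -ltNge.
  exact: mulr_gt0 (mulr_gt0 e0 m0) de0.
move=> t t0; apply/eqP; rewrite eq_le !leNgt; apply/andP; split; apply/negP.
  apply: (lt_false g f C' C lg lf) => // B mB; exact/esym/K.
exact: (lt_false f g C C' lf lg).
Unshelve. all: by end_near. Qed.

End LaplaceUniqueness.

(** * Laplace transform of a survival function *)

Section SurvivalLaplace.
Context {d} {T : measurableType d} {R : realType} (P : probability T R).
Variable S : T -> R.
Hypotheses (mS : measurable_fun setT S) (S0 : forall w, 0 <= S w).
Let mu := @lebesgue_measure R.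

Let F t : R := fine (P [set w | t < S w]).

Let mFset t : measurable [set w | t < S w].
Proof. exact: measurable_lt_set. Qed.

Let FE t : P [set w | t < S w] = (F t)%:E.
Proof. by rewrite /F fineK// fin_num_measure. Qed.

Let F01 t : 0 <= F t <= 1.
Proof.
rewrite -!lee_fin -FE measure_ge0/=; exact: probability_le1.
Qed.

Let X : {RV P >-> R} := mfun_Sub (mem_set mS).

Let ccdfE t : ccdf X t = (F t)%:E.
Proof.
rewrite -FE /ccdf /distribution /pushforward; congr (P _).
by apply/seteqP; split => w /=; rewrite in_itv/= andbT.
Qed.

Let F_right t : F @ at_right t --> F t.
Proof.
have := @ccdf_right_continuous _ _ _ P X t.
rewrite /= ccdfE (_ : ccdf X = (fun t => (F t)%:E)); last by apply/funext => u; exact: ccdfE.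
by move=> /fine_cvg.
Qed.

Let mF : measurable_fun setT F.
Proof.
have := @ccdf_measurable _ _ _ P X.
rewrite (_ : ccdf X = EFin \o F); last by apply/funext => u; exact: ccdfE.
by move/measurable_EFinP.
Qed.

(* Tonelli for [s e^{-st} 1_{t < S}]. *)
Let survival_fubini s : 0 < s ->
  \int[mu]_t (exponential_pdf s t * F t) = 1 - \int[P]_w expR (- (s * S w)).
Proof.
move=> s0.
have p0 t : 0 <= exponential_pdf s t by apply: exponential_pdf_ge0; exact: ltW.
have mp : measurable_fun setT (exponential_pdf s) by exact: measurable_exponential_pdf.
pose E : set (T * R) := [set p | p.2 < S p.1].
have mE : measurable E.
  apply: measurable_lt_set; first exact: measurable_snd.
  by apply: measurableT_comp => //; exact: measurable_fst.
pose g (p : T * R) : \bar R := (exponential_pdf s p.2 * \1_E p)%:E.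
have mg : measurable_fun setT g.
  apply/measurable_EFinP; apply: measurable_funM; last exact: measurable_indic.
  by apply: measurableT_comp => //; exact: measurable_snd.
have g0 p : (0 <= g p)%E by rewrite lee_fin mulr_ge0.
have indE w t : \1_E (w, t) = (t < S w)%R%:R :> R.
  by rewrite indicE; congr (nat_of_bool _)%:R; apply/idP/idP; rewrite inE.
have inner_t w : (\int[mu]_t g (w, t) = (1 - expR (- (s * S w)))%:E)%E.
  (* The exponential density has mass 1, and its part beyond [S w] has mass [e^{-s S w}]. *)
  have split_pdf : (\int[mu]_t g (w, t) +
      \int[mu]_t ((exponential_pdf s \_ `[S w, +oo[%classic) t)%:E = 1)%E.
    rewrite -(integral_exponential_pdf s0) -ge0_integralD//.
    - apply: eq_integral => t _; rewrite /g/= indE patchE mem_setE in_itv/= andbT.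
      by case: ltP => _; rewrite -EFinD ?mulr1 ?mulr0 ?addr0 ?add0r.
    - exact: measurableT_comp.
    - by move=> t _; rewrite lee_fin; apply: restrict_ge0 => u _; exact: p0.
    - apply/measurable_EFinP; apply/measurable_restrict => //.
      exact: measurable_funTS.
  have tailE : (\int[mu]_t ((exponential_pdf s \_ `[S w, +oo[%classic) t)%:E =
      (expR (- (s * S w)))%:E)%E.
    transitivity (\int[mu]_(t in `[S w, +oo[) (exponential_pdf s t)%:E)%E.
      rewrite [RHS]integral_mkcond; apply: eq_integral => t _.
      by rewrite !patchE; case: ifP.
    transitivity (\int[mu]_(t in `[S w, +oo[) (s%:E * (expR (- (s * t)))%:E))%E.
      apply: eq_integral => t; rewrite inE/= in_itv/= andbT => St.
      by rewrite exponential_pdfE ?(le_trans (S0 w))// mulNr EFinM.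
    rewrite ge0_integralZl//; last first.
    - by rewrite lee_fin ltW.
    - by apply: measurable_funTS; apply/measurable_EFinP; exact: measurable_expRM.
    by rewrite exp_tail_integral// -EFinM mulrC divfK// gt_eqF.
  by rewrite EFinB -split_pdf tailE addeK.
have inner_w t : (\int[P]_w g (w, t) = (exponential_pdf s t * F t)%:E)%E.
  transitivity (\int[P]_w ((exponential_pdf s t)%:E * (\1_[set w | t < S w] w)%:E))%E.
    apply: eq_integral => w _; rewrite /g indE -EFinM indicE; congr (_ * (nat_of_bool _)%:R)%:E.
    by apply/idP/idP; rewrite inE.
  rewrite ge0_integralZl ?lee_fin//; last first.
    by apply/measurable_EFinP; exact: measurable_indic.
  by rewrite integral_indic// setIT EFinM -FE.
have := @fubini_tonelli _ _ _ _ _ P mu g mg g0.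
under eq_integral do rewrite inner_t.
under [X in _ = X -> _]eq_integral do rewrite inner_w.
move=> h; rewrite {1}/Rintegral -h.
have me : measurable_fun setT (fun w => expR (- (s * S w))).
  by apply: measurableT_comp => //; apply: measurableT_comp => //; exact: measurable_funM.
have i1 : P.-integrable setT (EFin \o (fun=> 1 : R)).
  exact: finite_measure_integrable_cst.
have ie : P.-integrable setT (EFin \o (fun w => expR (- (s * S w)))).
  apply: integrable_unit => // w.
  by rewrite expR_ge0 expR_le1 oppr_le0 mulr_ge0// ltW.
transitivity (\int[P]_w (1 - expR (- (s * S w)))) => //.
by rewrite RintegralB// Rintegral_cst// [fine _](congr1 fine (probability_setT P)) mul1r.
Qed.

Lemma survival_laplace_dominated z : 0 <= z ->
  laplace_dominated z F 1 (fun s => (1 - \int[P]_w expR (- (s * S w))) / s).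
Proof.
move=> z0; split.
- exact: measurable_funTS.
- move=> t t0; have /andP[a b] := F01 t; rewrite ger0_norm// mul1r.
  by rewrite (le_trans b)// -[leLHS](@expR0 R) ler_expR mulr_ge0.
- by move=> t _; exact: F_right.
- move=> s zs; have s0 : 0 < s by exact: le_lt_trans zs.
  apply: (canRL (mulfK _)); first by rewrite gt_eqF.
  rewrite -survival_fubini// -RintegralZr//; last first.
    have iE := integrable_exp 0 s0.
    rewrite /= in iE *; apply: le_integrable iE => //.
      apply/measurable_EFinP; apply: measurable_funTS; apply: measurable_funM => //.
      exact: measurable_expRM.
    move=> t _ /=; rewrite lee_fin normrM ler_piMl//.
    by have /andP[a b] := F01 t; rewrite ger0_norm.
  rewrite Rintegral_mkcond; apply: eq_Rintegral => t _.
  rewrite patchE /exponential_pdf patchE; case: ifP => _; last by rewrite mul0r.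
  by rewrite mulNr; ring.
Qed.

End SurvivalLaplace.

(** * Independence and law of the sojourn times *)

Section ErlangSojourns.
Context {R : realType} {d : measure_display} {T : measurableType d}
  (P : probability T R).
Variables (k : nat) (la mu th al : R)
  (X : nat -> T -> nat * nat) (H : nat -> T -> R) (D : R -> T -> R).
Hypotheses (k0 : (0 < k)%N) (la0 : 0 < la) (mu0 : 0 < mu) (th0 : 0 < th)
  (al01 : 0 < al < 1).
Hypothesis JH : erlang_jump_hold P k la mu X H.
Hypothesis TS : tempered_subordinator P th al D.
Hypothesis QD : indep_processes P (ctmc_path X H) D.

Let S := nz_sojourn (qlen k (ctmc_path X H) D).
Let c : R := la + k%:R * mu.
Let psi := laplace_exponent th al.
(** Off an almost sure event an infimum over an empty set, equal to 0, can make a sojourn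
    negative. *)
Let aS n w := `|S n w|.

Let c0 : 0 < c. Proof. by rewrite addr_gt0// mulr_gt0// ltr0n. Qed.

Let mS n : measurable_fun setT (S n).
Proof. exact: (measurable_nz_sojourn_qlen JH TS). Qed.

Let maS n : measurable_fun setT (aS n).
Proof. exact: measurableT_comp. Qed.

Let aS0 n w : 0 <= aS n w. Proof. exact: normr_ge0. Qed.

(** The joint transform of the first [n + 1] sojourns with all parameters but the last equal to
    0. *)
Lemma sojourn_laplace n s : 0 <= s ->
  \int[P]_w expR (- (s * aS n w)) = c / (c + psi s).
Proof.
move=> s0; pose sg j := if j == n then s else 0.
have sg0 j : 0 <= sg j by rewrite /sg; case: ifP.
have sgn : sg n = s by rewrite /sg eqxx.
have sgj j : (j < n)%N -> sg j = 0 by move=> jn; rewrite /sg ltn_eqF.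
have := sojourns_laplace k0 la0 mu0 th0 al01 JH TS QD n.+1 sg0.
have prodE (h : nat -> R) : (forall j, (j < n)%N -> h j = 1) -> \prod_(j < n.+1) h j = h n.
  by move=> h1; rewrite big_ord_recr/= big1 ?mul1r// => j _; rewrite h1.
rewrite (prodE (fun j => c / (c + psi (sg j)))); last first.
  move=> j jn; rewrite sgj// /psi laplace_exponent0 addr0 divff//.
  by rewrite gt_eqF.
rewrite sgn => <-; apply: eq_Rintegral => w _.
rewrite (prodE (fun j => expR (- (sg j * aS j w)))); last first.
  by move=> j jn; rewrite sgj// mul0r oppr0 expR0.
by rewrite sgn.
Qed.

Let law n (f : R -> R) : R := \int[P]_w (1 * f (aS n w)).

Lemma sojourns_independent N (f : nat -> R -> R) :
  (forall i, (i < N)%N -> unit_fun (f i)) ->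
  \int[P]_w \prod_(i < N) f i (aS i w) = \prod_(i < N) \int[P]_w f i (aS i w).
Proof.
move=> uf.
have i1 : P.-integrable setT (EFin \o (fun=> 1 : R)).
  exact: finite_measure_integrable_cst.
have := @determines_prod _ _ _ P N (fun=> 1) aS law
  (fun=> [set f | exists2 s, 0 <= s & f = fun z => expR (- (s * `|z|))]) 1
  (measurable_cst _).
rewrite /law => H1; transitivity (\int[P]_w (1 * \prod_(i < N) f i (aS i w))).
  by apply: eq_Rintegral => w _; rewrite mul1r.
rewrite H1//.
- rewrite mul1r; apply: eq_bigr => i _; apply: eq_Rintegral => w _.
  by rewrite mul1r.
- by move=> w; rewrite ler01 lexx.
- by move=> i g _ [s s0 ->]; exact: unit_fun_exp.
- by move=> i _; exact: determines_laplace.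
move=> g Eg.
have /choice[sg sgP] : forall i, exists s : R, 0 <= s /\
    ((i < N)%N -> g i = fun z => expR (- (s * `|z|))).
  move=> i; have [iN|_] := ltnP i N; last by exists 0.
  by have [s s0 ->] := Eg i iN; exists s.
have sg0 i : 0 <= sg i by case: (sgP i).
have gE i : (i < N)%N -> g i = fun z => expR (- (sg i * `|z|)) by case: (sgP i).
transitivity (\int[P]_w \prod_(j < N) expR (- (sg j * aS j w))).
  apply: eq_Rintegral => w _; rewrite mul1r; apply: eq_bigr => i _.
  by rewrite gE// normr_id.
rewrite (sojourns_laplace k0 la0 mu0 th0 al01 JH TS QD N sg0) mul1r.
apply: eq_bigr => i _; rewrite -(sojourn_laplace i (sg0 i)).
by apply: eq_Rintegral => w _; rewrite mul1r gE// normr_id.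
Qed.

Lemma sojourn_survival_dominated :
  exists2 z, 0 <= z & laplace_dominated z (sojourn_survival k la mu th al) 8
    (fun s => (1 - c / (c + psi s)) / s).
Proof.
have /andP[al0 _] := al01.
have [z z0 hz] := exists_abscissa th0 al0 c0.
exists z; first exact: ltW.
have := survival_series_dominated th0 al0 c0 z0 hz.
set h := (fun t : R => _) => -[mh hC rh Ih].
have hE t : sojourn_survival k la mu th al t = expR (- (th * t)) * h t by [].
split.
- apply: measurable_funM => //; apply: measurable_funTS; exact: measurable_expRM.
- move=> t t0; rewrite hE normrM (ger0_norm (expR_ge0 _)).
  by apply: le_trans (hC t t0); rewrite ler_piMl// expR_le1 oppr_le0 mulr_ge0// ltW.
- move=> t t0; apply: cvgM; last exact: rh.
  by apply: cvg_at_right_filter; exact: continuous_expRM.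
- move=> s zs; have s0 : 0 < s by exact: lt_trans zs.
  have zst : z < s + th by rewrite (lt_trans zs)// ltrDl.
  have [sth0 _ h4 _] := hz _ (ltW zst).
  have p0 : 0 < powR (s + th) al by exact: powR_gt0.
  have pt0 : 0 < powR th al by exact: powR_gt0.
  (* The factor [e^{-th t}] moves the transform to [s + th], where the ratio of the sum over [r] is
     [- c / psi s]; the result is [psi s / (s (c + psi s))]. *)
  transitivity ((s + th - th)^-1 / (1 - - (c / (powR (s + th) al *
      (1 - powR th al / powR (s + th) al))))).
    rewrite -Ih//; apply: eq_Rintegral => t _.
    rewrite hE mulrAC mulrC -expRD; congr (_ * expR _).
    by rewrite mulrDl opprD addrC.
  rewrite addrK mulrBr mulr1 mulrCA divff ?mulr1 ?gt_eqF// opprK.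
  rewrite /psi /laplace_exponent.
  have ps : 0 < powR (s + th) al - powR th al by lra.
  by field; rewrite !gt_eqF// addr_gt0.
Qed.

End ErlangSojourns.

Theorem theorem4p5 (R : realType) (d : measure_display) (T : measurableType d)
  (P : probability T R) (k : nat) (la mu th al : R)
  (X : nat -> T -> nat * nat) (H : nat -> T -> R) (D : R -> T -> R) :
  (0 < k)%N -> 0 < la -> 0 < mu -> 0 < th -> 0 < al < 1 ->
  erlang_jump_hold P k la mu X H ->
  tempered_subordinator P th al D ->
  indep_processes P (ctmc_path X H) D ->
  let S := nz_sojourn (qlen k (ctmc_path X H) D) in
  [/\ (forall n, measurable_fun setT (S n)),
      (forall N : nat, mutual_indep P (fun i : 'I_N => S i)) &
      (forall n t, 0 <= t ->
         P [set w | t < S n w] = (sojourn_survival k la mu th al t)%:E)].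
Proof.
move=> k0 la0 mu0 th0 al01 JH TS QD S.
have mS n : measurable_fun setT (S n) by exact: (measurable_nz_sojourn_qlen JH TS).
have S_gt0 := ae_nz_sojourn_gt0 k0 th0 al01 JH TS.
have normS : {ae P, forall w n, `|S n w| = S n w}.
  by apply: filterS S_gt0 => w h n; rewrite gtr0_norm// h.
have mA n (B : set R) : measurable B -> measurable (S n @^-1` B).
  by move=> mB; rewrite -[X in measurable X]setTI; exact: mS.
have uI (A : set T) : measurable A -> P A = (\int[P]_w \1_A w)%:E.
  move=> mA'; rewrite /Rintegral integral_indic// setIT fineK//.
  exact: fin_num_measure.
have norm_indic n (B : set R) : measurable B ->
    \int[P]_w \1_B `|S n w| = \int[P]_w \1_(S n @^-1` B) w.
  move=> mB; apply: ae_eq_Rintegral.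
  - by apply: measurableT_comp; [exact: measurable_indic|exact: measurableT_comp].
  - by apply: measurable_indic; exact: mA.
  - by apply: filterS normS => w ->; rewrite !indicE.
split => //.
(* Sets indexed by ['I_N] are extended by [setT] to all naturals, the indexing used by
   [sojourns_independent]. *)
- move=> N B mB; pose B' j : set R := if insub j is Some i then B i else setT.
  have B'E (i : 'I_N) : B' i = B i by rewrite /B' valK.
  have mB' j : measurable (B' j) by rewrite /B'; case: insub.
  have mC : measurable [set w | forall i : 'I_N, B i (S i w)].
    rewrite (_ : [set w | _] = \bigcap_(j in [set j | (j < N)%N]) (S j @^-1` B' j)).
      by apply: bigcap_measurableType => j _; exact: mA.
    apply/seteqP; split => w /= h i; last by rewrite -B'E; exact: (h i (ltn_ord i)).
    by move=> iN; rewrite (B'E (Ordinal iN)); exact: h.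
  rewrite (uI _ mC).
  have uB j : (j < N)%N -> unit_fun (\1_(B' j) : R -> R).
    by move=> _; exact: unit_fun_indic.
  have -> : \int[P]_w \1_[set w | forall i : 'I_N, B i (S i w)] w =
            \int[P]_w \prod_(i < N) (\1_(B' i) `|S i w| : R).
    apply: ae_eq_Rintegral.
    + exact: measurable_indic.
    + apply: measurable_prod => i _.
      by apply: measurableT_comp; [exact: measurable_indic|exact: measurableT_comp].
    apply: filterS normS => w Sw; rewrite indicE.
    have [Cw|nCw] := boolP (w \in _).
      rewrite big1// => i _; rewrite Sw B'E indicE mem_set//.
      by move: Cw; rewrite inE => /(_ i).
    have [i ni] : exists i : 'I_N, S i w \notin B i.
      apply/existsP; apply: contraNT nCw; rewrite negb_exists => /forallP h.
      rewrite inE => i; have := h i; rewrite negbK; exact: set_mem.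
    by rewrite (bigD1 i)//= Sw B'E indicE (negbTE ni) mul0r.
  have := sojourns_independent k0 la0 mu0 th0 al01 JH TS QD uB; rewrite -/S => ->.
  rewrite -prodEFin.
  by apply: eq_bigr => i _; rewrite norm_indic// B'E uI//; exact: mA.
- move=> n t t0.
  have [z z0 lz] := sojourn_survival_dominated k0 la0 mu0 th0 al01.
  have mSn : measurable_fun setT (fun w => `|S n w|) by exact: measurableT_comp.
  have lS := survival_laplace_dominated P mSn (fun w => normr_ge0 (S n w)) z0.
  have lS' : laplace_dominated z (fun u => fine (P [set w | u < `|S n w|])) 1
      (fun s => (1 - (la + k%:R * mu) / (la + k%:R * mu + laplace_exponent th al s)) / s).
    apply: eq_laplace_dominated lS => // s zs.
    by rewrite (sojourn_laplace k0 la0 mu0 th0 al01 JH TS QD)// (le_trans z0)// ltW.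
  rewrite -(laplace_dominated_inj lS' lz t0).
  rewrite fineK; last by apply: fin_num_measure; exact: measurable_lt_set.
  have mlt (f : T -> R) : measurable_fun setT f -> measurable [set w | t < f w].
    by move=> mf; exact: measurable_lt_set.
  rewrite !uI//; [|exact: mlt..].
  congr EFin; apply: ae_eq_Rintegral; [by apply: measurable_indic; exact: mlt..|].
  by apply: filterS normS => w Sw; rewrite !indicE; congr (nat_of_bool _)%:R;
    apply/idP/idP; rewrite !inE/= Sw.
Qed.
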